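(* Let $1\le p<+\infty$, let $\omega$ be a weight on $\mathbb{R}^+$, let $\phi\in C_c(\mathbb{R})$, and let $T_\phi$ be the operator $f\mapsto P^+(\phi*f)$ on $L^p_\omega(\mathbb{R}^+)$. Then: i) if $\operatorname{supp}(\phi)\subset\mathbb{R}^+$, we have $\overline{\hat\phi(\mathcal{O})}=\sigma(T_\phi)$, where $\mathcal{O}=\{z\in\mathbb{C}:\ \operatorname{Im}z<\mathfrak{a}_0\}$; ii) if $\operatorname{supp}(\phi)\subset\mathbb{R}^-$, we have $\overline{\hat\phi(\mathcal{V})}=\sigma(T_\phi)$, where $\mathcal{V}=\{z\in\mathbb{C}:\ \operatorname{Im}z>-\mathfrak{a}_1\}$.
   Context: $\mathbb{R}^+=[0,\infty)$, $\mathbb{R}^-=(-\infty,0]$; $C_c(\mathbb{R})$ is the space of continuous complex-valued functions on $\mathbb{R}$ with compact support. A weight on $\mathbb{R}^+$ is a positive continuous function $\omega$ on $\mathbb{R}^+$ with $0<\inf_{x\ge0}\frac{\omega(x+t)}{\omega(x)}\le\sup_{x\ge0}\frac{\omega(x+t)}{\omega(x)}<+\infty$ for all $t\in\mathbb{R}^+$. $L^p_\omega(\mathbb{R}^+)$ is the Banach space of (complex-valued) measurable functions $f$ on $\mathbb{R}^+$ with $\int_0^\infty|f(x)|^p\omega(x)^p\,dx<+\infty$, with the corresponding norm. Functions on $\mathbb{R}^+$ are extended by $0$ to $\mathbb{R}$ when needed (in particular in $\phi*f$), and $P^+$ is the projection restricting a function on $\mathbb{R}$ to $\mathbb{R}^+$.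 For $t\ge0$, $\mathbf{S}_t$ is the right translation by $t$ on $L^p_\omega(\mathbb{R}^+)$ ($\mathbf{S}_tf(x)=f(x-t)$ for $x\ge t$ and $0$ for $0\le x<t$), and $P^+\mathbf{S}_{-t}$ is the left translation, $(P^+\mathbf{S}_{-t}f)(x)=f(x+t)$, $x\ge0$. Set $\mathfrak{a}_0=\lim_{t\to+\infty}\ln\|\mathbf{S}_t\|^{1/t}$, $\mathfrak{a}_1=\lim_{t\to+\infty}\ln\|P^+\mathbf{S}_{-t}\|^{1/t}$. $\hat\phi(z)=\int_{\mathbb{R}}\phi(t)e^{-izt}\,dt$ for $z\in\mathbb{C}$, and $\sigma(\cdot)$ denotes the spectrum of a bounded operator on $L^p_\omega(\mathbb{R}^+)$. *)

(* Defs.v *)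
From HB Require Import structures.
From mathcomp Require Import all_boot all_order all_algebra.
From mathcomp Require Import all_classical all_reals all_analysis.
From mathcomp Require Import measurable_realfun.
From mathcomp Require Import complex ring_quotient.

Set Implicit Arguments.
Unset Strict Implicit.
Unset Printing Implicit Defensive.

Import Order.TTheory GRing.Theory Num.Theory.
Import numFieldNormedType.Exports.
Import Normc.

Local Open Scope classical_set_scope.
Local Open Scope ring_scope.
Local Open Scope complex_scope.

(* The usual topology of the complex plane [R[i]]; the library only provides
   it on the alias [R[i]^o]. *)
HB.instance Definition _ (R : rcfType) := NormedModule.copy R[i] R[i]^o.

Section complex_functions.
Context {R : realType}.
Local Notation mu := (@lebesgue_measure R).

Definition cexp (z : R[i]) : R[i] :=
  (expR (complex.Re z))%:C * (cos (complex.Im z) +i* sin (complex.Im z)).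

(* Borel measurability of a complex-valued function; every Lebesgue measurable
   function is almost everywhere equal to such a function. *)
Definition cmeasurable (f : R -> R[i]) : Prop :=
  measurable_fun setT (fun x => complex.Re (f x)) /\
  measurable_fun setT (fun x => complex.Im (f x)).

Definition cintegral (f : R -> R[i]) : R[i] :=
  (\int[mu]_x complex.Re (f x)) +i* (\int[mu]_x complex.Im (f x)).

Definition convolution (phi f : R -> R[i]) (x : R) : R[i] :=
  cintegral (fun t => phi (x - t) * f t).

Definition fourier (phi : R -> R[i]) (z : R[i]) : R[i] :=
  cintegral (fun t => phi t * cexp (- ('i * z * t%:C))).

Definition supp (phi : R -> R[i]) : set R := closure [set x | phi x != 0].

Definition Pplus (f : R -> R[i]) (x : R) : R[i] := if 0 <= x then f x else 0.

End complex_functions.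

Definition weight {R : realType} (w : R -> R) : Prop :=
  [/\ {within `[0, +oo[, continuous w},
      forall x : R, 0 <= x -> 0 < w x &
      forall t : R, 0 <= t ->
        (0 < ereal_inf [set (w (x + t) / w x)%:E | x in `[0%R, +oo[])%E /\
        (ereal_sup [set (w (x + t) / w x)%:E | x in `[0%R, +oo[] < +oo)%E].

Section spectrum.

Definition spectrum {K : numFieldType} {V : normedModType K} (T : V -> V) :
    set K :=
  [set l | ~ exists S : {linear V -> V}, [/\ continuous S,
      forall v, S (T v - l *: v) = v & forall v, T (S v) - l *: S v = v]].

(* Norms on complex normed modules take their values in [R[i]]. *)
Definition opnorm {R : realType} {V : normedModType R[i]} (T : V -> V) : R :=
  sup [set complex.Re `|T v| | v in [set v | `|v| <= 1]].

End spectrum.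

Section Lpw_norm.
Context {R : realType} (p : R) (w : R -> R).
Local Notation mu := (@lebesgue_measure R).
Implicit Types f g : R -> R[i].

Definition weighted_modulus f (x : R) : R := normc (f x) * w x.

(* For f vanishing on ]-oo, 0[, (\int_0^oo |f x|^p (w x)^p dx)^(1/p). *)
Definition eLpw_norm f : \bar R :=
  'N[mu]_(p%:E)[EFin \o weighted_modulus f].

(* The representatives of the elements of the space: functions on [0, +oo[,
   extended by 0 to the real line. *)
Definition Lpw_fun : {pred R -> R[i]} :=
  mem [set f | [/\ forall x : R, x < 0 -> f x = 0, cmeasurable f &
                   (eLpw_norm f < +oo)%E]].

End Lpw_norm.

Section Lpw_fun_theory.
Context {R : realType} (p : R) (w : R -> R) (p1 : 1 <= p) (ww : weight w).
Local Notation mu := (@lebesgue_measure R).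
Implicit Types f g : R -> R[i].

Lemma cmeasurable_normc f : cmeasurable f ->
  measurable_fun setT (fun x => normc (f x)).
Proof.
move=> [mr mi].
rewrite (_ : (fun _ => _) = Num.sqrt \o
  (fun x => complex.Re (f x) ^+ 2 + complex.Im (f x) ^+ 2)); last first.
  by apply/funext => x /=; case: (f x).
apply: measurableT_comp.
  by apply: continuous_measurable_fun; exact: sqrt_continuous.
by apply: measurable_funD; exact: measurable_funX.
Qed.

Lemma measurable_weighted_modulus f : (forall x : R, x < 0 -> f x = 0) ->
  cmeasurable f -> measurable_fun setT (weighted_modulus w f).
Proof.
move=> f0 mf; have [cw _ _] := ww.
rewrite (_ : weighted_modulus w f =
             (fun x => normc (f x)) \* (w \_ `[0, +oo[)); last first.
  apply/funext => x; rewrite /weighted_modulus /= patchE.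
  case: ifPn => //; rewrite notin_setE/= in_itv/= andbT => /negP.
  by rewrite -ltNge => /f0 ->; rewrite normc0 !mul0r.
apply: measurable_funM; first exact: cmeasurable_normc.
apply/(measurable_restrictT _ _).1 => //.
exact: subspace_continuous_measurable_fun.
Qed.


Lemma cmeasurable0 : cmeasurable (0 : R -> R[i]).
Proof. by split; exact: measurable_cst. Qed.

Lemma cmeasurableD f g : cmeasurable f -> cmeasurable g -> cmeasurable (f + g).
Proof.
move=> [fr fi] [gr gi]; split.
- rewrite (_ : (fun _ => _) =
    (fun x => complex.Re (f x)) \+ (fun x => complex.Re (g x))).
    exact: measurable_funD.
  by apply/funext => x /=; rewrite -[(f + g) x]/(f x + g x); case: (f x) (g x) => [? ?] [].
- rewrite (_ : (fun _ => _) =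
    (fun x => complex.Im (f x)) \+ (fun x => complex.Im (g x))).
    exact: measurable_funD.
  by apply/funext => x /=; rewrite -[(f + g) x]/(f x + g x); case: (f x) (g x) => [? ?] [].
Qed.

Lemma cmeasurableZ (a : R[i]) f : cmeasurable f -> cmeasurable (a *: f).
Proof.
case: a => a b [fr fi]; split.
- rewrite (_ : (fun _ => _) = (fun x => a * complex.Re (f x)) \-
                              (fun x => b * complex.Im (f x))).
    by apply: measurable_funB; apply: measurable_funM => //; exact: measurable_cst.
  by apply/funext => x /=; rewrite -[(_ *: f) x]/(_ * f x); case: (f x).
- rewrite (_ : (fun _ => _) = (fun x => a * complex.Im (f x)) \+
                              (fun x => b * complex.Re (f x))).
    by apply: measurable_funD; apply: measurable_funM => //; exact: measurable_cst.
  by apply/funext => x /=; rewrite -[(_ *: f) x]/(_ * f x); case: (f x).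
Qed.

Lemma eLpw_norm0 : eLpw_norm p w 0 = 0%E.
Proof.
rewrite /eLpw_norm (_ : _ \o _ = cst 0%E).
  by rewrite Lnorm0// eqe gt_eqF// (lt_le_trans ltr01).
by apply/funext => x; rewrite /= /weighted_modulus normc0 mul0r.
Qed.

Lemma p_neq0 : p != 0.
Proof. by rewrite gt_eqF// (lt_le_trans ltr01). Qed.

Lemma normc_ge0 (z : R[i]) : 0 <= normc z.
Proof. by case: z => ? ? /=; exact: sqrtr_ge0. Qed.

Lemma weighted_modulus_ge0 f : (forall x : R, x < 0 -> f x = 0) ->
  forall x, 0 <= weighted_modulus w f x.
Proof.
move=> f0 x; rewrite /weighted_modulus; have [x0|/f0->] := leP 0 x.
  by have [_ w0 _] := ww; rewrite mulr_ge0 ?normc_ge0// ltW// w0.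
by rewrite normc0 mul0r.
Qed.

Lemma eLpw_normE f : (forall x : R, x < 0 -> f x = 0) ->
  eLpw_norm p w f =
  ((\int[mu]_x (weighted_modulus w f x `^ p)%:E) `^ p^-1)%E.
Proof.
move=> f0; rewrite /eLpw_norm unlock; congr (_ `^ _)%E.
apply: eq_integral => x _ /=.
by rewrite ger0_norm// weighted_modulus_ge0.
Qed.

Lemma eLpw_normZ (a : R[i]) f :
  (forall x : R, x < 0 -> f x = 0) -> cmeasurable f ->
  eLpw_norm p w (a *: f) = ((normc a)%:E * eLpw_norm p w f)%E.
Proof.
move=> f0 mf; have af0 (x : R) : x < 0 -> (a *: f) x = 0.
  by move=> /f0 fx; rewrite -[LHS]/(a * f x) fx mulr0.
rewrite !eLpw_normE//.
under eq_integral.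
  move=> x _; rewrite /weighted_modulus -[(_ *: f) x]/(a * f x) normcM -mulrA powRM ?normc_ge0//.
    rewrite EFinM; over.
  exact: weighted_modulus_ge0.
rewrite ge0_integralZl//=.
- rewrite poweRM ?integral_ge0// ?lee_fin ?powR_ge0//.
  by rewrite poweR_EFin -powRrM mulfV ?p_neq0// powRr1// normc_ge0.
- by move=> x _; rewrite lee_fin powR_ge0.
- apply/measurable_EFinP; apply: (measurableT_comp (measurable_powR p)).
  exact: measurable_weighted_modulus.
- by move=> x _; rewrite lee_fin powR_ge0.
- by rewrite lee_fin powR_ge0.
Qed.

Lemma eLpw_normD f g :
  (forall x : R, x < 0 -> f x = 0) -> cmeasurable f ->
  (forall x : R, x < 0 -> g x = 0) -> cmeasurable g ->
  (eLpw_norm p w (f + g)%R <= eLpw_norm p w f + eLpw_norm p w g)%E.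
Proof.
move=> f0 mf g0 mg.
have fg0 (x : R) : x < 0 -> (f + g) x = 0.
  by move=> x0; rewrite -[LHS]/(f x + g x) f0// g0// addr0.
have mF := measurable_weighted_modulus f0 mf.
have mG := measurable_weighted_modulus g0 mg.
apply: le_trans (minkowski_EFin mu mF mG p1).
rewrite eLpw_normE// unlock gt0_ler_poweR//.
- by rewrite invr_ge0 (le_trans ler01).
- by rewrite in_itv/= leey integral_ge0// => x _; rewrite lee_fin powR_ge0.
- by rewrite in_itv/= leey integral_ge0// => x _; rewrite poweR_ge0.
apply: ge0_le_integral => //=.
- by move=> x _; rewrite lee_fin powR_ge0.
- apply/measurable_EFinP; apply: (measurableT_comp (measurable_powR p)).
  by apply: measurable_weighted_modulus => //; exact: cmeasurableD.
- apply/measurable_EFinP; apply: (measurableT_comp (measurable_powR p)).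
  by apply: measurableT_comp => //; exact: measurable_funD.
move=> x _; rewrite lee_fin; apply: ge0_ler_powR.
- exact: le_trans ler01 p1.
- by rewrite nnegrE weighted_modulus_ge0.
- by rewrite nnegrE.
rewrite ger0_norm ?addr_ge0 ?weighted_modulus_ge0// /weighted_modulus.
have [x0|x0] := leP 0 x; last first.
  by rewrite -[(f + g) x]/(f x + g x) f0// g0// addr0 normc0 !mul0r addr0.
rewrite -mulrDl ler_wpM2r//; last exact: le_normcD.
by have [_ w0 _] := ww; rewrite ltW// w0.
Qed.

Lemma Lpw_fun_submod_closed : submod_closed (Lpw_fun p w).
Proof.
split.
  by rewrite inE; split; [|exact: cmeasurable0|rewrite eLpw_norm0].
move=> a f g; rewrite !inE => -[f0 mf fy] [g0 mg gy].
have af0 (x : R) : x < 0 -> (a *: f) x = 0.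
  by move=> /f0 fx; rewrite -[LHS]/(a * f x) fx mulr0.
split.
- by move=> x x0; rewrite -[LHS]/((a *: f) x + g x) af0// g0// addr0.
- exact/cmeasurableD/mg/cmeasurableZ.
- rewrite (le_lt_trans (eLpw_normD _ _ _ _))//; first exact: cmeasurableZ.
  rewrite lte_add_pinfty// eLpw_normZ// lte_mul_pinfty// ?lee_fin//.
  by case: (a) => ? ? /=; exact: sqrtr_ge0.
Qed.

End Lpw_fun_theory.


Record LpwFun {R : realType} {p : R} {w : R -> R}
    (p1 : 1 <= p) (ww : weight w) := MkLpwFun {
  Lpw_val :> R -> R[i];
  Lpw_valP : Lpw_val \in Lpw_fun p w }.

Section Lpw_def.
Context {R : realType} (p : R) (w : R -> R) (p1 : 1 <= p) (ww : weight w).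
Local Notation mu := (@lebesgue_measure R).
Local Notation LpwFun := (LpwFun p1 ww).

HB.instance Definition _ := [isSub for @Lpw_val R p w p1 ww].
HB.instance Definition _ := [Choice of LpwFun by <:].
#[local] HB.instance Definition _ :=
  GRing.isSubmodClosed.Build _ _ (Lpw_fun p w) (Lpw_fun_submod_closed p1 ww).
HB.instance Definition _ := [SubChoice_isSubLmodule of LpwFun by <:].

Definition Lpw_null : {pred LpwFun} :=
  mem [set f : LpwFun | {ae mu, forall x, f x = 0}].

#[local] Instance ae_mu_filter : Filter (nbhs (almost_everywhere mu)).
Proof. exact: ae_filter_ringOfSetsType. Qed.

Lemma Lpw_null_zmod_closed : zmod_closed Lpw_null.
Proof.
split; first by rewrite inE; exact: aeW.
move=> f g; rewrite !inE => f0 g0.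
have h := filterS2 _ _ f0 g0; apply: h => x fx gx.
by rewrite -[LHS]/(f x - g x) fx gx subrr.
Qed.

HB.instance Definition _ :=
  GRing.isZmodClosed.Build _ Lpw_null Lpw_null_zmod_closed.

Definition Lpw : Type := Quotient.quot Lpw_null.

HB.instance Definition _ := Choice.on Lpw.
HB.instance Definition _ := GRing.Zmodule.on Lpw.
HB.instance Definition _ := EqQuotient.on Lpw.

Lemma Lpw_pi_eqP (f g : LpwFun) :
  reflect {ae mu, forall x, f x = g x} (\pi_Lpw f == \pi_Lpw g)%qT.
Proof.
rewrite -Quotient.idealrBE; apply: (iffP idP); rewrite inE => h.
  by have h' := filterS _ h; apply: h' => x /eqP; rewrite subr_eq0 => /eqP.
by have h' := filterS _ h; apply: h' => x fg; rewrite -[LHS]/(f x - g x) fg subrr.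
Qed.

Lemma Lpw_reprP (f : LpwFun) : {ae mu, forall x, repr (\pi_Lpw f)%qT x = f x}.
Proof. by apply/Lpw_pi_eqP; rewrite reprK. Qed.

Definition Lpw_scale (a : R[i]) (u : Lpw) : Lpw := (\pi_Lpw (a *: repr u))%qT.

Lemma Lpw_scale_pi a (f : LpwFun) :
  Lpw_scale a (\pi_Lpw f)%qT = (\pi_Lpw (a *: f))%qT.
Proof.
apply/eqP/Lpw_pi_eqP; have h := filterS _ (Lpw_reprP f); apply: h => x fx.
by rewrite -[LHS]/(a * repr (\pi_Lpw f)%qT x) fx.
Qed.

Lemma Lpw_scalerA a b u : Lpw_scale a (Lpw_scale b u) = Lpw_scale (a * b) u.
Proof.
rewrite -[u]reprK; move: (repr u) => f.
by rewrite (Lpw_scale_pi b f) !Lpw_scale_pi scalerA.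
Qed.

Lemma Lpw_scale1r : left_id 1 Lpw_scale.
Proof.
move=> u; rewrite -[u]reprK; move: (repr u) => f.
by rewrite Lpw_scale_pi scale1r.
Qed.

Lemma Lpw_piD (f g : LpwFun) : (\pi_Lpw (f + g) = \pi_Lpw f + \pi_Lpw g)%qT.
Proof. by rewrite !piE. Qed.

Lemma Lpw_scalerDr : right_distributive Lpw_scale +%R.
Proof.
move=> a u v; rewrite -[u]reprK -[v]reprK.
move: (repr u) (repr v) => f g.
by rewrite -(Lpw_piD f g) (Lpw_scale_pi a f) (Lpw_scale_pi a g) Lpw_scale_pi
  -Lpw_piD scalerDr.
Qed.

Lemma Lpw_scalerDl u : {morph Lpw_scale^~ u : a b / a + b}.
Proof.
move=> a b; rewrite -[u]reprK; move: (repr u) => f.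
by rewrite (Lpw_scale_pi a f) (Lpw_scale_pi b f) Lpw_scale_pi -Lpw_piD scalerDl.
Qed.

HB.instance Definition _ := GRing.Zmodule_isLmodule.Build R[i] Lpw
  Lpw_scalerA Lpw_scale1r Lpw_scalerDr Lpw_scalerDl.

Definition Lpw_norm (u : Lpw) : R := fine (eLpw_norm p w (repr u)).

Let Lpw_funP (f : LpwFun) : [/\ forall x : R, x < 0 -> f x = 0, cmeasurable f &
  (eLpw_norm p w f < +oo)%E].
Proof. by have := Lpw_valP f; rewrite inE. Qed.

Lemma eLpw_norm_fin (f : LpwFun) : eLpw_norm p w f \is a fin_num.
Proof. by have [_ _ fy] := Lpw_funP f; rewrite ge0_fin_numE// Lnorm_ge0. Qed.

Lemma eq_eLpw_norm (f g : LpwFun) : {ae mu, forall x, f x = g x} ->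
  eLpw_norm p w f = eLpw_norm p w g.
Proof.
move=> fg; have [f0 mf _] := Lpw_funP f; have [g0 mg _] := Lpw_funP g.
rewrite !eLpw_normE//; congr (_ `^ _)%E; apply: ae_eq_integral => //.
- apply/measurable_EFinP; apply: (measurableT_comp (measurable_powR p)).
  exact: measurable_weighted_modulus.
- apply/measurable_EFinP; apply: (measurableT_comp (measurable_powR p)).
  exact: measurable_weighted_modulus.
- by have h := filterS _ fg; apply: h => x fgx _; rewrite /weighted_modulus fgx.
Qed.

Lemma Lpw_norm_pi (f : LpwFun) :
  Lpw_norm (\pi_Lpw f)%qT = fine (eLpw_norm p w f).
Proof. by congr fine; apply: eq_eLpw_norm; exact: Lpw_reprP. Qed.

Lemma Lpw_normD u v :
  (Lpw_norm (u + v))%:C <= (Lpw_norm u)%:C + (Lpw_norm v)%:C.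
Proof.
rewrite -rmorphD lecR -[u]reprK -[v]reprK.
move: (repr u) (repr v) => f g; rewrite -(Lpw_piD f g) !Lpw_norm_pi.
have [? ? _] := Lpw_funP f; have [? ? _] := Lpw_funP g.
rewrite -fineD ?eLpw_norm_fin// fine_le ?fin_numD ?eLpw_norm_fin//.
exact: eLpw_normD.
Qed.

Lemma Lpw_normZ (a : R[i]) u :
  (Lpw_norm (a *: u))%:C = `|a| * (Lpw_norm u)%:C.
Proof.
have [? ? _] := Lpw_funP (repr u).
rewrite -[`|a|]/((normc a)%:C) -rmorphM; congr (_%:C).
rewrite -[LHS]/(Lpw_norm (\pi_Lpw (a *: repr u))%qT) Lpw_norm_pi.
by rewrite eLpw_normZ// fineM ?eLpw_norm_fin.
Qed.

Lemma Lpw_norm0_eq0 u : (Lpw_norm u)%:C = 0 -> u = 0.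
Proof.
move=> [] u0; have [f0 mf _] := Lpw_funP (repr u).
have mF : measurable_fun setT (EFin \o weighted_modulus w (repr u)).
  by apply/measurable_EFinP; exact: measurable_weighted_modulus.
have p0 : (0 < p%:E)%E by rewrite lte_fin (lt_le_trans ltr01).
have uE : eLpw_norm p w (repr u) = 0%E.
  by rewrite -[LHS]fineK ?eLpw_norm_fin// -/(Lpw_norm u) u0.
have ae0 := @Lnorm_eq0_eq0 _ _ _ mu _ _ mF p0 uE.
rewrite -[u]reprK -[0]reprK; apply/eqP/Lpw_pi_eqP.
have r0 := Lpw_reprP (0 : LpwFun); have h := filterS2 _ _ ae0 r0; apply: h => x /= /(_ I).
rewrite (_ : (\pi_Lpw (0 : LpwFun))%qT = 0); last by rewrite piE.
move=> [] + ->; have [x0|/f0//] := leP 0 x; rewrite /weighted_modulus.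
have [_ w0 _] := ww; move/eqP; rewrite mulf_eq0 (gt_eqF (w0 _ x0)) orbF.
by move=> /eqP/eq0_normc.
Qed.

HB.instance Definition _ := @Lmodule_isNormed.Build R[i] Lpw
  (fun u => (Lpw_norm u)%:C) Lpw_normD Lpw_normZ Lpw_norm0_eq0.

Lemma Lpw_normE (u : Lpw) : `|u| = (Lpw_norm u)%:C.
Proof. by []. Qed.

End Lpw_def.

Section operators.
Context {R : realType} {p : R} {w : R -> R} (p1 : 1 <= p) (ww : weight w).
Local Notation mu := (@lebesgue_measure R).
Local Notation Lpw := (Lpw p1 ww).
Local Notation LpwFun := (LpwFun p1 ww).

(* The class of f, with the default value 0 when f is not p-integrable with
   respect to the weight; Lpw_ofP covers the meaningful case. *)
Definition Lpw_of (f : R -> R[i]) : Lpw :=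
  if insub f is Some g then (\pi_Lpw (g : LpwFun))%qT else 0.

Lemma Lpw_ofP f : f \in Lpw_fun p w ->
  {ae mu, forall x, repr (Lpw_of f) x = f x}.
Proof.
move=> fP; rewrite /Lpw_of insubT /=.
exact: (@Lpw_reprP _ _ _ p1 ww (MkLpwFun p1 ww fP)).
Qed.

(* For 0 <= t, Lpw_shift t is the right translation S_t (representatives vanish
   on ]-oo, 0[) and Lpw_shift (- t) is the left translation P^+ S_(-t). *)
Definition Lpw_shift (t : R) (u : Lpw) : Lpw :=
  Lpw_of (Pplus (fun x => repr u (x - t))).

Definition growth_right : R :=
  lim (ln (opnorm (Lpw_shift t) `^ t^-1) @[t --> +oo]).

Definition growth_left : R :=
  lim (ln (opnorm (Lpw_shift (- t)) `^ t^-1) @[t --> +oo]).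

Definition wiener_hopf (phi : R -> R[i]) (u : Lpw) : Lpw :=
  Lpw_of (Pplus (convolution phi (repr u))).

End operators.

Arguments Lpw_shift {R p w} p1 ww t u.
Arguments wiener_hopf {R p w} p1 ww phi u.

(* Main.v *)
From HB Require Import structures.
Require Import Defs.
From mathcomp Require Import all_boot all_order all_algebra.
From mathcomp Require Import all_classical all_reals all_analysis.
From mathcomp Require Import measurable_realfun.
From mathcomp Require Import complex ring lra.

(** Write [a] for the growth exponent of the translations towards the side of
    the kernel. [weight_local] and [exists_exp_growth] express it through the
    weight alone, and [growth_right_eq] and [growth_left_eq] identify it with
    the exponent of the operator norms of the translations, because the
    indicator of a unit interval already detects these norms up to a constant.
    Left translations for [w] behave as right translations for [1 / w].

    Symbol values are spectral ([causal_spectral_inclusion] and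
    [anticausal_spectral_inclusion]). Suppose [lam] is close to the value of
    the symbol at [zeta], with [Im zeta < a], and that [T - lam] has a bounded
    inverse [S]. The exponential [expi zeta] cut off to [[0, N)] is an
    approximate eigenvector of the transpose of [T] (of [T] itself, for the
    opposite frequency, in the anticausal case): the error lives near [N].
    Since [S] commutes with the translations, the functionals given by the
    iterates of [S] on a function supported in [[0, 1]] decay like [exp (- a
    n)] on [[n, n + 1]], whereas the error only grows like [exp (Im zeta *
    N)]. Iterating the eigenvector equation ([exponential_test_small]) shows
    that the pairing of the truncated exponential with a fixed function tends
    to 0, although it equals 1 for every [N].

    Other values are regular ([causal_regular] and [anticausal_regular]). If
    [lam - fourier phi] is bounded away from 0 on the half-plane, it remains
    so on a slightly larger one ([resolvent_beyond]). The kernel [phi / lam]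
    then has a convolution resolvent [psi] that is [O(exp (- b t))] for some
    [b > a] ([resolvent_kernel]). A kernel with that decay defines a bounded
    operator ([kernel_dom_causal], [eLpw_norm_convolution]), and the operator
    of [psi] provides the inverse of [T - lam] ([wiener_hopf_regular]).

    The resolvent exists by a Neumann series with some exponential bound
    ([volterra_resolvent]); the optimal rate is reached by lowering the rate
    in finitely many equal steps, each of which is an energy estimate
    ([resolvent_step]) resting on an inequality of Plancherel type
    ([plancherel_le]). The latter is proved without inverting the Fourier
    transform, from the positivity criterion [cos_transform_ge0]. *)

Set Implicit Arguments.
Unset Strict Implicit.
Unset Printing Implicit Defensive.

Import Order.TTheory GRing.Theory Num.Theory.
Import numFieldNormedType.Exports.
Import Normc.

Local Open Scope classical_set_scope.
Local Open Scope ring_scope.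
Local Open Scope complex_scope.

(** * Complex numbers and measure-preserving maps of the line *)

Section complex_measurability.
Context {R : realType}.
Implicit Types z w : R[i].

Lemma normc_ge_normRe z : `|complex.Re z| <= normc z.
Proof.
case: z => a b /=; rewrite -sqrtr_sqr ler_wsqrtr// lerDl sqr_ge0//.
Qed.

Lemma normc_ge_normIm z : `|complex.Im z| <= normc z.
Proof.
case: z => a b /=; rewrite -sqrtr_sqr ler_wsqrtr// lerDr sqr_ge0//.
Qed.

Lemma normc_le_normReIm z : normc z <= `|complex.Re z| + `|complex.Im z|.
Proof.
case: z => a b /=; rewrite -[leRHS]ger0_norm ?addr_ge0// -sqrtr_sqr.
rewrite ler_wsqrtr// sqrrD !real_normK ?num_real// lerD2r lerDl.
by rewrite mulrn_wge0// mulr_ge0.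
Qed.

Lemma normcC (r : R) : normc r%:C = `|r|.
Proof. by rewrite /= expr0n addr0 sqrtr_sqr. Qed.

Lemma normc_eq0 z : (normc z == 0) = (z == 0).
Proof.
apply/eqP/eqP => [/eq0_normc//|->]; exact: normc0.
Qed.

Lemma normc_conj z : normc (conjc z) = normc z.
Proof. by case: z => a b; rewrite /= sqrrN. Qed.

Lemma ReD z w : complex.Re (z + w) = complex.Re z + complex.Re w.
Proof. by case: z w => [? ?] []. Qed.

Lemma ImD z w : complex.Im (z + w) = complex.Im z + complex.Im w.
Proof. by case: z w => [? ?] []. Qed.

Lemma conjcM z w : conjc (z * w) = conjc z * conjc w.
Proof. exact: rmorphM. Qed.

Lemma normc_gt0 z : (0 < normc z) = (z != 0).
Proof. by rewrite lt_neqAle normc_ge0 andbT eq_sym normc_eq0. Qed.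

Lemma normcB z w : normc (z - w) <= normc z + normc w.
Proof. by rewrite -[normc w]normcN; exact: le_normcD. Qed.

Lemma normc_subC z w : normc (z - w) = normc (w - z).
Proof. by rewrite -normcN opprB. Qed.

Lemma cnormE z : `|z| = (normc z)%:C.
Proof. by []. Qed.

Lemma normc_sqr z : normc z ^+ 2 = complex.Re z ^+ 2 + complex.Im z ^+ 2.
Proof. by case: z => a b; rewrite /= sqr_sqrtr// addr_ge0// sqr_ge0. Qed.

Lemma cexpD z w : cexp (z + w) = cexp z * cexp w.
Proof.
rewrite /cexp !raddfD/= expRD cosD sinD.
by apply/eqP; rewrite eq_complex/=; apply/andP; split; apply/eqP; ring.
Qed.

Lemma normc_cexp z : normc (cexp z) = expR (complex.Re z).
Proof.
rewrite /cexp normcM normcC ger0_norm ?expR_ge0//.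
by rewrite /= cos2Dsin2 sqrtr1 mulr1.
Qed.

Lemma cexp0 : cexp (0 : R[i]) = 1.
Proof.
by rewrite /cexp/= expR0 cos0 sin0 mul1r.
Qed.

Section cmeas.
Context d (T : measurableType d).
Implicit Types f g : T -> R[i].

(** Measurability on an arbitrary domain, so that integrands of two variables
    can be treated by the same rules as functions on the line. *)
Definition cmeas f : Prop :=
  measurable_fun setT (fun x => complex.Re (f x)) /\
  measurable_fun setT (fun x => complex.Im (f x)).

Lemma cmeas_cst z : cmeas (fun=> z).
Proof. by split; exact: measurable_cst. Qed.

Lemma cmeasD f g : cmeas f -> cmeas g -> cmeas (fun x => f x + g x).
Proof.
move=> [fr fi] [gr gi]; split.
- by under eq_fun do rewrite raddfD/=; exact: measurable_funD.
- by under eq_fun do rewrite raddfD/=; exact: measurable_funD.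
Qed.

Lemma cmeasM f g : cmeas f -> cmeas g -> cmeas (fun x => f x * g x).
Proof.
move=> [fr fi] [gr gi]; split.
- rewrite (_ : (fun _ => _) = (fun x => complex.Re (f x) * complex.Re (g x) - complex.Im (f x) * complex.Im (g x))).
    by apply: measurable_funB; exact: measurable_funM.
  by apply/funext => x; case: (f x); case: (g x).
- rewrite (_ : (fun _ => _) = (fun x => complex.Re (f x) * complex.Im (g x) + complex.Im (f x) * complex.Re (g x))).
    by apply: measurable_funD; exact: measurable_funM.
  by apply/funext => x; case: (f x); case: (g x).
Qed.

Lemma cmeasN f : cmeas f -> cmeas (fun x => - f x).
Proof.
move=> mf; under eq_fun do rewrite -mulN1r.
by apply: cmeasM => //; exact: cmeas_cst.
Qed.

Lemma cmeasB f g : cmeas f -> cmeas g -> cmeas (fun x => f x - g x).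
Proof. by move=> mf mg; apply: cmeasD => //; exact: cmeasN. Qed.

Lemma cmeasJ f : cmeas f -> cmeas (fun x => conjc (f x)).
Proof.
move=> [fr fi]; split.
- by rewrite (_ : (fun _ => _) = (fun x => complex.Re (f x)))//; apply/funext => x; case: (f x).
- rewrite (_ : (fun _ => _) = (fun x => - complex.Im (f x))).
    by apply: measurableT_comp => //.
  by apply/funext => x; case: (f x).
Qed.

Lemma cmeas_realC (h : T -> R) : measurable_fun setT h -> cmeas (fun x => (h x)%:C).
Proof. by move=> mh; split => //; exact: measurable_cst. Qed.

Lemma cmeas_if (b : T -> bool) f g : measurable_fun setT b ->
  cmeas f -> cmeas g -> cmeas (fun x => if b x then f x else g x).
Proof.
move=> mb [fr fi] [gr gi]; split.
- rewrite (_ : (fun _ => _) = (fun x => if b x then complex.Re (f x) else complex.Re (g x))).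
    by apply: measurable_fun_ifT.
  by apply/funext => x; case: (b x).
- rewrite (_ : (fun _ => _) = (fun x => if b x then complex.Im (f x) else complex.Im (g x))).
    by apply: measurable_fun_ifT.
  by apply/funext => x; case: (b x).
Qed.

Lemma measurable_normc f : cmeas f -> measurable_fun setT (fun x => normc (f x)).
Proof.
move=> [mr mi].
rewrite (_ : (fun _ => _) = Num.sqrt \o
  (fun x => complex.Re (f x) ^+ 2 + complex.Im (f x) ^+ 2)); last first.
  by apply/funext => x /=; case: (f x).
apply: measurableT_comp.
  by apply: continuous_measurable_fun; exact: sqrt_continuous.
by apply: measurable_funD; exact: measurable_funX.
Qed.

End cmeas.

Lemma cmeas_comp d d' (T : measurableType d) (T' : measurableType d')
    (h : T -> T') (f : T' -> R[i]) :
  measurable_fun setT h -> cmeas f -> cmeas (f \o h).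
Proof. by move=> mh [fr fi]; split; [exact: (measurableT_comp fr mh)|exact: (measurableT_comp fi mh)]. Qed.

Lemma cmeas_cexp d (T : measurableType d) (f : T -> R[i]) : cmeas f -> cmeas (fun x => cexp (f x)).
Proof.
move=> [fr fi]; rewrite /cexp; apply: cmeasM.
  by apply: cmeas_realC; apply: (measurableT_comp (@measurable_expR R)) => //.
split => /=.
- by apply: (measurableT_comp (continuous_measurable_fun (@continuous_cos R))) => //.
- by apply: (measurableT_comp (continuous_measurable_fun (@continuous_sin R))) => //.
Qed.

End complex_measurability.

#[export] Instance ae_lebesgue_filter (R : realType) :
  Filter (nbhs (almost_everywhere (@lebesgue_measure R))).
Proof. exact: ae_filter_ringOfSetsType. Qed.

Section invariance.
Context {R : realType}.
Local Notation mu := (@lebesgue_measure R).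

Definition mpres (h : R -> R) := measurable_fun setT (h : measurableTypeR R -> measurableTypeR R) /\
  forall A, measurable A -> mu (h @^-1` A) = mu A.

Lemma mpresN : mpres -%R.
Proof.
split; first exact: oppr_measurable.
exact: lebesgue_measureN.
Qed.

Lemma mpresD (a : R) : mpres (fun x => x + a).
Proof.
have mh : measurable_fun setT ((fun x => x + a) : measurableTypeR R -> measurableTypeR R).
  by apply: measurable_funD => //; exact: measurable_cst.
split => // A mA; apply/esym.
pose h := ((fun x => x + a) : measurableTypeR R -> measurableTypeR R).
apply: (@lebesgue_measure_unique R (pushforward mu h)) => // _ [[x y]] _ <-.
rewrite /pushforward.
have hE : h @^-1` `]x, y]%classic = `]x - a, y - a]%classic; last first.
  rewrite [RHS](_ : _ = mu `]x - a, y - a]%classic); last by rewrite -hE.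
  by rewrite !lebesgue_measure_itv/= !lte_fin ltrD2r -!EFinB; congr (if _ then _%:E else _); ring.
apply/seteqP; split=> z /=; rewrite !in_itv/= /h; lra.
Qed.

Lemma mpres_comp h k : mpres h -> mpres k -> mpres (h \o k).
Proof.
move=> [mh ph] [mk pk]; split; first exact: measurableT_comp.
move=> A mA; rewrite comp_preimage pk ?ph//.
by rewrite -[X in measurable X]setTI; exact: mh.
Qed.

Lemma mpres_sub (a : R) : mpres (fun x => a - x).
Proof.
rewrite (_ : (fun x => _) = (fun x => x + a) \o -%R).
  by apply: mpres_comp; [exact: mpresD|exact: mpresN].
by apply/funext => x /=; rewrite addrC.
Qed.

Lemma mpres_subr (a : R) : mpres (fun x => x - a).
Proof. exact: mpresD. Qed.

Lemma integral_mpres h (f : R -> \bar R) : mpres h -> measurable_fun setT f ->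
  (\int[mu]_x f (h x) = \int[mu]_x f x)%E.
Proof.
move=> [mh ph] mf.
pose h' : measurableTypeR R -> measurableTypeR R := h.
have ge0 (g : measurableTypeR R -> \bar R) : measurable_fun setT g -> (forall x, 0 <= g x)%E ->
    (\int[mu]_x g (h x) = \int[mu]_x g x)%E.
  move=> mg g0.
  have <- : (\int[pushforward mu h']_x g x = \int[mu]_x g x)%E.
    by apply: eq_measure_integral => A mA _; exact: ph.
  by rewrite (@ge0_integral_pushforward _ _ _ _ _ h' mh).
have mf' : measurable_fun setT (f : measurableTypeR R -> \bar R) := mf.
rewrite [LHS]integralE [RHS]integralE; congr (_ - _)%E.
- rewrite -[RHS]ge0//; last exact: measurable_funepos mf'.
  by under eq_integral do rewrite (funepos_comp f h).
- rewrite -[RHS]ge0//; last exact: measurable_funeneg mf'.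
  by under eq_integral do rewrite (funeneg_comp f h).
Qed.

Lemma Rintegral_mpres h (f : R -> R) : mpres h -> measurable_fun setT f ->
  \int[mu]_x f (h x) = \int[mu]_x f x.
Proof.
move=> ph mf; rewrite /Rintegral; congr fine.
by apply: (@integral_mpres h (EFin \o f)) => //; exact/measurable_EFinP.
Qed.

Lemma ae_mpres h (P : R -> Prop) : mpres h ->
  {ae mu, forall x, P x} -> {ae mu, forall x, P (h x)}.
Proof.
move=> [mh ph] [N [mN N0 subN]]; exists (h @^-1` N); split.
- by rewrite -[X in measurable X]setTI; exact: mh.
- by rewrite [LHS]ph.
- by move=> x /=; exact: subN.
Qed.

Lemma cintegral_mpres h (f : R -> R[i]) : mpres h -> cmeasurable f ->
  cintegral (fun x => f (h x)) = cintegral f.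
Proof.
move=> ph [mr mi]; rewrite /cintegral; congr (_ +i* _).
- exact: (Rintegral_mpres ph mr).
- exact: (Rintegral_mpres ph mi).
Qed.

End invariance.

(** * Integrable complex-valued functions *)

Section complex_integral.
Context {R : realType}.
Local Notation mu := (@lebesgue_measure R).
Local Notation mR := (measurableTypeR R).
Implicit Types (f g : R -> R[i]) (c : R[i]).

Lemma RintegrableZl (k : R) (f : R -> R) :
  mu.-integrable setT (fun x => (f x)%:E) ->
  mu.-integrable setT (fun x => (k * f x)%:E).
Proof. by move=> jf; have := integrableZl measurableT k jf. Qed.

Definition L1 f := cmeasurable f /\ (\int[mu]_x (normc (f x))%:E < +oo)%E.

Lemma L1P f : L1 f <-> cmeasurable f /\
  mu.-integrable setT (fun x => (normc (f x))%:E).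
Proof.
split=> [[mf fy]|[mf /integrableP[_ fy]]]; split => //.
  apply/integrableP; split.
    by apply/measurable_EFinP; exact: measurable_normc.
  by under eq_integral do rewrite /= ger0_norm ?normc_ge0//.
apply: le_lt_trans fy; apply: ge0_le_integral => //=.
- by move=> x _; rewrite lee_fin normc_ge0.
- by apply/measurable_EFinP; exact: measurable_normc.
- by apply/measurable_EFinP; apply: measurableT_comp => //; exact: measurable_normc.
- by move=> x _; rewrite lee_fin ler_norm.
Qed.

Lemma L1_integrable_normc f : L1 f ->
  mu.-integrable setT (fun x => (normc (f x))%:E).
Proof. by move=> /L1P[]. Qed.

Lemma L1_cmeasurable f : L1 f -> cmeasurable f.
Proof. by case. Qed.

Lemma L1_dominated f (g : R -> R) : cmeasurable f ->
  mu.-integrable setT (EFin \o g) -> (forall x, normc (f x) <= g x) -> L1 f.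
Proof.
move=> mf ig fg; apply/L1P; split => //.
apply: le_integrable ig => //.
- by apply/measurable_EFinP; exact: measurable_normc.
- by move=> x _ /=; rewrite lee_fin ger0_norm ?normc_ge0// (le_trans (fg x))// ler_norm.
Qed.

Lemma L1_integrable_Re f : L1 f -> mu.-integrable setT (fun x => (complex.Re (f x))%:E).
Proof.
move=> /L1P[[mr mi] i]; apply: le_integrable i => //.
- exact/measurable_EFinP.
- by move=> x _ /=; rewrite lee_fin (ger0_norm (normc_ge0 _)) normc_ge_normRe.
Qed.

Lemma L1_integrable_Im f : L1 f -> mu.-integrable setT (fun x => (complex.Im (f x))%:E).
Proof.
move=> /L1P[[mr mi] i]; apply: le_integrable i => //.
- exact/measurable_EFinP.
- by move=> x _ /=; rewrite lee_fin (ger0_norm (normc_ge0 _)) normc_ge_normIm.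
Qed.

Lemma L1D f g : L1 f -> L1 g -> L1 (fun x => f x + g x).
Proof.
move=> /L1P[mf jf] /L1P[mg jg].
apply: (@L1_dominated _ (fun x => normc (f x) + normc (g x))).
- exact: cmeasD.
- exact: (integrableD _ jf jg).
- by move=> x; exact: le_normcD.
Qed.

Lemma L1Z c f : L1 f -> L1 (fun x => c * f x).
Proof.
move=> /L1P[mf jf]; apply: (@L1_dominated _ (fun x => normc c * normc (f x))).
- by apply: cmeasM => //; exact: cmeas_cst.
- exact: RintegrableZl.
- by move=> x; rewrite normcM.
Qed.

Lemma L1B f g : L1 f -> L1 g -> L1 (fun x => f x - g x).
Proof.
move=> jf jg; rewrite (_ : (fun _ => _) = fun x => f x + (-1) * g x).
  by apply: L1D => //; exact: L1Z.
by apply/funext => x; rewrite mulN1r.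
Qed.

Lemma L1_mpres h f : mpres h -> L1 f -> L1 (f \o h).
Proof.
move=> ph [mf fy]; have [mh _] := ph; split; first exact: (cmeas_comp mh).
rewrite (@integral_mpres R h (fun x => (normc (f x))%:E))//.
by apply/measurable_EFinP; exact: measurable_normc.
Qed.

Lemma L1_Mbounded f g (M : R) : cmeasurable f -> (forall x, normc (f x) <= M) ->
  L1 g -> L1 (fun x => f x * g x).
Proof.
move=> mf fM /L1P[mg jg]; apply: (@L1_dominated _ (fun x => M * normc (g x))).
- exact: cmeasM.
- exact: RintegrableZl.
- by move=> x; rewrite normcM ler_wpM2r ?normc_ge0.
Qed.

Lemma cintegralD f g : L1 f -> L1 g ->
  cintegral (fun x => f x + g x) = cintegral f + cintegral g.
Proof.
move=> jf jg; rewrite /cintegral; apply/eqP; rewrite eq_complex/=.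
have E1 x : complex.Re (f x + g x) = complex.Re (f x) + complex.Re (g x) by rewrite raddfD.
have E2 x : complex.Im (f x + g x) = complex.Im (f x) + complex.Im (g x) by rewrite raddfD.
under eq_Rintegral do rewrite E1.
under [X in _ && (X == _)]eq_Rintegral do rewrite E2.
rewrite !RintegralD ?eqxx//; [exact: L1_integrable_Im|exact: L1_integrable_Im|exact: L1_integrable_Re|exact: L1_integrable_Re].
Qed.

Lemma cintegralZ c f : L1 f -> cintegral (fun x => c * f x) = c * cintegral f.
Proof.
move=> jf; have jr := L1_integrable_Re jf; have ji := L1_integrable_Im jf.
case: c => a b; rewrite /cintegral; apply/eqP; rewrite eq_complex/=.
have E1 x : complex.Re ((a +i* b) * f x) = a * complex.Re (f x) - b * complex.Im (f x).
  by case: (f x).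
have E2 x : complex.Im ((a +i* b) * f x) = a * complex.Im (f x) + b * complex.Re (f x).
  by case: (f x).
under eq_Rintegral do rewrite E1.
under [X in _ && (X == _)]eq_Rintegral do rewrite E2.
rewrite RintegralB//; [|exact: RintegrableZl|exact: RintegrableZl].
rewrite RintegralD//; [|exact: RintegrableZl|exact: RintegrableZl].
by rewrite !RintegralZl// !eqxx.
Qed.

Lemma cintegralZr c f : L1 f -> cintegral (fun x => f x * c) = cintegral f * c.
Proof.
move=> jf; rewrite mulrC -cintegralZ//; congr cintegral.
by apply/funext => x; rewrite mulrC.
Qed.

Lemma cintegral0 : cintegral (fun=> 0 : R[i]) = 0.
Proof. by rewrite /cintegral/= Rintegral_cst// mul0r. Qed.

Lemma cintegralB f g : L1 f -> L1 g ->
  cintegral (fun x => f x - g x) = cintegral f - cintegral g.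
Proof.
move=> jf jg; rewrite -mulN1r -cintegralZ// -cintegralD//; last exact: L1Z.
by congr cintegral; apply/funext => x; rewrite mulN1r.
Qed.

Lemma ae_eq_cintegral f g : cmeasurable f -> cmeasurable g ->
  {ae mu, forall x, f x = g x} -> cintegral f = cintegral g.
Proof.
move=> [fr fi] [gr gi] fg; rewrite /cintegral /Rintegral; congr (fine _ +i* fine _).
- apply: ae_eq_integral => //; [exact/measurable_EFinP|exact/measurable_EFinP|].
  by have h := filterS _ fg; apply: h => x /= ->.
- apply: ae_eq_integral => //; [exact/measurable_EFinP|exact/measurable_EFinP|].
  by have h := filterS _ fg; apply: h => x /= ->.
Qed.

Lemma normc_cintegral f : L1 f -> normc (cintegral f) <= \int[mu]_x normc (f x).
Proof.
move=> jf; have jn := L1_integrable_normc jf.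
have [->|I0] := eqVneq (cintegral f) 0.
  by rewrite normc0; apply: Rintegral_ge0 => x _; exact: normc_ge0.
set I := cintegral f in I0 *.
have nI0 : 0 < normc I by rewrite normc_gt0.
rewrite -(ler_pM2l nI0) -RintegralZl// -expr2.
(* multiplying by [conjc I] turns the integral into a nonnegative real number *)
have cII : normc I ^+ 2 = complex.Re ((conjc I) * I).
  by rewrite normc_sqr; case: (I) => a b /=; ring.
rewrite cII /I -cintegralZ//; apply: le_Rintegral => //.
- exact/L1_integrable_Re/L1Z.
- exact: RintegrableZl.
- move=> x _; rewrite (le_trans (ler_norm _))// (le_trans (normc_ge_normRe _))//.
  by rewrite normcM normc_conj.
Qed.

(** The bound is trivial when the right-hand side is infinite; in this form it
    can be used before integrability is known. *)
Lemma normc_cintegral_ereal f : cmeasurable f ->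
  ((normc (cintegral f))%:E <= \int[mu]_x (normc (f x))%:E)%E.
Proof.
move=> mf.
have [fy|] := ltP (\int[mu]_x (normc (f x))%:E)%E +oo%E; last first.
  by move=> /(le_trans _)->//; rewrite leey.
apply: le_trans (_ : ((\int[mu]_x (normc (f x)))%:E <= _)%E).
  by rewrite lee_fin; exact: normc_cintegral.
rewrite /Rintegral fineK// ge0_fin_numE//.
by apply: integral_ge0 => x _; rewrite lee_fin normc_ge0.
Qed.

Lemma normc_cintegral_le f (g : R -> R) : cmeasurable f ->
  mu.-integrable setT (EFin \o g) -> (forall x, normc (f x) <= g x) ->
  normc (cintegral f) <= \int[mu]_x g x.
Proof.
move=> mf ig fg; have jf := L1_dominated mf ig fg.
apply: le_trans (normc_cintegral jf) _; apply: le_Rintegral => //.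
exact: L1_integrable_normc.
Qed.

Section two_variables.
Variable F : mR * mR -> R[i].
Hypothesis mF : cmeas F.

Lemma cmeas_pair1 x : cmeasurable (fun y => F (x, y)).
Proof.
exact: (@cmeas_comp R _ _ _ _ (fun y : mR => (x, y)) F (pair1_measurable x) mF).
Qed.

Lemma measurable_Rintegral (h : mR * mR -> R) : measurable_fun setT h ->
  measurable_fun setT (fun x : mR => \int[mu]_y h (x, y)).
Proof.
move=> mh; rewrite /Rintegral.
apply: measurableT_comp => //.
rewrite (_ : (fun _ => _) = (fun x => \int[mu]_y ((EFin \o h)^\+ (x, y)) - \int[mu]_y ((EFin \o h)^\- (x, y)))%E).
  have mEh : measurable_fun setT (EFin \o h) by exact/measurable_EFinP.
  apply: emeasurable_funB.
  - by apply: (@measurable_fun_fubini_tonelli_F _ _ _ _ _ mu); [exact: measurable_funepos|].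
  - by apply: (@measurable_fun_fubini_tonelli_F _ _ _ _ _ mu); [exact: measurable_funeneg|].
apply/funext => x; rewrite integralE; congr (_ - _)%E; apply: eq_integral => y _.
- exact: (congr1 (fun k => k y) (funepos_comp (EFin \o h) (pair x))).
- exact: (congr1 (fun k => k y) (funeneg_comp (EFin \o h) (pair x))).
Qed.

Lemma cmeasurable_cintegral : cmeasurable (fun x => cintegral (fun y => F (x, y))).
Proof.
have [mr mi] := mF; split => /=.
- exact: (measurable_Rintegral mr).
- exact: (measurable_Rintegral mi).
Qed.

Hypothesis iF : (\int[mu]_x \int[mu]_y (normc (F (x, y)))%:E < +oo)%E.

Lemma integrable_prod (h : mR * mR -> R) : measurable_fun setT h ->
  (forall z, `|h z| <= normc (F z)) ->
  (mu \x mu)%E.-integrable setT (EFin \o h).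
Proof.
move=> mh hF; apply/integrable12ltyP; first exact/measurable_EFinP.
apply: le_lt_trans iF; apply: ge0_le_integral => //.
- by move=> x _; exact: integral_ge0.
- apply: (@measurable_fun_fubini_tonelli_F _ _ _ _ _ mu (fun z => `|(EFin \o h) z|%E)) => //.
  by apply: measurableT_comp => //; exact/measurable_EFinP.
- apply: (@measurable_fun_fubini_tonelli_F _ _ _ _ _ mu (fun z => (normc (F z))%:E)) => //.
    by apply/measurable_EFinP; exact: measurable_normc.
  by move=> z; rewrite lee_fin normc_ge0.
- move=> x _; apply: ge0_le_integral => //.
  + apply: measurableT_comp => //; apply/measurable_EFinP.
    by apply: (measurableT_comp mh); exact: pair1_measurable.
  + apply/measurable_EFinP; apply: (measurableT_comp (measurable_normc mF)).
    exact: pair1_measurable.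
  + by move=> y _; rewrite lee_fin.
Qed.

Lemma ae_L1_slice : {ae mu, forall x, L1 (fun y => F (x, y))}.
Proof.
have ij : (mu \x mu)%E.-integrable setT (fun z => (normc (F z))%:E).
  apply: integrable_prod; first exact: measurable_normc.
  by move=> z; rewrite ger0_norm ?normc_ge0.
have h := filterS _ (ae_integrable1 ij); apply: h => x jx.
by apply/L1P; split => //; exact: cmeas_pair1.
Qed.

Lemma L1_cintegral : L1 (fun x => cintegral (fun y => F (x, y))).
Proof.
split; first exact: cmeasurable_cintegral.
apply: le_lt_trans iF; apply: ge0_le_integral => //.
- by move=> x _; rewrite lee_fin normc_ge0.
- by apply/measurable_EFinP/measurable_normc/cmeasurable_cintegral.
- apply: (@measurable_fun_fubini_tonelli_F _ _ _ _ _ mu (fun z => (normc (F z))%:E)) => //.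
    by apply/measurable_EFinP; exact: measurable_normc.
  by move=> z; rewrite lee_fin normc_ge0.
- by move=> x _; apply: normc_cintegral_ereal; exact: cmeas_pair1.
Qed.

Let RFubini (h : mR * mR -> R) : measurable_fun setT h ->
  (forall z, `|h z| <= normc (F z)) ->
  \int[mu]_x \int[mu]_y h (x, y) = \int[mu]_y \int[mu]_x h (x, y).
Proof.
move=> mh hF; have ih := integrable_prod mh hF.
rewrite /Rintegral; congr fine.
transitivity (\int[mu]_x \int[mu]_y (h (x, y))%:E)%E.
  apply: ae_eq_integral => //.
  - apply/measurable_EFinP; exact: (measurable_Rintegral mh).
  - exact: (measurable_fubini_F ih).
  - have q := filterS _ (ae_integrable1 ih); apply: q => x jx _.
    by rewrite fineK//; exact: integrable_fin_num jx.
rewrite (Fubini ih); apply: ae_eq_integral => //.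
- exact: (measurable_fubini_G ih).
- apply/measurable_EFinP; have msw : measurable_fun setT (fun z : mR * mR => h (z.2, z.1)).
    apply: (measurableT_comp mh); apply: measurable_fun_pair => //.
  exact: (measurable_Rintegral msw).
- have q := filterS _ (ae_integrable2 ih); apply: q => x jx _.
  by rewrite fineK//; exact: integrable_fin_num jx.
Qed.

Lemma cFubini : cintegral (fun x => cintegral (fun y => F (x, y))) =
  cintegral (fun y => cintegral (fun x => F (x, y))).
Proof.
have [mr mi] := mF; rewrite /cintegral/=; congr (_ +i* _).
- by apply: (RFubini mr) => z; exact: normc_ge_normRe.
- by apply: (RFubini mi) => z; exact: normc_ge_normIm.
Qed.

End two_variables.

End complex_integral.

(** * Growth of weights *)

Section weights.
Context {R : realType}.
Implicit Types w : R -> R.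

Lemma weight_ratio w : weight w -> forall t : R, 0 <= t ->
  exists2 K : R, 0 < K & forall x, 0 <= x -> w (x + t) <= K * w x /\ w x <= K * w (x + t).
Proof.
move=> [_ w0 wb] t t0; have [inf0 supy] := wb t t0.
set A := [set (w (x + t) / w x)%:E | x in `[0%R, +oo[] in inf0 supy.
have memA x : 0 <= x -> A (w (x + t) / w x)%:E.
  by move=> x0; exists x => //=; rewrite in_itv/= andbT.
have supK x : 0 <= x -> w (x + t) <= fine (ereal_sup A) * w x.
  move=> x0; rewrite -ler_pdivrMr ?w0// -lee_fin fineK.
    exact/ereal_sup_ubound/memA.
  apply: fin_real; rewrite supy andbT.
  by rewrite (lt_le_trans _ (ereal_sup_ubound (memA 0 (lexx _))))// ltNyr.
have infK : exists2 k : R, 0 < k & forall x, 0 <= x -> k * w x <= w (x + t).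
  exists (fine (ereal_inf A)).
    rewrite fine_gt0// inf0/=.
    by rewrite (le_lt_trans (ereal_inf_lbound (memA 0 (lexx _))))// ltry.
  move=> x x0; rewrite -ler_pdivlMr ?w0// -lee_fin fineK.
    exact/ereal_inf_lbound/memA.
  apply: fin_real; rewrite (lt_trans _ inf0) ?ltNy0//=.
  by rewrite (le_lt_trans (ereal_inf_lbound (memA 0 (lexx _))))// ltry.
have [k k0 kP] := infK.
exists (Num.max (fine (ereal_sup A)) k^-1).
  by rewrite lt_max invr_gt0 k0 orbT.
move=> x x0; split.
- by rewrite (le_trans (supK _ x0))// ler_wpM2r ?le_max ?lexx// ltW// w0.
- apply: (@le_trans _ _ (k^-1 * w (x + t))).
    by rewrite ler_pdivlMl// kP.
  by rewrite ler_wpM2r ?le_max ?lexx ?orbT// ltW// w0// addr_ge0.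
Qed.

Lemma weight_continuous_norm w (x : R) : weight w -> 0 <= x ->
  continuous (fun t : R => w (x + `|t|)).
Proof.
move=> [cw _ _] x0 t.
have /subspace_continuousP/(_ (x + `|t|)) := cw.
rewrite /= in_itv/= andbT addr_ge0// => /(_ isT) cxt.
apply/cvgrPdist_lt => e e0.
move/cvgrPdist_lt: cxt => /(_ e e0).
rewrite /within/= near_simpl => /nbhs_ballP[d /= d0 hd].
near=> s; apply: hd; last by rewrite in_itv/= andbT addr_ge0.
rewrite /ball/= opprD addrACA subrr add0r.
rewrite (le_lt_trans (ler_dist_dist _ _))//.
Unshelve. all: by end_near. Qed.

(** The definition of a weight bounds each translation separately.  The sets
    [F n] of the translations with bound [n] are closed and cover the line, so
    that by Baire's theorem one of them contains an interval; this gives a bound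
    uniform over small translations, hence over unit ones. *)
Lemma weight_local w : weight w ->
  exists2 C : R, 1 <= C & forall x s, 0 <= x -> 0 <= s <= 1 ->
    w (x + s) <= C * w x /\ w x <= C * w (x + s).
Proof.
move=> ww; have [_ w0 _] := ww; have wr := weight_ratio ww.
pose F (n : nat) := [set t : R | forall x, 0 <= x -> w (x + `|t|) <= n%:R * w x].
have closedF n : closed (F n).
  rewrite (_ : F n = \bigcap_(x in [set x : R | 0 <= x])
      ((fun t => w (x + `|t|)) @^-1` [set y | y <= n%:R * w x])); last first.
    by apply/seteqP; split.
  apply: closed_bigI => x /= x0; apply: closed_comp => [y _|].
    exact: weight_continuous_norm.
  exact: closed_le.
have [n [t0 [e [e0 Fn]]]] : exists n t0 e, 0 < e /\ ball t0 e `<=` F n.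
  apply: contrapT => nF.
  have : dense (\bigcap_i (~` F i)).
    apply: (@Baire R R (fun i => ~` F i)) => i; split; first exact: closed_openC.
    move=> O [t Ot] oO; apply: contrapT => OF; apply: nF.
    have /nbhs_ballP[e /= e0 eO] : nbhs t O by apply: open_nbhs_nbhs.
    exists i, t, e; split => // s /eO Os; apply: contrapT => Fs.
    by apply: OF; exists s.
  move=> /(_ setT) [||t [_ Ft]]; [by exists 0|exact: openT|].
  have [K K0 KP] := wr `|t| (normr_ge0 _).
  have := Ft (Num.bound K) I; apply => x x0.
  rewrite (le_trans (KP x x0).1)// ler_wpM2r//; first exact/ltW/w0.
  by apply/ltW/archi_boundP/ltW.
have Fs s x : 0 <= x -> 0 <= s < e -> w (x + (`|t0| + s)) <= n%:R * w x.
  move=> x0 /andP[s0 se].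
  have [t00|t00] := leP 0 t0.
    have := Fn (t0 + s); rewrite (ger0_norm t00) => /(_ _)/(_ x x0) + .
    rewrite ger0_norm ?addr_ge0//; apply.
    by rewrite /ball/= opprD addrA subrr sub0r normrN ger0_norm.
  have := Fn (t0 - s); rewrite (ltr0_norm t00) => /(_ _)/(_ x x0) + .
  rewrite ler0_norm; last by rewrite subr_le0 (le_trans (ltW t00)).
  rewrite opprB (addrC s); apply.
  by rewrite /ball/= opprD addrA subrr sub0r opprK ger0_norm.
have [Ka Ka0 KaP] := wr `|t0| (normr_ge0 _).
pose C0 := Num.max 1 (Ka * n%:R).
have C01 : 1 <= C0 by rewrite le_max lexx.
have C00 : 0 <= C0 by exact: le_trans C01.
have loc0 s x : 0 <= x -> 0 <= s < e -> w (x + s) <= C0 * w x.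
  move=> x0 /andP[s0 se].
  rewrite (le_trans (KaP (x + s) _).2) ?addr_ge0//.
  have := Fs s x x0; rewrite s0 se => /(_ isT) h.
  apply: (@le_trans _ _ (Ka * (n%:R * w x))).
    by rewrite ler_pM2l// -addrA (addrC s).
  by rewrite mulrA ler_wpM2r ?le_max ?lexx ?orbT// ltW// w0.
have e20 : 0 < e / 2 by rewrite divr_gt0.
(* steps of length at most [e / 2], each of which costs a factor [C0] *)
have locN N s x : 0 <= x -> 0 <= s < (e / 2) *+ N -> w (x + s) <= C0 ^+ N * w x.
  elim: N s x => [|N ih] s x x0 /andP[s0 se].
    by have := le_lt_trans s0 se; rewrite mulr0n ltxx.
  have [sle|sgt] := ltP s (e / 2).
    rewrite (le_trans (loc0 s x x0 _)) ?s0//; first by lra.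
    rewrite ler_wpM2r//; first exact/ltW/w0.
    by rewrite -[leLHS]expr1 ler_weXn2l.
  rewrite (_ : x + s = x + e / 2 + (s - e / 2)); last by lra.
  have xe : 0 <= x + e / 2 by rewrite addr_ge0// ltW.
  rewrite (le_trans (ih _ _ xe _))//.
    by rewrite subr_ge0 sgt/= ltrBlDr -mulrSr.
  rewrite exprSr -mulrA ler_wpM2l ?exprn_ge0//.
  by apply: loc0 => //; rewrite ltW//=; lra.
pose N := Num.bound (e / 2)^-1.
have N1 : 1 < (e / 2) *+ N.
  rewrite -mulr_natr -ltr_pdivrMl// mulr1.
  by apply: archi_boundP; rewrite invr_ge0 ltW.
have [K1 K10 K1P] := wr 1 ler01.
pose C := Num.max (C0 ^+ N) (K1 * C0 ^+ N).
have up x s : 0 <= x -> 0 <= s <= 1 -> w (x + s) <= C0 ^+ N * w x.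
  by move=> x0 /andP[s0 s1]; apply: locN => //; rewrite s0 (le_lt_trans s1).
exists C; first by rewrite le_max exprn_ege1.
move=> x s x0 /andP[s0 s1]; split.
  rewrite (le_trans (up x s x0 _)) ?s0// ler_wpM2r ?le_max ?lexx//.
  exact/ltW/w0.
have xs0 : 0 <= x + s by rewrite addr_ge0.
rewrite (le_trans (K1P x x0).2)//.
apply: (@le_trans _ _ (K1 * (C0 ^+ N * w (x + s)))).
  rewrite ler_pM2l// (_ : x + 1 = x + s + (1 - s)); last by lra.
  by apply: up => //; lra.
by rewrite mulrA ler_wpM2r ?le_max ?lexx ?orbT//; exact/ltW/w0.
Qed.

Definition locally_doubling w (C : R) := [/\ 1 <= C, forall x, 0 <= x -> 0 < w x &
  forall x s, 0 <= x -> 0 <= s <= 1 -> w (x + s) <= C * w x /\ w x <= C * w (x + s)].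

Lemma locally_doublingV w C : locally_doubling w C ->
  locally_doubling (fun x => (w x)^-1) C.
Proof.
move=> [C1 w0 wC]; have C0 : 0 < C by exact: lt_le_trans C1.
split => // [x x0|x s x0 /[dup] s01 /andP[s0 s1]]; first by rewrite invr_gt0 w0.
have [h1 h2] := wC x s x0 s01; have xs0 : 0 < w (x + s) by rewrite w0// addr_ge0.
have wx0 := w0 x x0.
by rewrite !ler_pdivlMr// ![_^-1 * _]mulrC !ler_pdivrMr.
Qed.

Lemma locally_doubling_iter w C : locally_doubling w C ->
  forall N x s, 0 <= x -> 0 <= s <= N%:R -> w (x + s) <= C ^+ N * w x /\ w x <= C ^+ N * w (x + s).
Proof.
move=> [C1 w0 wC]; have C0 : 0 <= C by exact: le_trans C1.
elim=> [|N ih] x s x0 /andP[s0 sN].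
  by rewrite (_ : s = 0) ?addr0 ?expr0 ?mul1r//; apply/eqP; rewrite eq_le s0 andbT.
have xs0 : 0 <= x + s by rewrite addr_ge0.
have [s1|s1] := leP s 1.
  have [h1 h2] : w (x + s) <= C * w x /\ w x <= C * w (x + s) by apply: wC => //; rewrite s0.
  have CN : C <= C ^+ N.+1 by rewrite -[leLHS]expr1 ler_weXn2l.
  by split; [apply: le_trans h1 _|apply: le_trans h2 _]; rewrite ler_wpM2r// ltW// w0.
have x10 : 0 <= x + 1 by rewrite addr_ge0.
have s10 : 0 <= s - 1 <= N%:R.
  by rewrite subr_ge0 (ltW s1)/= lerBlDr natr1.
have [h1 h2] := ih (x + 1) (s - 1) x10 s10.
rewrite (_ : x + 1 + (s - 1) = x + s) in h1 h2; last by lra.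
have [k1 k2] : w (x + 1) <= C * w x /\ w x <= C * w (x + 1) by apply: wC => //; rewrite ler01 lexx.
split.
- by rewrite (le_trans h1)// exprSr -mulrA ler_wpM2l// exprn_ge0.
- by rewrite (le_trans k2)// exprS -mulrA ler_wpM2l.
Qed.

(** [a] is the exponential rate, as [t] tends to infinity, of the supremum over
    [x] of [w (x + t) / w x].  The factor 2 absorbs the fact that this supremum
    need not be attained. *)
Definition exp_growth w (a : R) :=
  (forall t, 1 <= t -> exists2 x, 0 <= x & expR (a * t) * w x <= 2 * w (x + t)) /\
  (forall b, a < b -> exists2 D, 0 < D &
     forall x t, 0 <= x -> 0 <= t -> w (x + t) <= D * expR (b * t) * w x).

(** Fekete's argument: the supremum [M t] of the ratios is submultiplicative, so
    the infimum of [ln (M t) / t] is both a lower bound and the exact rate. *)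
Lemma exists_exp_growth w C : locally_doubling w C -> exists a, exp_growth w a.
Proof.
move=> wC; have [C1 w0 _] := wC; have C0 : 0 < C by exact: lt_le_trans C1.
have iter := locally_doubling_iter wC.
pose A t := [set w (x + t) / w x | x in [set x | 0 <= x]].
pose M t := sup (A t).
have CN1 N : 1 <= C ^+ N by rewrite exprn_ege1.
have archi t : 0 <= t -> t <= (Num.bound t)%:R by move=> t0; apply/ltW/archi_boundP.
have supA N t : 0 <= t <= N%:R -> has_sup (A t).
  move=> tN; split; first by exists (w (0 + t) / w 0); exists 0 => //=.
  exists (C ^+ N) => _ [x x0 <-]; rewrite ler_pdivrMr ?w0//.
  exact: (iter N x t x0 tN).1.
have ratioM x t : 0 <= x -> 0 <= t -> w (x + t) <= M t * w x.
  move=> x0 t0; rewrite -ler_pdivrMr ?w0//.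
  have tN : 0 <= t <= (Num.bound t)%:R by rewrite t0 archi.
  by apply: sup_upper_bound; [exact: supA tN|exists x].
have MC N t : 0 <= t <= N%:R -> M t <= C ^+ N.
  move=> tN; apply: ge_sup; first by have [] := supA N t tN.
  move=> _ [x x0 <-]; rewrite ler_pdivrMr ?w0//.
  exact: (iter N x t x0 tN).1.
have MCV N t : 0 <= t <= N%:R -> C ^- N <= M t.
  move=> tN; have t0 : 0 <= t by case/andP: tN.
  have := ratioM 0 t (lexx _) t0; have [_] := iter N 0 t (lexx _) tN.
  move=> h1 h2; have := le_trans h1 (ler_wpM2l (exprn_ge0 N (ltW C0)) h2).
  rewrite mulrA -[X in X <= _]mul1r ler_pM2r ?w0// => h.
  by rewrite -[leLHS]mul1r ler_pdivrMr ?exprn_gt0// mulrC.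
have M0 t : 0 <= t -> 0 < M t.
  move=> t0; have tN : 0 <= t <= (Num.bound t)%:R by rewrite t0 archi.
  by apply: lt_le_trans (MCV _ _ tN); rewrite invr_gt0 exprn_gt0.
have MD s t : 0 <= s -> 0 <= t -> M (s + t) <= M s * M t.
  move=> s0 t0; have st0 : 0 <= s + t by rewrite addr_ge0.
  have tN : 0 <= s + t <= (Num.bound (s + t))%:R by rewrite st0 archi.
  apply: ge_sup; first by have [] := supA _ _ tN.
  move=> _ [x x0 <-]; rewrite ler_pdivrMr ?w0// -mulrA addrA.
  rewrite (addrAC x) -addrA (addrC t).
  rewrite (le_trans (_ : _ <= M s * w (x + t)))//.
    by rewrite (addrC s) addrA ratioM// addr_ge0.
  by rewrite ler_pM2l ?M0// ratioM.
pose B := [set ln (M t) / t | t in [set t | 1 <= t]].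
have lnC0 : 0 <= ln C by rewrite ln_ge0.
have infB : has_inf B.
  split; first by exists (ln (M 1) / 1); exists 1 => /=.
  exists (- (2 * ln C)) => _ [t /= t1 <-].
  have t0 : 0 < t by exact: lt_le_trans t1.
  rewrite ler_pdivlMr//.
  pose N := (Num.truncn t).+1.
  have tN : 0 <= t <= N%:R.
    by rewrite ltW//= ltW// truncnS_gt.
  have NC : N%:R <= 2 * t.
    have := truncn_le t; rewrite (ltW t0) => h.
    by rewrite /N -natr1; lra.
  apply: (@le_trans _ _ (ln (C ^- N))).
    rewrite lnV ?posrE ?exprn_gt0// lnXn// -mulr_natr.
    by have := ler_wpM2l lnC0 NC; lra.
  by rewrite ler_ln ?posrE ?invr_gt0 ?exprn_gt0 ?M0 ?(ltW t0)//; exact: MCV.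
pose a := inf B; exists a; split.
  move=> t t1; have t0 : 0 < t by exact: lt_le_trans t1.
  have aM : expR (a * t) <= M t.
    rewrite -[leRHS]lnK ?posrE ?M0// ?ler_expR; last exact: ltW.
    by rewrite -ler_pdivlMr//; apply: ge_inf; [case: infB|exists t].
  have tN : 0 <= t <= (Num.bound t)%:R by rewrite ltW//= archi// ltW.
  have M20 : 0 < M t / 2 by rewrite divr_gt0// M0// ltW.
  have [_ [x x0 <-] xM] := sup_adherent M20 (supA _ _ tN).
  exists x => //; rewrite -/(M t) in xM.
  apply: (le_trans (ler_wpM2r (ltW (w0 _ x0)) aM)).
  have : M t / 2 < w (x + t) / w x by lra.
  by rewrite ltr_pdivlMr ?w0// => h; lra.
move=> b ab.
have ba0 : 0 < b - a by rewrite subr_gt0.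
have [_ [t0 t01 <-] tb] := inf_adherent ba0 infB.
have {}tb : M t0 <= expR (b * t0).
  have t00 : 0 < t0 by exact: lt_le_trans t01.
  rewrite -[leLHS]lnK ?posrE ?M0// ?ler_expR; last exact: ltW.
  by rewrite -ler_pdivrMr// ltW//; move: tb; rewrite -/a; lra.
have t00 : 0 < t0 by exact: lt_le_trans t01.
pose K := C ^+ Num.bound t0.
have Mn n r : 0 <= r -> M (t0 *+ n + r) <= expR (b * t0) ^+ n * M r.
  move=> r0; elim: n => [|n ih]; first by rewrite mulr0n add0r mul1r.
  rewrite mulrS -addrA (le_trans (MD _ _ _ _)) ?(ltW t00)// ?addr_ge0 ?mulrn_wge0 ?(ltW t00)//.
  rewrite exprS -mulrA; apply: ler_pM => //; first exact/ltW/M0/ltW.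
  by apply/ltW/M0; rewrite addr_ge0// mulrn_wge0// ltW.
exists (K * expR (`|b| * t0)).
  by rewrite mulr_gt0 ?exprn_gt0 ?expR_gt0.
move=> x t x0 tge0; rewrite (le_trans (ratioM _ _ x0 tge0))// ler_wpM2r//; first exact/ltW/w0.
pose n := Num.truncn (t / t0); pose r := t - t0 *+ n.
have tt0 : 0 <= t / t0 by rewrite divr_ge0// ltW.
have r0 : 0 <= r.
  by rewrite subr_ge0 -mulr_natl -ler_pdivlMr// truncn_le.
have rt : r <= t0.
  rewrite lerBlDr -mulrS -mulr_natl -ler_pdivrMr//; exact/ltW/truncnS_gt.
rewrite (_ : t = t0 *+ n + r); last by rewrite /r addrC subrK.
rewrite (le_trans (Mn _ _ r0))//.
rewrite -expRM_natr mulrC -[leRHS]mulrA -expRD; apply: ler_pM => //.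
- exact/ltW/M0.
- by apply: MC; rewrite r0/= (le_trans rt)// archi// ltW.
- rewrite ler_expR -mulr_natr.
  have : - (b * r) <= `|b| * t0.
    rewrite (le_trans (ler_norm _))// normrN normrM (ger0_norm r0).
    by rewrite ler_wpM2l.
  lra.
Qed.

(** Multiplicative constants disappear under the [t]-th root. *)
Lemma exp_rate_lim (f : R -> R) (a : R) :
  (exists2 c, 0 < c & forall t, 1 <= t -> c * expR (a * t) <= f t) ->
  (forall b, a < b -> exists2 D, 0 < D & forall t, 1 <= t -> f t <= D * expR (b * t)) ->
  lim (ln (f t `^ t^-1) @[t --> +oo]) = a.
Proof.
move=> [c c0 cf] fD; apply: cvg_lim => //.
apply/cvgrPdist_le => e e0.
have [D D0 fDD] := fD (a + e / 2) ltac:(lra).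
near=> t.
have t1 : 1 <= t by near: t; apply: nbhs_pinfty_ge; rewrite num_real.
have t0 : 0 < t by exact: lt_le_trans t1.
have ft0 : 0 < f t by rewrite (lt_le_trans _ (cf t t1))// mulr_gt0// expR_gt0.
rewrite ln_powR mulrC ler_norml; apply/andP; split.
  rewrite -(lerD2l (- a)) addKr -lerN2 !opprD !opprK ler_pdivrMr//.
  apply: (@le_trans _ _ (ln (D * expR ((a + e / 2) * t)))).
    by rewrite ler_ln ?posrE// ?mulr_gt0 ?expR_gt0// fDD.
  rewrite lnM ?posrE ?expR_gt0// expRK.
  have : ln D <= (e / 2) * t.
    rewrite -ler_pdivrMl ?divr_gt0//.
  lra.
rewrite lerBlDl -lerBlDr ler_pdivlMr//.
apply: (@le_trans _ _ (ln (c * expR (a * t)))); last first.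
  by rewrite ler_ln ?posrE ?mulr_gt0 ?expR_gt0// cf.
rewrite lnM ?posrE ?expR_gt0// expRK.
have : - ln c <= e * t.
  rewrite -ler_pdivrMl//.
lra.
Unshelve. all: by end_near. Qed.

End weights.

(** * A positivity criterion by the Fejer kernel *)

Section bounded_support.
Context {R : realType}.
Local Notation mu := (@lebesgue_measure R).
Local Notation mR := (measurableTypeR R).

Lemma measurable_in_itv (a b : R) : measurable_fun setT (fun x : mR => a <= x <= b).
Proof.
by apply: measurable_and; apply: measurable_fun_ler => //; exact: measurable_cst.
Qed.

Lemma integrable_itv_cst (M a b : R) :
  mu.-integrable setT (fun x => (if a <= x <= b then M else 0)%:E).
Proof.
have := RintegrableZl M (integrable_indic_itv a b true false).
apply: eq_integrable => //= x _; congr (_%:E).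
by rewrite indicE mem_setE in_itv/=; case: ifP; rewrite ?mulr1 ?mulr0.
Qed.

Lemma Rintegral_itv_cst (M a b : R) : a <= b ->
  \int[mu]_x (if a <= x <= b then M else 0) = M * (b - a).
Proof.
move=> ab; transitivity (\int[mu]_(x in `[a, b]) M).
  rewrite [RHS]Rintegral_mkcond; apply: eq_Rintegral => x _.
  by rewrite patchE mem_setE in_itv.
rewrite Rintegral_cst// [X in _ * fine X](_ : _ = (b - a)%:E)//.
rewrite [LHS]lebesgue_measure_itv/= lte_fin.
by case: ltgtP ab => // -> _; rewrite subrr.
Qed.

Lemma integrable_bounded_support (f : R -> R) (M a b : R) : measurable_fun setT f ->
  (forall x, `|f x| <= if a <= x <= b then M else 0) ->
  mu.-integrable setT (fun x => (f x)%:E).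
Proof.
move=> mf fM; apply: le_integrable (integrable_itv_cst M a b) => //.
  exact/measurable_EFinP.
by move=> x _ /=; rewrite lee_fin (le_trans (fM x))// ler_norm.
Qed.

Lemma L1_bounded_support (f : R -> R[i]) (M a b : R) : cmeasurable f ->
  (forall x, normc (f x) <= if a <= x <= b then M else 0) -> L1 f.
Proof. by move=> mf fM; apply: L1_dominated mf (integrable_itv_cst M a b) fM. Qed.

Lemma Rintegral_itv_primitive (F f : R -> R) (T : R) : 0 < T -> continuous f ->
  (forall x : R, is_derive x 1 F (f x)) ->
  \int[mu]_x (if 0 <= x <= T then f x else 0) = F T - F 0.
Proof.
move=> T0 cf dF; transitivity (\int[mu]_(x in `[0, T]) f x).
  by rewrite [RHS]Rintegral_mkcond; apply: eq_Rintegral => x _; rewrite patchE mem_setE in_itv.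
have cF x : {for x, continuous F}.
  by apply: differentiable_continuous; apply/derivable1_diffP; have [] := dF x.
rewrite /Rintegral (continuous_FTC2 (F := F))//=.
- exact: continuous_subspaceT.
- split=> [x _||]; [by have [] := dF x|apply: cvg_at_right_filter; exact: cF|].
  by apply: cvg_at_left_filter; exact: cF.
- by move=> x _; rewrite derive1E; have [] := dF x.
Qed.

Lemma Rfubini (h : mR * mR -> R) : measurable_fun setT h ->
  (\int[mu]_x \int[mu]_y `|h (x, y)|%:E < +oo)%E ->
  \int[mu]_x \int[mu]_y h (x, y) = \int[mu]_y \int[mu]_x h (x, y).
Proof.
move=> mh hy; have mc : cmeas (fun z => (h z)%:C) by exact: cmeas_realC.
have cy : (\int[mu]_x \int[mu]_y (normc (h (x, y))%:C)%:E < +oo)%E.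
  by under eq_integral do under eq_integral do rewrite normcC.
exact: (congr1 (@complex.Re R) (cFubini mc cy)).
Qed.

End bounded_support.

Section positive_definite.
Context {R : realType}.
Local Notation mu := (@lebesgue_measure R).
Local Notation mR := (measurableTypeR R).

Let tri (T x : R) : R := if 0 <= x <= T then 2 * (T - x) else 0.
Let K (T s : R) : R := \int[mu]_x (tri T x * cos (x * s)).

Let mtri T : measurable_fun setT (tri T).
Proof.
apply: measurable_fun_ifT; [exact: measurable_in_itv| |exact: measurable_cst].
by apply: measurable_funM => //; apply: measurable_funB.
Qed.

Let mcos d (U : measurableType d) (f : U -> R) : measurable_fun setT f ->
  measurable_fun setT (fun x => cos (f x)).
Proof.
by move=> mf; apply: (measurableT_comp (continuous_measurable_fun (@continuous_cos R)) mf).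
Qed.

Let norm_cos (x : R) : `|cos x| <= 1.
Proof. by rewrite ler_norml cos_le1 cos_geN1. Qed.

Let tri_le T x : 0 <= T -> `|tri T x| <= if 0 <= x <= T then 2 * T else 0.
Proof.
move=> T0; rewrite /tri; case: ifP => [/andP[x0 xT]|]; last by rewrite normr0.
by rewrite ger0_norm; nra.
Qed.

Let itri T s : 0 <= T -> mu.-integrable setT (fun x => (tri T x * cos (x * s))%:E).
Proof.
move=> T0; apply: (@integrable_bounded_support _ _ (2 * T) 0 T).
  apply: measurable_funM => //; apply: mcos; exact: measurable_funM.
move=> x; apply: le_trans (tri_le x T0).
by rewrite normrM ler_piMr.
Qed.

Let KE T s : 0 < T -> s != 0 -> K T s = 2 * (1 - cos (T * s)) / s ^+ 2.
Proof.
move=> T0 s0.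
transitivity (\int[mu]_x (if 0 <= x <= T then 2 * (T - x) * cos (x * s) else 0)).
  by apply: eq_Rintegral => x _; rewrite /tri; case: ifP => //; rewrite mul0r.
pose F (x : R) := 2 * ((T - x) * sin (x * s) / s - cos (x * s) / s ^+ 2).
have dF (x : R) : is_derive x 1 F (2 * (T - x) * cos (x * s)).
  apply: is_derive_eq.
  rewrite /GRing.scale/=.
  by field.
rewrite (Rintegral_itv_primitive T0 _ dF).
  by rewrite /F !mul0r sin0 cos0 subrr mul0r subr0 mulr0 mul0r sub0r; field.
move=> x; apply: cvgM.
  by apply: cvgM; [exact: cvg_cst|apply: cvgB; [exact: cvg_cst|exact: cvg_id]].
apply: (@cvg_comp _ _ _ (fun y : R => y * s) (@cos R) _ (nbhs (x * s))); last exact: continuous_cos.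
by apply: cvgM; [exact: cvg_id|exact: cvg_cst].
Qed.

Let K_ge0 T s : 0 < T -> s != 0 -> 0 <= K T s.
Proof.
move=> T0 s0; rewrite KE//; rewrite divr_ge0 ?sqr_ge0// mulr_ge0// subr_ge0.
Qed.

Let K_le T s : 0 < T -> s != 0 -> K T s <= 4 / s ^+ 2.
Proof.
move=> T0 s0; rewrite KE// ler_pM2r; last by rewrite invr_gt0 exprn_even_gt0.
have := cos_geN1 (T * s); lra.
Qed.

Let K_lower T s : 0 < T -> `|s| <= T^-1 -> cos 1 * T ^+ 2 <= K T s.
Proof.
move=> T0 sT.
have K0 : K T 0 = T ^+ 2.
  transitivity (\int[mu]_x (if 0 <= x <= T then 2 * (T - x) else 0)).
    by apply: eq_Rintegral => x _; rewrite mulr0 cos0 mulr1.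
  pose F (x : R) := 2 * T * x - x ^+ 2.
  have dF (x : R) : is_derive x 1 F (2 * (T - x)).
    apply: is_derive_eq.
    rewrite /GRing.scale/= ?scaler0 ?addr0 ?add0r /GRing.scale/=.
    by ring.
  rewrite (Rintegral_itv_primitive T0 _ dF); first by rewrite /F; ring.
  by move=> x; apply: cvgM; [exact: cvg_cst|apply: cvgB; [exact: cvg_cst|exact: cvg_id]].
rewrite -K0 /K -RintegralZl//; last by apply: itri; exact: ltW.
apply: le_Rintegral => //.
- by apply: RintegrableZl; apply: itri; exact: ltW.
- by apply: itri; exact: ltW.
move=> x _; rewrite mulr0 cos0 mulr1 mulrC /tri; case: ifP => [/andP[x0 xT]|]; last by rewrite !mul0r.
rewrite ler_wpM2l//; first by lra.
have xs : `|x * s| <= 1.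
  rewrite normrM ger0_norm// (le_trans (ler_pM _ _ xT sT))//.
  by rewrite divff// gt_eqF.
have pi1 : 1 <= pi :> R by rewrite (le_trans _ (pi_ge2 _)) // ler1n.
rewrite -(cos_norm (x * s)) leNgt ltr_cos -?leNgt//.
- by rewrite in_itv/= ler01.
- by rewrite in_itv/= normr_ge0/= (le_trans xs).
Qed.

(** Integrating the nonnegative cosine transform of [a] against the triangle
    function of width [T] gives the integral of [a] against the Fejer kernel,
    whose mass near 0 is of order [T] whereas it is bounded by [4 / s ^+ 2]
    elsewhere.  A negative value of [a] at 0 would make this integral negative
    for large [T]. *)
Lemma cos_transform_ge0 (a : R -> R) : measurable_fun setT a ->
  mu.-integrable setT (fun s => (a s)%:E) ->
  {for 0, continuous a} ->
  (forall x, 0 <= \int[mu]_s (a s * cos (x * s))) ->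
  0 <= a 0.
Proof.
move=> ma ia ca aN; rewrite leNgt; apply/negP => a0.
pose d := - a 0 / 2; have d0 : 0 < d by rewrite divr_gt0 ?oppr_gt0.
have [e e0 ae] : exists2 e, 0 < e & forall s, `|s| < e -> a s < - d.
  move/cvgrPdist_lt : ca => /(_ d d0) /nbhs_ballP[e /= e0 he]; exists e => // s se.
  have := he s; rewrite /ball/= sub0r normrN => /(_ se).
  by rewrite ltr_norml /d; lra.
have ina : mu.-integrable setT (fun s => (`|a s|)%:E) by exact: integrable_norm.
pose A := \int[mu]_s `|a s|.
have A0 : 0 <= A by apply: Rintegral_ge0.
(* the Fejer kernel is at least [cos 1 * T ^+ 2] on an interval of length [2 / T] *)
have key T : e^-1 < T -> T * (d * cos 1 * 2) <= 4 / e ^+ 2 * A.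
  move=> eT; have T0 : 0 < T by apply: lt_trans eT; rewrite invr_gt0.
  have TVe : T^-1 < e by rewrite invf_plt.
  have ge0 : 0 <= \int[mu]_s (a s * K T s).
    pose h (z : mR * mR) := tri T z.1 * (a z.2 * cos (z.1 * z.2)).
    have mh : measurable_fun setT h.
      apply: measurable_funM; first exact: (measurableT_comp (mtri T)).
      apply: measurable_funM; first exact: (measurableT_comp ma).
      by apply: mcos; exact: measurable_funM.
    have swap : \int[mu]_x \int[mu]_s h (x, s) = \int[mu]_s \int[mu]_x h (x, s).
      apply: Rfubini => //.
      apply: (@le_lt_trans _ _ (\int[mu]_x (A * (if 0 <= x <= T then 2 * T else 0))%:E)%E).
        apply: ge0_le_integral => //.
        - by move=> x _; exact: integral_ge0.
        - apply: (@measurable_fun_fubini_tonelli_F _ _ _ _ _ mu (fun z => (`|h z|)%:E)) => //.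
          by apply/measurable_EFinP; apply: measurableT_comp.
        - apply/measurable_EFinP; apply: measurable_funM => //.
          apply: measurable_fun_ifT => //; exact: measurable_in_itv.
        move=> x _; rewrite mulrC EFinM /A /Rintegral fineK ?integrable_fin_num// -ge0_integralZl//.
        - apply: ge0_le_integral => //.
          + apply/measurable_EFinP; apply: measurableT_comp => //.
            by apply: (measurableT_comp mh); exact: pair1_measurable.
          + apply: emeasurable_funM => //; apply/measurable_EFinP; exact: measurableT_comp.
          + move=> s _; rewrite -EFinM lee_fin /h/= normrM; apply: ler_pM => //.
              by apply: tri_le; exact: ltW.
            by rewrite normrM; apply: ler_piMr.
        - by apply/measurable_EFinP; exact: measurableT_comp.
        - by rewrite lee_fin; case: ifP => // _; rewrite mulr_ge0// ltW.
      have iT := RintegrableZl A (integrable_itv_cst (2 * T) 0 T).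
      exact: (integrable_lty measurableT iT).
    have hK s : \int[mu]_x h (x, s) = a s * K T s.
      rewrite /K -RintegralZl//; last by apply: itri; exact: ltW.
      by apply: eq_Rintegral => x _; rewrite /h/=; ring.
    under eq_Rintegral do rewrite -hK.
    rewrite -swap; apply: Rintegral_ge0 => x _.
    rewrite (_ : \int[mu]_s h (x, s) = tri T x * \int[mu]_s (a s * cos (x * s))).
      by rewrite mulr_ge0// /tri; case: ifP => // /andP[_ xT]; rewrite mulr_ge0// subr_ge0.
    rewrite -RintegralZl//.
    apply: le_integrable ia => //.
      apply/measurable_EFinP; apply: measurable_funM => //; apply: mcos; exact: measurable_funM.
    by move=> s _; rewrite /= lee_fin normrM ler_piMr.
  have mK : measurable_fun setT (K T).
    apply: (@measurable_Rintegral _ (fun z : mR * mR => tri T z.2 * cos (z.2 * z.1))).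
    apply: measurable_funM; first exact: (measurableT_comp (mtri T)).
    by apply: mcos; exact: measurable_funM.
  have K_norm s : `|K T s| <= T * (2 * T).
    apply: le_trans (le_normr_Rintegral measurableT (itri s (ltW T0))) _.
    rewrite mulrC -[X in _ * X]subr0 -Rintegral_itv_cst; last exact: ltW.
    apply: le_Rintegral => //.
    - by apply: integrable_norm; apply: itri; exact: ltW.
    - exact: integrable_itv_cst.
    - by move=> x _; rewrite normrM (le_trans _ (tri_le x (ltW T0)))// ler_piMr.
  have TV0 : 0 < T^-1 by rewrite invr_gt0.
  have i1 := integrable_itv_cst (- (d * (cos 1 * T ^+ 2))) (- T^-1) T^-1.
  have i2 := RintegrableZl (4 / e ^+ 2) ina.
  have iK : mu.-integrable setT (fun s => (a s * K T s)%:E).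
    apply: le_integrable (RintegrableZl (T * (2 * T)) ina) => //.
      by apply/measurable_EFinP; exact: measurable_funM.
    move=> s _; rewrite /= lee_fin normrM mulrC.
    apply: le_trans (ler_norm _); exact: ler_wpM2r.
  have : \int[mu]_s (a s * K T s) <= - (d * (cos 1 * T ^+ 2)) * (T^-1 - - T^-1) + 4 / e ^+ 2 * A.
    rewrite -Rintegral_itv_cst; last by rewrite (@le_trans _ _ 0)// ?oppr_le0 ltW.
    rewrite -RintegralZl// -RintegralD//; apply: le_Rintegral => //.
      exact: (integrableD _ i1 i2).
    move=> s _; have e40 : 0 <= 4 / e ^+ 2 by rewrite divr_ge0// sqr_ge0.
    rewrite -ler_norml; have [sT|sT] := leP `|s| T^-1.
      rewrite (@le_trans _ _ (- d * K T s))//.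
        have Kl := K_lower T0 sT.
        rewrite ler_wpM2r//; last by rewrite ltW// ae// (le_lt_trans sT).
        by rewrite (le_trans _ Kl)// mulr_ge0 ?sqr_ge0// ltW// cos1_gt0.
      rewrite mulNr -[leLHS]addr0; apply: lerD; last exact: mulr_ge0.
      by rewrite lerN2 ler_wpM2l ?(ltW d0)// K_lower.
    have s0 : s != 0 by rewrite -normr_gt0 (lt_trans TV0).
    rewrite add0r; have [se|se] := ltP `|s| e.
      apply: (@le_trans _ _ 0); last exact: mulr_ge0.
      rewrite nmulr_rle0 ?K_ge0//.
      by rewrite (lt_trans (ae s se)) ?oppr_lt0.
    rewrite (le_trans (ler_norm _))// normrM mulrC ler_wpM2r// ger0_norm ?K_ge0//.
    rewrite (le_trans (K_le T0 s0))// ler_wpM2l//.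
    have e2 : 0 < e ^+ 2 by exact: exprn_gt0.
    have s2 : e ^+ 2 <= s ^+ 2.
      by rewrite -[leRHS]real_normK ?num_real//; nra.
    by rewrite lef_pV2 ?posrE// (lt_le_trans e2).
  move=> /(le_trans ge0).
  rewrite opprK (_ : - (d * (cos 1 * T ^+ 2)) * (T^-1 + T^-1) = - (T * (d * cos 1 * 2))).
    lra.
  by field; rewrite gt_eqF.
have dc : 0 < d * cos 1 * 2 by rewrite mulr_gt0// mulr_gt0// cos1_gt0.
pose T := Num.max (e^-1 + 1) ((4 / e ^+ 2 * A + 1) / (d * cos 1 * 2)).
have : e^-1 < T by rewrite lt_max ltrDl ltr01.
move=> /key; apply/negP; rewrite -ltNge.
apply: (@lt_le_trans _ _ (4 / e ^+ 2 * A + 1)); first by rewrite ltrDl.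
by rewrite -ler_pdivrMr// le_max lexx orbT.
Qed.

End positive_definite.

(** * Fourier transforms on the real line *)

Section fourier.
Context {R : realType}.
Local Notation mu := (@lebesgue_measure R).
Local Notation mR := (measurableTypeR R).
Implicit Types (f g v : R -> R[i]).

Definition ccontinuous f := continuous (fun x => complex.Re (f x)) /\
  continuous (fun x => complex.Im (f x)).

Lemma ccontinuous_cmeasurable f : ccontinuous f -> cmeasurable f.
Proof. by move=> [cr ci]; split; exact: continuous_measurable_fun. Qed.

Lemma ReN_iM (z : R[i]) (t : R) : complex.Re (- ('i * z * t%:C)) = complex.Im z * t.
Proof. by case: z => a b /=; ring. Qed.

Lemma ImN_iM (z : R[i]) (t : R) : complex.Im (- ('i * z * t%:C)) = - (complex.Re z * t).
Proof. by case: z => a b /=; ring. Qed.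

Definition expi (z : R[i]) (t : R) : R[i] := cexp (- ('i * z * t%:C)).

Lemma expiD z s t : expi z (s + t) = expi z s * expi z t.
Proof. by rewrite /expi -cexpD; congr cexp; rewrite rmorphD mulrDr opprD. Qed.

Lemma normc_expi z t : normc (expi z t) = expR (complex.Im z * t).
Proof. by rewrite /expi normc_cexp ReN_iM. Qed.

Lemma normc_expi_real (x t : R) : normc (expi x%:C t) = 1.
Proof. by rewrite normc_expi /= mul0r expR0. Qed.

Lemma Re_expi (x t : R) : complex.Re (expi x%:C t) = cos (x * t).
Proof. by rewrite /expi /cexp ReN_iM ImN_iM /= mul0r expR0 cosN sinN; ring. Qed.

Lemma Im_expi (x t : R) : complex.Im (expi x%:C t) = - sin (x * t).
Proof. by rewrite /expi /cexp ReN_iM ImN_iM /= mul0r expR0 cosN sinN; ring. Qed.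

Lemma Re_conj (z : R[i]) : complex.Re (conjc z) = complex.Re z.
Proof. by case: z. Qed.

Lemma Im_conj (z : R[i]) : complex.Im (conjc z) = - complex.Im z.
Proof. by case: z. Qed.

Lemma expi_conj (x t : R) : conjc (expi x%:C t) = expi x%:C (- t).
Proof.
apply/eqP; rewrite eq_complex Re_conj Im_conj !Re_expi !Im_expi.
by rewrite mulrN cosN sinN !eqxx.
Qed.

Lemma cmeas_expi d (T : measurableType d) z (h : T -> R) : measurable_fun setT h ->
  cmeas (fun x => expi z (h x)).
Proof.
move=> mh; apply: cmeas_cexp; apply: cmeasN; apply: cmeasM; first exact: cmeas_cst.
exact: cmeas_realC.
Qed.

Lemma fourierE f z : fourier f z = cintegral (fun t => f t * expi z t).
Proof. by []. Qed.

(** The map [h] stands for the difference of the variables in convolutions and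
    for their sum in autocorrelations. *)
Lemma tonelli_mpres (f g : R -> \bar R) (h : mR * mR -> mR) :
  measurable_fun setT f -> measurable_fun setT g -> measurable_fun setT h ->
  (forall x, 0 <= f x)%E -> (forall x, 0 <= g x)%E ->
  (forall t, mpres (fun s => h (s, t))) ->
  (\int[mu]_s \int[mu]_t (f (h (s, t)) * g t) = (\int[mu]_s f s) * \int[mu]_t g t)%E.
Proof.
move=> mf mg mh f0 g0 ph.
rewrite (fubini_tonelli (fun z : mR * mR => f (h z) * g z.2)%E)//; last 2 first.
- apply: emeasurable_funM; first exact: (measurableT_comp (mf : measurable_fun setT (f : mR -> _)) mh).
  exact: (measurableT_comp (mg : measurable_fun setT (g : mR -> _))).
- by move=> z; rewrite mule_ge0.
rewrite -ge0_integralZl//; last exact: integral_ge0.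
apply: eq_integral => t _ /=.
have mft : measurable_fun setT (fun x : mR => f (h (x, t))).
  apply: (measurableT_comp (mf : measurable_fun setT (f : mR -> _))).
  by apply: (measurableT_comp mh); exact: pair2_measurable.
rewrite ge0_integralZr//.
by congr (_ * _)%E; exact: (integral_mpres (ph t) mf).
Qed.

Lemma conv_measurable (h : mR * mR -> mR) f g : measurable_fun setT h ->
  cmeasurable f -> cmeasurable g -> cmeas (fun z : mR * mR => f (h z) * g z.2).
Proof.
move=> mh mf mg; apply: cmeasM; first exact: (cmeas_comp mh mf).
exact: (cmeas_comp (@measurable_snd _ _ mR mR) mg).
Qed.

Lemma measurable_subz : measurable_fun setT (fun z : mR * mR => (z.1 - z.2 : mR)).
Proof. exact: measurable_funB. Qed.

Lemma measurable_addz : measurable_fun setT (fun z : mR * mR => (z.1 + z.2 : mR)).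
Proof. exact: measurable_funD. Qed.

Lemma conv_integrable (h : mR * mR -> mR) f g : measurable_fun setT h ->
  (forall t, mpres (fun s => h (s, t))) -> L1 f -> L1 g ->
  (\int[mu]_s \int[mu]_t (normc (f (h (s, t)) * g t))%:E < +oo)%E.
Proof.
move=> mh ph [mf fy] [mg gy].
under eq_integral do under eq_integral do rewrite normcM EFinM.
rewrite (tonelli_mpres (f := fun x => (normc (f x))%:E) (g := fun x => (normc (g x))%:E) (h := h))//.
- by apply: lte_mul_pinfty => //; [by apply: integral_ge0 => x _; rewrite lee_fin normc_ge0|rewrite ge0_fin_numE// integral_ge0// => x _; rewrite lee_fin normc_ge0].
- by apply/measurable_EFinP; exact: measurable_normc.
- by apply/measurable_EFinP; exact: measurable_normc.
- by move=> x; rewrite lee_fin normc_ge0.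
- by move=> x; rewrite lee_fin normc_ge0.
Qed.

Lemma L1_Mexpi f (x : R) : L1 f -> L1 (fun t => f t * expi x%:C t).
Proof.
move=> jf; under eq_fun do rewrite mulrC.
apply: (@L1_Mbounded _ _ _ 1) => //; first exact: cmeas_expi.
by move=> t; rewrite normc_expi_real.
Qed.

Lemma L1_slice_mpres f g (M : R) h : mpres h -> L1 f -> cmeasurable g ->
  (forall x, normc (g x) <= M) -> L1 (fun t => f (h t) * g t).
Proof.
move=> ph jf mg gM; under eq_fun do rewrite mulrC.
by apply: (L1_Mbounded mg gM); exact: (L1_mpres ph jf).
Qed.

Lemma cFubini_conv (h : mR * mR -> mR) f g : measurable_fun setT h ->
  (forall t, mpres (fun s => h (s, t))) -> L1 f -> L1 g ->
  cintegral (fun s => cintegral (fun t => f (h (s, t)) * g t)) =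
  cintegral f * cintegral g.
Proof.
move=> mh ph jf jg; have mf := L1_cmeasurable jf; have mg := L1_cmeasurable jg.
have mF := conv_measurable mh mf mg.
rewrite (cFubini mF (conv_integrable mh ph jf jg)) -cintegralZ//.
congr cintegral; apply/funext => t /=; rewrite cintegralZr; last exact: (L1_mpres (ph t) jf).
congr (_ * _); exact: (cintegral_mpres (ph t) mf).
Qed.

Lemma fourier_convolution_real g v (M : R) (x : R) : L1 g -> L1 v ->
  (forall t, normc (v t) <= M) ->
  fourier (convolution g v) x%:C = fourier g x%:C * fourier v x%:C.
Proof.
move=> jg jv vM; rewrite !fourierE.
rewrite -(cFubini_conv measurable_subz mpres_subr (L1_Mexpi x jg) (L1_Mexpi x jv)).
congr cintegral; apply/funext => s; rewrite /convolution -cintegralZr.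
  congr cintegral; apply/funext => t /=.
  have -> : expi x%:C s = expi x%:C (s - t) * expi x%:C t by rewrite -expiD subrK.
  by ring.
by apply: (L1_slice_mpres _ jg (L1_cmeasurable jv) vM); exact: mpres_sub.
Qed.

Lemma L1J v : L1 v -> L1 (fun t => conjc (v t)).
Proof.
move=> [mv vy]; split; first exact: cmeasJ.
by under eq_integral do rewrite normc_conj.
Qed.

Lemma cintegralJ v : L1 v -> cintegral (fun t => conjc (v t)) = conjc (cintegral v).
Proof.
move=> jv; rewrite /cintegral /=; congr (_ +i* _).
  by apply: eq_Rintegral => t _; rewrite Re_conj.
rewrite -mulN1r -RintegralZl//; last exact: L1_integrable_Im.
by apply: eq_Rintegral => t _; rewrite Im_conj mulN1r.
Qed.

(** The inverse Fourier transform of the squared modulus of that of [v]. *)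
Definition autocorr v (s : R) := cintegral (fun t => v (s + t) * conjc (v t)).

Lemma fourier_autocorr v (M : R) (x : R) : L1 v -> (forall t, normc (v t) <= M) ->
  fourier (autocorr v) x%:C = fourier v x%:C * conjc (fourier v x%:C).
Proof.
move=> jv vM; rewrite !fourierE; rewrite -(cintegralJ (L1_Mexpi x jv)).
rewrite -(cFubini_conv measurable_addz mpresD (L1_Mexpi x jv) (L1J (L1_Mexpi x jv))).
congr cintegral; apply/funext => s; rewrite /autocorr -cintegralZr.
  congr cintegral; apply/funext => t /=; rewrite conjcM expi_conj.
  have -> : expi x%:C s = expi x%:C (s + t) * expi x%:C (- t) by rewrite -expiD addrK.
  by ring.
under eq_fun do rewrite addrC.
apply: (L1_slice_mpres (mpresD s) jv (cmeasJ (L1_cmeasurable jv)) (M := M)).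
by move=> t; rewrite normc_conj.
Qed.

Lemma L1_autocorr v : L1 v -> L1 (autocorr v).
Proof.
move=> jv; have mv := L1_cmeasurable jv.
exact: (L1_cintegral (conv_measurable measurable_addz mv (cmeasJ mv))
  (conv_integrable measurable_addz mpresD jv (L1J jv))).
Qed.

Lemma Re_autocorr0 v : complex.Re (autocorr v 0) = \int[mu]_t (normc (v t) ^+ 2).
Proof.
rewrite /autocorr/=; apply: eq_Rintegral => t _; rewrite add0r normc_sqr.
by case: (v t) => a b /=; ring.
Qed.

Lemma continuous_Re_autocorr v (M : R) : ccontinuous v -> L1 v -> (forall t, normc (v t) <= M) ->
  {for 0, continuous (fun s => complex.Re (autocorr v s))}.
Proof.
move=> [cr ci] jv vM.
pose f (s t : R) := complex.Re (v (s + t) * conjc (v t) ).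
have mv := L1_cmeasurable jv.
have jf s : L1 (fun t => v (s + t) * conjc (v t) ).
  under eq_fun do rewrite addrC.
  apply: (L1_slice_mpres (mpresD s) jv (cmeasJ mv) (M := M)).
  by move=> t; rewrite normc_conj.
have ig := RintegrableZl M (L1_integrable_normc jv).
apply: (@continuity_under_integral R _ _ mu f setT measurableT (-1) 1 _ _ (fun t => M * normc (v t))) => //.
- by move=> s _; exact: L1_integrable_Re (jf s).
- apply: aeW => t _ s _; rewrite /f.
  rewrite (_ : (fun s => _) = fun s => complex.Re (v (s + t)) * complex.Re (v t)
     + complex.Im (v (s + t)) * complex.Im (v t)); last first.
    by apply/funext => s'; case: (v (s' + t)) => ? ?; case: (v t) => ? ? /=; ring.
  have ct : (fun s : R => s + t) @ s --> s + t.
    by apply: cvgD; [exact: cvg_id|exact: cvg_cst].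
  apply: cvgD; (apply: cvgM; last exact: cvg_cst).
  + exact: (@cvg_comp _ _ _ (fun s : R => s + t) (fun y => complex.Re (v y)) _ _ _ ct (cr (s + t))).
  + exact: (@cvg_comp _ _ _ (fun s : R => s + t) (fun y => complex.Im (v y)) _ _ _ ct (ci (s + t))).
- move=> s _; apply: aeW => t _.
  rewrite (le_trans (normc_ge_normRe _))// normcM normc_conj ler_wpM2r//; exact: normc_ge0.
- by rewrite inE/= in_itv/= ltrN10 ltr01.
Qed.

(** The half of Plancherel's theorem that matters: a pointwise bound between
    Fourier transforms on the real line gives the same bound in [L^2].  The
    combination of autocorrelations of [w] and [v] below has a nonnegative
    cosine transform, and its value at 0 is the difference of the two sides. *)
Lemma plancherel_le v w (M c : R) : ccontinuous v -> ccontinuous w -> L1 v -> L1 w ->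
  (forall t, normc (v t) <= M) -> (forall t, normc (w t) <= M) -> 0 <= c ->
  (forall x : R, c * normc (fourier v x%:C) <= normc (fourier w x%:C)) ->
  c ^+ 2 * \int[mu]_t (normc (v t) ^+ 2) <= \int[mu]_t (normc (w t) ^+ 2).
Proof.
move=> cv cw jv jw vM wM c0 vw.
have jav := L1_autocorr jv; have jaw := L1_autocorr jw.
pose a s := complex.Re (autocorr w s) - c ^+ 2 * complex.Re (autocorr v s).
have iaw := L1_integrable_Re jaw; have iav := L1_integrable_Re jav.
have ia : mu.-integrable setT (fun s => (a s)%:E).
  exact: (integrableB measurableT iaw (RintegrableZl (c ^+ 2) iav)).
have ma : measurable_fun setT a.
  have [+ _] := L1_cmeasurable jav; have [+ _] := L1_cmeasurable jaw => m1 m2.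
  by apply: measurable_funB => //; apply: measurable_funM.
have icos u (x : R) : L1 u -> mu.-integrable setT (fun s => (complex.Re (u s) * cos (x * s))%:E).
  move=> ju; apply: le_integrable (L1_integrable_Re ju) => //.
    have [mr _] := L1_cmeasurable ju.
    apply/measurable_EFinP; apply: measurable_funM => //.
    apply: (measurableT_comp (continuous_measurable_fun (@continuous_cos R))).
    exact: measurable_funM.
  move=> s _; rewrite /= lee_fin normrM ler_piMr//.
  by rewrite ler_norml cos_le1 cos_geN1.
have cosE u (x : R) : L1 u -> 2 * \int[mu]_s (complex.Re (u s) * cos (x * s)) =
    complex.Re (fourier u x%:C) + complex.Re (fourier u (- x)%:C).
  move=> ju; rewrite -ReD !fourierE -cintegralD; [|exact: L1_Mexpi|exact: L1_Mexpi].
  rewrite -RintegralZl//; last exact: icos.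
  apply: eq_Rintegral => s _; rewrite -mulrDr.
  have -> : expi x%:C s + expi (- x)%:C s = (2 * cos (x * s))%:C.
    apply/eqP; rewrite eq_complex ReD ImD !Re_expi !Im_expi /= mulNr cosN sinN.
    by apply/andP; split; apply/eqP; ring.
  by case: (u s) => ? ? /=; ring.
have acE u (N x : R) : L1 u -> (forall t, normc (u t) <= N) ->
    complex.Re (fourier (autocorr u) x%:C) = normc (fourier u x%:C) ^+ 2.
  move=> ju uN; rewrite (fourier_autocorr _ ju uN) normc_sqr.
  by case: (fourier u _) => ? ? /=; ring.
have cosN u (N x : R) : L1 u -> (forall t, normc (u t) <= N) ->
    2 * \int[mu]_s (complex.Re (autocorr u s) * cos (x * s)) =
    normc (fourier u x%:C) ^+ 2 + normc (fourier u (- x)%:C) ^+ 2.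
  by move=> ju uN; rewrite (cosE _ _ (L1_autocorr ju)) !(acE u N).
have : 0 <= a 0.
  apply: cos_transform_ge0 => //.
    apply: cvgB; first exact: continuous_Re_autocorr jw wM.
    by apply: cvgM; [exact: cvg_cst|exact: continuous_Re_autocorr jv vM].
  move=> x; rewrite -(@pmulr_rge0 _ 2)//.
  rewrite (_ : \int[mu]_s (a s * cos (x * s)) =
    \int[mu]_s (complex.Re (autocorr w s) * cos (x * s)) -
    c ^+ 2 * \int[mu]_s (complex.Re (autocorr v s) * cos (x * s))); last first.
    rewrite -RintegralZl//; last exact: icos.
    rewrite -RintegralB//; [|exact: icos|exact/RintegrableZl/icos].
    by apply: eq_Rintegral => s _; rewrite /a; ring.
  rewrite mulrBr mulrCA (cosN w M x jw wM) (cosN v M x jv vM).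
  have h y : c ^+ 2 * normc (fourier v y%:C) ^+ 2 <= normc (fourier w y%:C) ^+ 2.
    by rewrite -exprMn ler_pXn2r// nnegrE ?mulr_ge0 ?normc_ge0.
  by have := h x; have := h (- x); lra.
by rewrite /a !Re_autocorr0 subr_ge0.
Qed.

End fourier.

(** * Resolvents of causal kernels *)

Section geometric_sums.
Context {R : realType}.

(** The explicit geometric error replaces uniform convergence when the sum of
    the Neumann series is inserted into the resolvent equation. *)
Lemma series_half_approx (u : nat -> R) (C : R) : (forall n, `|u n| <= C * 2^-1 ^+ n) ->
  exists l, forall N, `|l - \sum_(0 <= n < N) u n| <= 2 * C * 2^-1 ^+ N.
Proof.
move=> uC; have C0 : 0 <= C by have := uC 0; rewrite expr0 mulr1; exact: le_trans.
have tail N k : `|\sum_(0 <= n < N + k) u n - \sum_(0 <= n < N) u n| <= 2 * C * 2^-1 ^+ N * (1 - 2^-1 ^+ k).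
  elim: k => [|k ih]; first by rewrite addn0 subrr normr0 expr0 subrr mulr0.
  rewrite addnS big_nat_recr//= -addrA addrCA.
  rewrite (le_trans (ler_normD _ _))// (le_trans (lerD (uC _) ih))//.
  by rewrite exprD [2^-1 ^+ k.+1]exprS le_eqVlt; apply/orP; left; apply/eqP; field.
have cu : cvgn (series u).
  apply: (@normed_cvg R R^o); apply: (@series_le_cvg R _ (geometric C 2^-1)) => //.
  - by move=> n; exact: normr_ge0.
  - by move=> n; rewrite /geometric/= mulr_ge0// exprn_ge0.
  - by apply: is_cvg_geometric_series; rewrite ger0_norm// invf_lt1// ltr1n.
exists (limn (series u)) => N; apply/ler_addgt0Pr => e e0.
have /cvgrPdist_lt/(_ e e0)[M _ hM] := cu.
have := hM (N + M)%N (leq_addl _ _) => /= hd.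
rewrite -(subrK (\sum_(0 <= n < N + M) u n) (limn _)) -addrA addrC.
rewrite (le_trans (ler_normD _ _))// lerD//; last exact: ltW.
rewrite (le_trans (tail N M))// ler_piMr ?mulr_ge0 ?exprn_ge0//.
Qed.

Lemma cseries_half_approx (u : nat -> R[i]) (C : R) : (forall n, normc (u n) <= C * 2^-1 ^+ n) ->
  exists l, forall N, normc (l - \sum_(0 <= n < N) u n) <= 4 * C * 2^-1 ^+ N.
Proof.
move=> uC.
have [a aP] := @series_half_approx (fun n => complex.Re (u n)) C
  (fun n => le_trans (normc_ge_normRe _) (uC n)).
have [b bP] := @series_half_approx (fun n => complex.Im (u n)) C
  (fun n => le_trans (normc_ge_normIm _) (uC n)).
exists (a +i* b) => N; apply: le_trans (normc_le_normReIm _) _.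
have ReS : complex.Re (\sum_(0 <= n < N) u n) = \sum_(0 <= n < N) complex.Re (u n).
  by elim: N => [|N ih]; rewrite ?big_nil// !big_nat_recr//= ReD ih.
have ImS : complex.Im (\sum_(0 <= n < N) u n) = \sum_(0 <= n < N) complex.Im (u n).
  by elim: N {ReS} => [|N ih]; rewrite ?big_nil// !big_nat_recr//= ImD ih.
have -> : complex.Re ((a +i* b) - \sum_(0 <= n < N) u n) = a - \sum_(0 <= n < N) complex.Re (u n).
  by rewrite -ReS; case: (\sum_(_ <= _ < _) _).
have -> : complex.Im ((a +i* b) - \sum_(0 <= n < N) u n) = b - \sum_(0 <= n < N) complex.Im (u n).
  by rewrite -ImS; case: (\sum_(_ <= _ < _) _).
by have := aP N; have := bP N; lra.
Qed.

End geometric_sums.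

Section causal_convolution.
Context {R : realType}.
Local Notation mu := (@lebesgue_measure R).
Local Notation mR := (measurableTypeR R).
Implicit Types (f g : R -> R[i]).

Definition causal f := forall t, t < 0 -> f t = 0.

Definition locally_bounded f := forall N : R, exists B, forall t, `|t| <= N -> normc (f t) <= B.

Lemma measurable_convolution f g : cmeasurable f -> cmeasurable g ->
  cmeasurable (convolution f g).
Proof.
move=> mf mg; exact: (cmeasurable_cintegral (conv_measurable measurable_subz mf mg)).
Qed.

Lemma cmeasurable_slice f g x : cmeasurable f -> cmeasurable g ->
  cmeasurable (fun t => f (x - t) * g t).
Proof.
by move=> mf mg; apply: cmeasM => //; have [mh _] := mpres_sub x; exact: (cmeas_comp mh mf).
Qed.

Lemma convolution_causal f g : causal f -> causal g -> causal (convolution f g).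
Proof.
move=> f0 g0 x x0; rewrite /convolution (_ : (fun _ => _) = fun=> 0) ?cintegral0//.
apply/funext => t; have [t0|t0] := ltP t 0; first by rewrite g0// mulr0.
by rewrite f0 ?mul0r//; lra.
Qed.

Variables (g : R -> R[i]) (L G : R).
Hypotheses (cg : ccontinuous g) (g_supp : forall t, ~~ (0 <= t <= L) -> g t = 0)
  (g_bnd : forall t, normc (g t) <= G).

Let mg := ccontinuous_cmeasurable cg.

Lemma window_slice f x B : cmeasurable f ->
  (forall t, x - L <= t <= x -> normc (f t) <= B) ->
  forall t, normc (g (x - t) * f t) <= if x - L <= t <= x then G * B else 0.
Proof.
move=> mf fB t; rewrite normcM; case: ifP => [tx|/negbT tx].
  by apply: ler_pM; rewrite ?normc_ge0// fB.
rewrite g_supp ?normc0 ?mul0r//; apply: contra tx => /andP[h1 h2].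
by apply/andP; split; lra.
Qed.

Lemma L1_window f x : cmeasurable f -> locally_bounded f ->
  L1 (fun t => g (x - t) * f t).
Proof.
move=> mf /(_ (`|x| + `|L|))[B fB].
apply: (@L1_bounded_support _ _ (G * B) (x - L) x); first exact: cmeasurable_slice.
apply: window_slice => // t /andP[h1 h2]; apply: fB.
by rewrite ler_norml; have := ler_norm x; have := ler_norm (- x);
  have := ler_norm L; have := normr_ge0 L; rewrite normrN; lra.
Qed.

Let convolution_Re_continuous f : cmeasurable f -> locally_bounded f ->
  continuous (fun x => complex.Re (convolution g f x)).
Proof.
move=> mf lf x; have [cr ci] := cg.
have [B fB] := lf (`|x| + 1 + `|L|).
have bnd y t : `]x - 1, x + 1[%classic y ->
   normc (g (y - t) * f t) <= if x - 1 - L <= t <= x + 1 then G * `|B| else 0.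
  rewrite /= in_itv/= => /andP[y1 y2].
  have G0 : 0 <= G by exact: le_trans (normc_ge0 _) (g_bnd 0).
  have := @window_slice f y `|B| mf _ t => /(_ _)/le_trans; apply.
    move=> u /andP[u1 u2]; rewrite (le_trans (fB u _)) ?ler_norm//.
    by rewrite ler_norml; have := ler_norm x; have := ler_norm (- x);
      have := ler_norm L; have := normr_ge0 L; rewrite normrN; lra.
  case: ifP => [/andP[t1 t2]|_]; last by case: ifP => // _; rewrite mulr_ge0.
  by rewrite ifT//; apply/andP; split; lra.
have cxt t y : (fun s : R => s - t) @ y --> y - t.
  by apply: cvgB; [exact: cvg_id|exact: cvg_cst].
have Ix : x \in `]x - 1, x + 1[%classic.
  by rewrite inE/= in_itv/=; apply/andP; split; lra.
apply: (@continuity_under_integral R _ _ mu (fun y t => complex.Re (g (y - t) * f t)) setT measurableT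
   (x - 1) (x + 1) _ _ (fun t => if x - 1 - L <= t <= x + 1 then G * `|B| else 0)) => //.
- by move=> y _; exact: L1_integrable_Re (L1_window y mf lf).
- apply: aeW => t _ y _.
  rewrite (_ : (fun s => _) = fun s => complex.Re (g (s - t)) * complex.Re (f t)
     - complex.Im (g (s - t)) * complex.Im (f t)); last first.
    by apply/funext => s; case: (g (s - t)) => ? ?; case: (f t) => ? ? /=.
  apply: cvgB; (apply: cvgM; last exact: cvg_cst).
  + exact: (@cvg_comp _ _ _ (fun s : R => s - t) (fun y => complex.Re (g y)) _ _ _ (cxt t y) (cr (y - t))).
  + exact: (@cvg_comp _ _ _ (fun s : R => s - t) (fun y => complex.Im (g y)) _ _ _ (cxt t y) (ci (y - t))).
- exact: integrable_itv_cst.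
- by move=> y yI; apply: aeW => t _; rewrite (le_trans (normc_ge_normRe _))// bnd.
Qed.

Lemma convolution_ccontinuous f : cmeasurable f -> locally_bounded f -> ccontinuous (convolution g f).
Proof.
move=> mf lf; split; first exact: convolution_Re_continuous.
(* the imaginary part of the convolution is the real part of that of [- 'i * f] *)
pose f' t := - 'i * f t.
have mf' : cmeasurable f' by apply: cmeasM => //; exact: cmeas_cst.
have lf' : locally_bounded f'.
  move=> N; have [B fB] := lf N; exists B => t tN.
  by rewrite /f' normcM (_ : normc (- 'i) = 1) ?mul1r ?fB//= oppr0 expr0n add0r sqrrN expr1n sqrtr1.
rewrite (_ : (fun x => _) = fun x => complex.Re (convolution g f' x)).
  exact: convolution_Re_continuous.
apply/funext => x; rewrite /convolution /f'.
under [X in complex.Re (cintegral X)]eq_fun do rewrite mulrCA.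
rewrite cintegralZ; last exact: L1_window.
by case: (cintegral _) => a b /=; ring.
Qed.

End causal_convolution.

Section exponential_integrals.
Context {R : realType}.
Local Notation mu := (@lebesgue_measure R).

Lemma measurable_expM (s : R) : measurable_fun setT (fun t : R => expR (s * t)).
Proof.
by apply: (measurableT_comp (@measurable_expR R)); exact: measurable_funM.
Qed.

Lemma continuous_expM (s : R) : continuous (fun t : R => expR (s * t)).
Proof.
move=> t; apply: (@cvg_comp _ _ _ (fun t : R => s * t) (@expR R) _ (nbhs (s * t))).
  by apply: cvgM; [exact: cvg_cst|exact: cvg_id].
exact: continuous_expR.
Qed.

Lemma is_derive_expM (s t : R) : is_derive t 1 (fun t : R => expR (s * t)) (s * expR (s * t)).
Proof.
apply: is_derive_eq; rewrite /GRing.scale/=; ring.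
Qed.

Lemma integrable_expM_window (s a b : R) :
  mu.-integrable setT (fun t => (if a <= t <= b then expR (s * t) else 0)%:E).
Proof.
apply: (@integrable_bounded_support _ _ (expR (`|s| * (`|a| + `|b|))) a b).
  by apply: measurable_fun_ifT; [exact: measurable_in_itv|exact: measurable_expM|].
move=> t; case: ifP => [/andP[h1 h2]|_]; last by rewrite normr0.
rewrite ger0_norm ?expR_ge0// ler_expR (le_trans (ler_norm _))// normrM ler_wpM2l//.
rewrite ler_norml; have := ler_norm a; have := ler_norm b; have := ler_norm (- a).
have := ler_norm (- b); rewrite !normrN; lra.
Qed.

Lemma Rintegral_expM_window (s x : R) : 0 < s -> 0 <= x ->
  \int[mu]_t (if 0 <= t <= x then expR (s * t) else 0) = (expR (s * x) - 1) / s.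
Proof.
move=> s0; rewrite le_eqVlt => /predU1P[<-|x0].
  rewrite mulr0 expR0 subrr mul0r -[RHS](mulr0 1) -[X in _ * X](subr0 0).
  rewrite -(Rintegral_itv_cst 1 (lexx 0)); apply: eq_Rintegral => t _.
  by case: ifP => // /le_anti <-; rewrite mulr0 expR0.
have dF (t : R) : is_derive t 1 (fun t => expR (s * t) / s) (expR (s * t)).
  have := is_derive_expM s t => d; apply: is_derive_eq.
  by rewrite /GRing.scale/=; field; rewrite gt_eqF.
rewrite (Rintegral_itv_primitive x0 _ dF); last exact: continuous_expM.
by rewrite mulr0 expR0; field; rewrite gt_eqF.
Qed.

Lemma integrable_exp_decay (d : R) : 0 < d ->
  mu.-integrable setT (fun t => (if 0 <= t then expR (- d * t) else 0)%:E).
Proof.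
move=> d0; apply/integrableP; split.
  apply/measurable_EFinP; apply: measurable_fun_ifT; [|exact: measurable_expM|exact: measurable_cst].
  by apply: measurable_fun_ler => //; exact: measurable_cst.
have dF (t : R) : is_derive t 1 (fun t => - (expR (- d * t) / d)) (expR (- d * t)).
  have := is_derive_expM (- d) t => h; apply: is_derive_eq.
  by rewrite /GRing.scale/=; field; rewrite gt_eqF.
have E : (\int[mu]_(t in `[0%R, +oo[) (expR (- d * t))%:E = 0%:E - (- (expR (- d * 0) / d))%:E)%E.
  apply: (@ge0_continuous_FTC2y _ _ (fun t => - (expR (- d * t) / d))).
  - by move=> t _; exact: expR_ge0.
  - by apply: continuous_subspaceT; exact: continuous_expM.
  - rewrite -oppr0; apply: cvgN; rewrite -(mul0r d^-1); apply: cvgM; last exact: cvg_cst.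
    apply/cvgrPdist_le => e e0; near=> t.
    rewrite sub0r normrN ger0_norm ?expR_ge0// -[leRHS]lnK ?posrE// ler_expR.
    rewrite mulNr lerNl -ler_pdivrMl//.
  - by move=> t _; have [] := dF t.
  - by apply: cvg_at_right_filter; apply: cvgN; apply: cvgM; [exact: continuous_expM|exact: cvg_cst].
  - by move=> t _; rewrite derive1E; have [] := dF t.
apply: (@le_lt_trans _ _ (\int[mu]_(t in `[0%R, +oo[) (expR (- d * t))%:E)%E); last by rewrite E ltry.
rewrite [leRHS]integral_mkcond le_eqVlt; apply/orP; left; apply/eqP.
apply: eq_integral => t _; rewrite patchE mem_setE in_itv/= andbT.
by case: ifP => _ /=; rewrite ?normr0// ger0_norm// expR_ge0.
Unshelve. all: by end_near. Qed.

End exponential_integrals.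

Section volterra.
Context {R : realType}.
Local Notation mu := (@lebesgue_measure R).
Local Notation mR := (measurableTypeR R).
Implicit Types (f : R -> R[i]).

Variables (g : R -> R[i]) (L G : R).
Hypotheses (cg : ccontinuous g) (g_supp : forall t, ~~ (0 <= t <= L) -> g t = 0)
  (g_bnd : forall t, normc (g t) <= G).

Let mg := ccontinuous_cmeasurable cg.

Let G0 : 0 <= G. Proof. exact: le_trans (normc_ge0 _) (g_bnd 0). Qed.

Lemma window_causal : causal g.
Proof. by move=> t t0; apply: g_supp; rewrite leNgt t0. Qed.

Lemma locally_bounded_exp f (A s : R) : 0 <= A -> 0 <= s ->
  (forall t, normc (f t) <= A * expR (s * t)) -> locally_bounded f.
Proof.
move=> A0 s0 fA N; exists (A * expR (s * N)) => t tN; rewrite (le_trans (fA t))//.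
by rewrite ler_wpM2l// ler_expR ler_wpM2l// (le_trans (ler_norm _)).
Qed.

(** Convolution by [g] contracts the functions of growth [exp (s t)] as soon as
    [s] exceeds the bound [G] of the kernel. *)
Lemma normc_convolution_exp f (A s : R) : 0 < s -> 0 <= A -> cmeasurable f -> causal f ->
  (forall t, normc (f t) <= A * expR (s * t)) ->
  forall x, normc (convolution g f x) <= G / s * A * expR (s * x).
Proof.
move=> s0 A0 mf f0 fA x.
have GA : 0 <= G / s * A by rewrite mulr_ge0// divr_ge0// ltW.
have [x0|x0] := ltP x 0.
  rewrite (convolution_causal window_causal f0)// normc0 mulr_ge0 ?expR_ge0//.
have i1 := RintegrableZl (G * A) (integrable_expM_window s 0 x).
apply: (le_trans (normc_cintegral_le (cmeasurable_slice x mg mf) i1 _)).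
  move=> t; rewrite normcM; case: ifP => [_|/negbT tx].
    by rewrite -mulrA; apply: ler_pM; rewrite ?normc_ge0.
  have [t0|t0] := ltP t 0; first by rewrite f0// normc0 !mulr0.
  rewrite g_supp ?normc0 ?mul0r ?mulr0//; apply: contra tx => /andP[h1 h2].
  by rewrite t0/=; lra.
rewrite RintegralZl//; last exact: integrable_expM_window.
rewrite Rintegral_expM_window// [leLHS](_ : _ = G / s * A * (expR (s * x) - 1)); last by ring.
by rewrite ler_wpM2l// lerBlDr lerDl.
Qed.

Fixpoint iter_conv (n : nat) : R -> R[i] :=
  if n is m.+1 then convolution g (iter_conv m) else g.

Let s := 2 * G + 1.

Let s0 : 0 < s. Proof. by rewrite /s; have := G0; lra. Qed.

Lemma iter_convP n : [/\ cmeasurable (iter_conv n), causal (iter_conv n) &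
  forall t, normc (iter_conv n t) <= G * 2^-1 ^+ n * expR (s * t)].
Proof.
elim: n => [|n [mn cn nP]].
  split => //; first exact: window_causal.
  move=> t /=; rewrite expr0 mulr1; have [t0|t0] := ltP t 0.
    by rewrite window_causal// normc0 mulr_ge0// expR_ge0.
  apply: le_trans (g_bnd t) _; rewrite ler_peMr// -expR0 ler_expR mulr_ge0//; exact: ltW.
split => /=.
- exact: measurable_convolution.
- exact: convolution_causal window_causal cn.
- move=> t; apply: le_trans (normc_convolution_exp s0 _ mn cn nP t) _.
    by rewrite mulr_ge0// exprn_ge0.
  have Gs : G / s <= 2^-1 by rewrite ler_pdivrMr// /s; lra.
  rewrite ler_wpM2r ?expR_ge0// exprS [leRHS]mulrCA.
  by rewrite ler_wpM2r// mulr_ge0// exprn_ge0.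
Qed.

(** The Neumann series converges geometrically for the growth [exp (s t)] with
    [s = 2 G + 1].  The exponential rate obtained in this way is far from the
    optimal one. *)
Lemma volterra_resolvent : exists psi, [/\ ccontinuous psi, causal psi,
  (exists A r, [/\ 0 <= A, 0 <= r & forall t, normc (psi t) <= A * expR (r * t)]) &
  forall x, psi x = g x + convolution g psi x].
Proof.
have sums t : exists l, forall N,
    normc (l - \sum_(0 <= n < N) iter_conv n t) <= 4 * (G * expR (s * t)) * 2^-1 ^+ N.
  apply: cseries_half_approx => n; have [_ _ h] := iter_convP n.
  by rewrite (le_trans (h t))// mulrAC.
have [psi psiP] := choice sums.
pose S N t := \sum_(0 <= n < N) iter_conv n t.
have SD N : S N.+1 = fun t => S N t + iter_conv N t.
  by apply/funext => t; rewrite /S big_nat_recr.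
have mS N : cmeasurable (S N).
  elim: N => [|N ih]; first by rewrite /S; under eq_fun do rewrite big_nil; exact: cmeas_cst.
  by rewrite SD; apply: cmeasD => //; have [] := iter_convP N.
have cS N : causal (S N).
  by move=> t t0; rewrite /S big1// => n _; have [_ h _] := iter_convP n; exact: h.
have half0 (C e : R) : 0 < e -> exists N, C * 2^-1 ^+ N < e.
  move=> e0; have h : `|2^-1 : R| < 1 by rewrite ger0_norm// invf_lt1// ltr1n.
  have /cvgrPdist_lt/(_ e e0)[N _ hN] := cvg_geometric C h.
  exists N; have := hN N (leqnn _); rewrite /= sub0r normrN => /(le_lt_trans _); apply; exact: ler_norm.
have cpsi : causal psi.
  move=> t t0; apply: eq0_normc; apply/eqP; rewrite eq_le normc_ge0 andbT.
  apply/ler_addgt0Pr => e e0; rewrite add0r; have [N hN] := half0 (4 * (G * expR (s * t))) e e0.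
  by apply/ltW/(le_lt_trans _ hN); have := psiP t N; rewrite -/(S N t) cS// subr0.
have psiA t : normc (psi t) <= 4 * G * expR (s * t).
  by have := psiP t 0; rewrite big_nil subr0 expr0 mulr1 mulrA.
have G40 : 0 <= 4 * G by rewrite mulr_ge0.
have mpsi : cmeasurable psi.
  split.
  - apply: (measurable_fun_cvg (h := fun N t => complex.Re (S N t))) => [N|t _]; first by have [] := mS N.
    apply/cvgrPdist_lt => e e0; have [N hN] := half0 (4 * (G * expR (s * t))) e e0.
    exists N => // M /= NM; rewrite -raddfB (le_lt_trans (normc_ge_normRe _))//.
    rewrite (le_lt_trans (psiP t M))// (le_lt_trans _ hN)// ler_wpM2l ?mulr_ge0 ?expR_ge0//.
    by rewrite ler_wiXn2l// invf_le1// ler1n.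
  - apply: (measurable_fun_cvg (h := fun N t => complex.Im (S N t))) => [N|t _]; first by have [] := mS N.
    apply/cvgrPdist_lt => e e0; have [N hN] := half0 (4 * (G * expR (s * t))) e e0.
    exists N => // M /= NM; rewrite -raddfB (le_lt_trans (normc_ge_normIm _))//.
    rewrite (le_lt_trans (psiP t M))// (le_lt_trans _ hN)// ler_wpM2l ?mulr_ge0 ?expR_ge0//.
    by rewrite ler_wiXn2l// invf_le1// ler1n.
have lpsi := locally_bounded_exp G40 (ltW s0) psiA.
have lS N : locally_bounded (S N).
  apply: (@locally_bounded_exp _ (4 * G * 2^-1 ^+ N + 4 * G) s); rewrite ?addr_ge0 ?mulr_ge0 ?exprn_ge0 ?(ltW s0)//.
  move=> t; rewrite -[S N t](subKr (psi t)) (le_trans (normcB _ _))// addrC mulrDl lerD//.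
  by rewrite (le_trans (psiP t N))//; rewrite le_eqVlt; apply/orP; left; apply/eqP; ring.
have convS N x : convolution g (S N) x = S N.+1 x - g x.
  elim: N => [|N ih].
    rewrite /S big_nat1 subrr /convolution (_ : (fun _ => _) = fun=> 0) ?cintegral0//.
    by apply/funext => t; rewrite big_nil mulr0.
  have [mn _ bn] := iter_convP N.
  have ln : locally_bounded (iter_conv N).
    by apply: locally_bounded_exp bn; rewrite ?mulr_ge0 ?exprn_ge0// ltW.
  rewrite [in RHS]SD addrAC -ih /convolution -cintegralD; last 2 first.
  - exact: (L1_window cg g_supp g_bnd x (mS N) (lS N)).
  - exact: (L1_window cg g_supp g_bnd x mn ln).
  by congr cintegral; apply/funext => t; rewrite SD mulrDr.
have psiE x : psi x = g x + convolution g psi x.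
  apply/eqP; rewrite -subr_eq0 -normc_eq0 eq_le normc_ge0 andbT.
  apply/ler_addgt0Pr => e e0; rewrite add0r.
  pose C := 4 * (G * expR (s * x)) + G / s * (4 * G) * expR (s * x).
  have [N hN] := half0 C e e0.
  apply: le_trans (ltW hN).
  have -> : psi x - (g x + convolution g psi x) =
      (psi x - S N.+1 x) - convolution g (fun t => psi t - S N t) x.
    have -> : convolution g (fun t => psi t - S N t) x = convolution g psi x - convolution g (S N) x.
      rewrite /convolution -cintegralB; last 2 first.
      - exact: (L1_window cg g_supp g_bnd x mpsi lpsi).
      - exact: (L1_window cg g_supp g_bnd x (mS N) (lS N)).
      by congr cintegral; apply/funext => t; rewrite mulrBr.
    by rewrite convS; ring.
  rewrite (le_trans (normcB _ _))// /C mulrDl lerD//.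
    rewrite (le_trans (psiP x N.+1))// ler_wpM2l ?mulr_ge0 ?expR_ge0//.
    by rewrite ler_wiXn2l// invf_le1// ler1n.
  have := @normc_convolution_exp (fun t => psi t - S N t) (4 * G * 2^-1 ^+ N) s s0 _ (cmeasB mpsi (mS N)) _ _ x.
  rewrite mulr_ge0 ?exprn_ge0// => /(_ isT) h; apply: (le_trans (h _ _)).
  - by move=> t t0; rewrite cpsi// cS// subrr.
  - move=> t; rewrite (le_trans (psiP t N))// le_eqVlt; apply/orP; left; apply/eqP; ring.
  - by rewrite le_eqVlt; apply/orP; left; apply/eqP; ring.
exists psi; split => //; last by exists (4 * G), s; split => //; exact: ltW.
rewrite (_ : psi = fun x => g x + convolution g psi x); last exact/funext.
have [cr ci] := cg; have [cr' ci'] := convolution_ccontinuous cg g_supp g_bnd mpsi lpsi.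
split=> x.
- under eq_fun do rewrite ReD; apply: cvgD; [exact: cr|exact: cr'].
- under eq_fun do rewrite ImD; apply: cvgD; [exact: ci|exact: ci'].
Qed.

End volterra.

Section real_tools.
Context {R : realType}.
Local Notation mu := (@lebesgue_measure R).
Local Notation mR := (measurableTypeR R).

Lemma expi_cartesian (a b t : R) : expi (a +i* b) t = (expR (b * t))%:C * expi a%:C t.
Proof.
by rewrite /expi /cexp !ReN_iM !ImN_iM /= mul0r expR0 mul1r.
Qed.

Lemma cintegral_realC (f : R -> R) : cintegral (fun t => (f t)%:C) = (\int[mu]_t f t)%:C.
Proof. by rewrite /cintegral/= Rintegral_cst// mul0r. Qed.

Lemma L1_realC (f : R -> R) : measurable_fun setT f ->
  mu.-integrable setT (fun t => (f t)%:E) -> L1 (fun t => (f t)%:C).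
Proof.
move=> mf jf; apply: (@L1_dominated _ _ (fun t => `|f t|)).
- exact: cmeas_realC.
- exact: (integrable_norm jf).
- by move=> t; rewrite normcC.
Qed.

Lemma Rintegral_conv (f g : R -> R) : measurable_fun setT f -> measurable_fun setT g ->
  mu.-integrable setT (fun t => (f t)%:E) -> mu.-integrable setT (fun t => (g t)%:E) ->
  mu.-integrable setT (fun x => (\int[mu]_t (f (x - t) * g t))%:E) /\
  \int[mu]_x \int[mu]_t (f (x - t) * g t) = \int[mu]_x f x * \int[mu]_t g t.
Proof.
move=> mf mg jf jg.
have cf := L1_realC mf jf; have cg := L1_realC mg jg.
have E x : cintegral (fun t => (f (x - t))%:C * (g t)%:C) = (\int[mu]_t (f (x - t) * g t))%:C.
  by rewrite -cintegral_realC; congr cintegral; apply/funext => t; rewrite rmorphM.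
split.
  have := L1_cintegral (conv_measurable measurable_subz (L1_cmeasurable cf) (L1_cmeasurable cg))
    (conv_integrable measurable_subz mpres_subr cf cg).
  by move=> /L1_integrable_Re; apply: eq_integrable => // x _; exact: (congr1 (fun z => (complex.Re z)%:E) (E x)).
have := cFubini_conv measurable_subz mpres_subr cf cg.
rewrite /= !cintegral_realC -rmorphM/= => /(congr1 (@complex.Re R)) /= <-.
by apply: eq_Rintegral => x _; exact: (esym (congr1 (@complex.Re R) (E x))).
Qed.

Lemma ccontinuousM_real (r : R -> R) (f : R -> R[i]) : continuous r -> ccontinuous f ->
  ccontinuous (fun t => (r t)%:C * f t).
Proof.
move=> cr [fr fi]; split=> x.
- rewrite (_ : (fun _ => _) = fun t => r t * complex.Re (f t)).
    by apply: cvgM; [exact: cr|exact: fr].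
  by apply/funext => t; case: (f t) => ? ? /=; ring.
- rewrite (_ : (fun _ => _) = fun t => r t * complex.Im (f t)).
    by apply: cvgM; [exact: cr|exact: fi].
  by apply/funext => t; case: (f t) => ? ? /=; ring.
Qed.

Lemma ccontinuousB (f g : R -> R[i]) : ccontinuous f -> ccontinuous g -> ccontinuous (fun t => f t - g t).
Proof.
have ReB (z w : R[i]) : complex.Re (z - w) = complex.Re z - complex.Re w by case: z w => ? ? [].
have ImB (z w : R[i]) : complex.Im (z - w) = complex.Im z - complex.Im w by case: z w => ? ? [].
move=> [fr fi] [gr gi]; split=> x.
- by under eq_fun do rewrite ReB; apply: cvgB; [exact: fr|exact: gr].
- by under eq_fun do rewrite ImB; apply: cvgB; [exact: fi|exact: gi].
Qed.

End real_tools.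

Section bootstrap.
Context {R : realType}.
Local Notation mu := (@lebesgue_measure R).
Local Notation mR := (measurableTypeR R).

Variables (g : R -> R[i]) (L G c : R).
Hypotheses (cg : ccontinuous g) (g_supp : forall t, ~~ (0 <= t <= L) -> g t = 0)
  (g_bnd : forall t, normc (g t) <= G) (L0 : 0 < L) (c0 : 0 < c).
Hypothesis g_sym : forall z : R[i], complex.Im z <= 0 -> c <= normc (1 - fourier g z).

Variable psi : R -> R[i].
Hypotheses (cpsi : ccontinuous psi) (psi0 : causal psi)
  (psiE : forall x, psi x = g x + convolution g psi x).

Let G0 : 0 <= G. Proof. exact: le_trans (normc_ge0 _) (g_bnd 0). Qed.

Let box (t : R) : R := if 0 <= t <= L then 1 else 0.

Let mbox : measurable_fun setT box.
Proof.
by apply: measurable_fun_ifT; [exact: measurable_in_itv|exact: measurable_cst|exact: measurable_cst].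
Qed.

Let ibox : mu.-integrable setT (fun t => (box t)%:E) := integrable_itv_cst 1 0 L.

Let Ibox : \int[mu]_t box t = L.
Proof. by rewrite Rintegral_itv_cst ?(ltW L0)// mul1r subr0. Qed.

Let box0 t : 0 <= box t. Proof. by rewrite /box; case: ifP. Qed.
Let box1 t : box t <= 1. Proof. by rewrite /box; case: ifP. Qed.
Let boxx t : box t * box t = box t. Proof. by rewrite /box; case: ifP; rewrite ?mulr1 ?mulr0. Qed.

Let D := G * (1 + L + 4 * G ^+ 2 * L / c ^+ 2).

(** Multiplying [psi] by [exp (- s t)], flattened beyond [T] so as to make it
    integrable, perturbs the equation by an amount proportional to the slope of
    the flattening.  The bound on the symbol and Plancherel's inequality give an
    [L^2] estimate in which this perturbation is absorbed, and convolving once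
    with [g] turns it into a bound of [psi T] by a constant independent of the
    growth assumed at the start. *)
Lemma resolvent_step (s d D' : R) : 0 <= s -> 0 < d ->
  16 * d ^+ 2 * L ^+ 4 * G ^+ 2 <= c ^+ 2 ->
  (forall t, normc (psi t) <= D' * expR ((s + d) * t)) ->
  forall t, normc (psi t) <= D * expR (s * t).
Proof.
move=> s0 d0 dc psiD' T.
have D0 : 0 <= D.
  rewrite /D; apply: mulr_ge0 => //; apply: addr_ge0; first by rewrite addr_ge0// ltW.
  by apply: divr_ge0; rewrite ?sqr_ge0//; apply: mulr_ge0; rewrite ?(ltW L0)// mulr_ge0 ?sqr_ge0.
have [T0|T0] := ltP T 0.
  by rewrite psi0// normc0 mulr_ge0// expR_ge0.
have D'0 : 0 <= D'.
  by have := psiD' 0; rewrite mulr0 expR0 mulr1; apply: le_trans; exact: normc_ge0.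
pose gs t := (expR (- s * t))%:C * g t.
pose ps t := (expR (- s * t))%:C * psi t.
pose r (t : R) := expR (- (2 * d) * Num.max (t - T) 0).
pose v t := (r t)%:C * ps t.
have cr : continuous r.
  move=> x; apply: (@cvg_comp _ _ _ (fun t : R => Num.max (t - T) 0) (fun y : R => expR (- (2 * d) * y)) _
     (nbhs (Num.max (x - T) 0))); last exact: continuous_expM.
  apply: (@continuous_max _ _ (fun t : R => (t - T : R^o)) (fun=> 0) x); last exact: cvg_cst.
  by apply: cvgB; [exact: cvg_id|exact: cvg_cst].
have cgs : ccontinuous gs by apply: ccontinuousM_real => //; exact: continuous_expM.
have cps : ccontinuous ps by apply: ccontinuousM_real => //; exact: continuous_expM.
have cv : ccontinuous v by exact: ccontinuousM_real.
have gs_supp t : ~~ (0 <= t <= L) -> gs t = 0 by move=> /g_supp gt; rewrite /gs gt mulr0.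
have gs_bnd t : normc (gs t) <= G.
  have [t0|t0] := ltP t 0.
    by rewrite gs_supp ?normc0// leNgt t0.
  rewrite normcM normcC ger0_norm ?expR_ge0// (le_trans _ (g_bnd t))// ler_piMl ?normc_ge0//.
  by rewrite -expR0 ler_expR mulNr oppr_le0 mulr_ge0.
have gs_box t : normc (gs t) <= G * box t.
  rewrite /box; case: ifP => [_|/negbT tL]; first by rewrite mulr1.
  by rewrite gs_supp// normc0 mulr0.
have rge0 t : 0 <= r t by exact: expR_ge0.
have rle1 t : r t <= 1.
  rewrite /r -expR0 ler_expR mulNr oppr_le0; apply: mulr_ge0.
    by rewrite mulr_ge0// ltW.
  by rewrite le_max lexx orbT.
have rT t : t <= T -> r t = 1.
  move=> tT; rewrite /r (_ : Num.max _ _ = 0) ?mulr0 ?expR0//.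
  by apply/max_idPr; rewrite subr_le0.
have normv t : normc (v t) = r t * normc (ps t).
  by rewrite /v normcM normcC ger0_norm.
pose C := D' * expR (2 * d * T).
have C0 : 0 <= C by rewrite mulr_ge0// expR_ge0.
have vC t : normc (v t) <= C * (if 0 <= t then expR (- d * t) else 0).
  case: ifP => [t0|/negbT]; last first.
    by rewrite -ltNge => t0; rewrite /v /ps psi0// !mulr0 normc0.
  rewrite normv /ps normcM normcC (ger0_norm (expR_ge0 _)).
  apply: (@le_trans _ _ (r t * (expR (- s * t) * (D' * expR ((s + d) * t))))).
    by rewrite ler_wpM2l// ler_wpM2l ?expR_ge0.
  rewrite /C /r [leLHS](_ : _ = D' * (expR (- (2 * d) * Num.max (t - T) 0) * (expR (- s * t) * expR ((s + d) * t)))); last by ring.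
  rewrite -mulrA ler_wpM2l// -!expRD ler_expR.
  have : t - T <= Num.max (t - T) 0 by rewrite le_max lexx.
  move=> /(ler_wpM2l (ltW d0)); lra.
have vM t : normc (v t) <= C.
  apply: (le_trans (vC t)); rewrite ler_piMr//; case: ifP => // t0.
  by rewrite -expR0 ler_expR mulNr oppr_le0 mulr_ge0// ltW.
have mgs := ccontinuous_cmeasurable cgs; have mps := ccontinuous_cmeasurable cps.
have mv := ccontinuous_cmeasurable cv.
have jv : L1 v.
  apply: (L1_dominated mv _ vC); exact: (RintegrableZl C (integrable_exp_decay d0)).
have jgs : L1 gs.
  apply: (@L1_bounded_support _ _ G 0 L) => // t; case: ifP => // /negbT tL.
  by rewrite gs_supp// normc0.
pose w x := v x - convolution gs v x.
have lv : locally_bounded v by move=> N; exists C.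
have lps : locally_bounded ps.
  move=> N; exists (D' * expR (d * N)) => t tN.
  rewrite /ps normcM normcC (ger0_norm (expR_ge0 _)).
  apply: (@le_trans _ _ (expR (- s * t) * (D' * expR ((s + d) * t)))).
    by rewrite ler_wpM2l// expR_ge0.
  rewrite mulrCA -expRD ler_wpM2l// ler_expR (_ : - s * t + _ = d * t); last by ring.
  by rewrite ler_wpM2l ?(ltW d0)// (le_trans (ler_norm _)).
have psE x : ps x = gs x + convolution gs ps x.
  rewrite /ps psiE mulrDr; congr (_ + _).
  rewrite /convolution -cintegralZ; last first.
    have lpsi : locally_bounded psi.
      apply: (@locally_bounded_exp _ _ D' (s + d)) => //; exact: addr_ge0 (ltW d0).
    exact: (L1_window cg g_supp g_bnd x (ccontinuous_cmeasurable cpsi) lpsi).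
  congr cintegral; apply/funext => t.
  rewrite (_ : - s * x = - s * (x - t) + - s * t); last by ring.
  by rewrite expRD rmorphM /gs /=; ring.
have cw : ccontinuous w by apply: ccontinuousB => //; exact: (convolution_ccontinuous cgs gs_supp gs_bnd mv lv).
pose A x := \int[mu]_t (box (x - t) * normc (v t)).
pose q t := normc (v t) ^+ 2.
pose J x := \int[mu]_t (box (x - t) * q t).
pose Q := \int[mu]_t q t.
have mnv := measurable_normc mv.
have mq : measurable_fun setT q by exact: measurable_funX.
have inv := L1_integrable_normc jv.
have iq : mu.-integrable setT (fun t => (q t)%:E).
  apply: le_integrable (RintegrableZl C inv) => //; first exact/measurable_EFinP.
  move=> t _; rewrite /= lee_fin ger0_norm ?sqr_ge0// (le_trans _ (ler_norm _))//.
  by rewrite /q expr2 ler_wpM2r ?normc_ge0.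
have Q0 : 0 <= Q by apply: Rintegral_ge0 => t _; exact: sqr_ge0.
have mboxx (x : R) : measurable_fun setT (fun t : R => box (x - t)).
  by apply: (measurableT_comp mbox); have [] := mpres_sub x.
have iboxM (x : R) (f : R -> R) : measurable_fun setT f -> mu.-integrable setT (fun t => (f t)%:E) ->
    mu.-integrable setT (fun t => (box (x - t) * f t)%:E).
  move=> mf jf; apply: le_integrable jf => //; first by apply/measurable_EFinP; apply: measurable_funM; [exact: mboxx|].
  by move=> t _; rewrite /= lee_fin normrM ler_piMl// ger0_norm.
have iboxx (x : R) : mu.-integrable setT (fun t => (box (x - t))%:E).
  apply: (@integrable_bounded_support _ _ 1 (x - L) x) => // t.
  rewrite /box; case: ifP => [/andP[h1 h2]|_]; last by rewrite normr0; case: ifP.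
  by rewrite ifT ?normr1//; apply/andP; split; lra.
have Iboxx (x : R) : \int[mu]_t box (x - t) = L by rewrite (Rintegral_mpres (mpres_sub x) mbox).
have [iJ IJ] := Rintegral_conv mbox mq ibox iq.
have A0 x : 0 <= A x by apply: Rintegral_ge0 => t _; rewrite mulr_ge0// normc_ge0.
have AJ x : A x ^+ 2 <= L * J x.
  have key : 2 * (A x / L) * A x <= J x + (A x / L) ^+ 2 * L.
    rewrite /J -[X in _ + _ * X](Iboxx x) /A -!RintegralZl//; [|exact: iboxx|exact: iboxM].
    rewrite -RintegralD//; [|exact: iboxM|exact: RintegrableZl].
    rewrite -/(A x); apply: le_Rintegral => //.
    - exact: RintegrableZl (iboxM _ _ mnv inv).
    - exact: (integrableD _ (iboxM x _ mq iq) (RintegrableZl _ (iboxx x))).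
    - move=> t _; have := sqr_ge0 (normc (v t) - A x / L).
      by rewrite -(ler_pM2l (_ : 0 < 1))// /q; have := box0 (x - t); nra.
  move: key; rewrite (_ : 2 * (A x / L) * A x = 2 * (A x ^+ 2 / L)); last by ring.
  rewrite (_ : (A x / L) ^+ 2 * L = A x ^+ 2 / L); last by field; rewrite gt_eqF.
  by move=> h; rewrite -ler_pdivrMl// mulrC; lra.
have convA x : normc (convolution gs v x) <= G * A x.
  rewrite /A -RintegralZl//; last exact: iboxM.
  apply: normc_cintegral_le; first exact: cmeasurable_slice.
    exact: RintegrableZl (iboxM _ _ mnv inv).
  by move=> t; rewrite normcM mulrA ler_wpM2r ?normc_ge0.
have AL x : A x <= C * L.
  rewrite -(Iboxx x) -RintegralZl; [|by []|exact: iboxx].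
  rewrite /A; apply: le_Rintegral => //.
  - exact: iboxM.
  - exact: RintegrableZl.
  - by move=> t _; rewrite mulrC ler_wpM2r.
have [h hE] : exists h, h = 2 * d * L by eexists.
have wE x : w x = (r x)%:C * gs x + cintegral (fun t => gs (x - t) * ((r x - r t)%:C * ps t)).
  rewrite /w /v psE mulrDr -addrA; congr (_ + _).
  have j1 := L1_window cgs gs_supp gs_bnd x mps lps.
  have j2 := L1_window cgs gs_supp gs_bnd x mv lv.
  rewrite /convolution -cintegralZ// -cintegralB//; last exact: L1Z.
  by congr cintegral; apply/funext => t; rewrite rmorphB/=; ring.
have wA x : normc (w x) <= G * box x + h * G * A x.
  rewrite wE (le_trans (le_normcD _ _))// lerD//.
    rewrite normcM normcC ger0_norm// (le_trans _ (gs_box x))// ler_piMl//; exact: normc_ge0.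
  rewrite /A -RintegralZl//; last exact: iboxM.
  apply: normc_cintegral_le.
  - apply: cmeasurable_slice => //; apply: cmeasM => //; apply: cmeas_realC.
    by apply: measurable_funB => //; exact: continuous_measurable_fun.
  - exact: RintegrableZl (iboxM _ _ mnv inv).
  move=> t; rewrite (normcM (gs (x - t))) (normcM (r x - r t)%:C) normcC normv.
  have [tL|tL] := boolP (0 <= x - t <= L); last first.
    by rewrite gs_supp// normc0 mul0r mulr_ge0 ?mulr_ge0 ?normc_ge0//; rewrite hE !mulr_ge0// ltW.
  rewrite (_ : box (x - t) = 1) ?mul1r; last by rewrite /box tL.
  have rr : `|r x - r t| <= h * r t.
    have -> : r x = r t * expR (- (2 * d) * (Num.max (x - T) 0 - Num.max (t - T) 0)).
      by rewrite /r -expRD; congr expR; ring.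
    rewrite -{2}[r t]mulr1 -mulrBr normrM ger0_norm// mulrC ler_wpM2r//.
    have [mm1 mm2] : 0 <= Num.max (x - T) 0 - Num.max (t - T) 0 /\ Num.max (x - T) 0 - Num.max (t - T) 0 <= L.
      by move: tL => /andP[h1 h2]; rewrite !maxEle; case: ifP => q1; case: ifP => q2; split; lra.
    set m := _ - _ in mm1 mm2 *.
    have := expR_ge1Dx (- (2 * d) * m).
    have e1 : expR (- (2 * d) * m) <= 1 by rewrite -expR0 ler_expR mulNr oppr_le0 mulr_ge0// mulr_ge0// ltW.
    have e3 : 2 * d * m <= 2 * d * L by rewrite ler_wpM2l// mulr_ge0// ltW.
    rewrite ler_norml hE => e2; apply/andP; split; lra.
  rewrite [leRHS](_ : _ = G * (h * r t * normc (ps t))); last by ring.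
  apply: ler_pM; [exact: normc_ge0|by rewrite mulr_ge0 ?normc_ge0|exact: gs_bnd|].
  by rewrite ler_wpM2r ?normc_ge0.
have h0 : 0 <= h by rewrite hE !mulr_ge0// ltW.
have jconv : L1 (convolution gs v).
  exact: (L1_cintegral (conv_measurable measurable_subz mgs mv)
    (conv_integrable measurable_subz mpres_subr jgs jv)).
have jw : L1 w by exact: L1B.
pose M := C + G * (C * L).
have wM x : normc (w x) <= M.
  apply: (le_trans (normcB _ _)); apply: lerD => //.
  by apply: (le_trans (convA x)); rewrite ler_wpM2l.
have vM' x : normc (v x) <= M.
  by apply: (le_trans (vM x)); rewrite lerDl !mulr_ge0// ltW.
have fgs (x : R) : fourier gs x%:C = fourier g (x +i* (- s)).
  by rewrite !fourierE; congr cintegral; apply/funext => t; rewrite expi_cartesian /gs; ring.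
have fw (x : R) : c * normc (fourier v x%:C) <= normc (fourier w x%:C).
  have -> : fourier w x%:C = (1 - fourier gs x%:C) * fourier v x%:C.
    rewrite mulrBl mul1r -(fourier_convolution_real _ jgs jv vM) !fourierE.
    rewrite -cintegralB; [|exact: L1_Mexpi|exact: L1_Mexpi].
    by congr cintegral; apply/funext => t; rewrite /w mulrBl.
  rewrite normcM ler_wpM2r ?normc_ge0// fgs; apply: g_sym => /=.
  by rewrite oppr_le0.
have pl := plancherel_le cv cw jv jw vM' wM (ltW c0) fw.
rewrite -/Q in pl.
have nw x : normc (w x) ^+ 2 <= 2 * G ^+ 2 * box x + 2 * h ^+ 2 * G ^+ 2 * L * J x.
  apply: (@le_trans _ _ ((G * box x + h * G * A x) ^+ 2)).
    rewrite ler_pXn2r// nnegrE ?normc_ge0//; apply: addr_ge0; first exact: mulr_ge0.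
    by rewrite mulr_ge0// mulr_ge0.
  apply: (@le_trans _ _ (2 * (G * box x) ^+ 2 + 2 * (h * G * A x) ^+ 2)).
    by have := sqr_ge0 (G * box x - h * G * A x); lra.
  have hG : 0 <= 2 * h ^+ 2 * G ^+ 2 by apply: mulr_ge0; [apply: mulr_ge0 => //|]; exact: sqr_ge0.
  have AJx := ler_wpM2l hG (AJ x).
  have bx : box x ^+ 2 = box x by rewrite expr2 boxx.
  by rewrite !exprMn bx; lra.
have mw := L1_cmeasurable jw.
have iw2 : mu.-integrable setT (fun t => (normc (w t) ^+ 2)%:E).
  apply: le_integrable (RintegrableZl M (L1_integrable_normc jw)) => //.
    by apply/measurable_EFinP; apply: measurable_funX; exact: measurable_normc.
  move=> t _; rewrite /= lee_fin ger0_norm ?sqr_ge0// (le_trans _ (ler_norm _))//.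
  by rewrite expr2 ler_wpM2r ?normc_ge0.
rewrite Ibox -/Q in IJ.
have Q_eq : c ^+ 2 * Q <= 2 * G ^+ 2 * L + 2 * h ^+ 2 * G ^+ 2 * L * (L * Q).
  apply: (le_trans pl); rewrite -{1}Ibox -IJ -RintegralZl//.
  rewrite -[X in _ + X]RintegralZl// -RintegralD//; last 2 first.
  - exact: RintegrableZl.
  - exact: RintegrableZl.
  apply: le_Rintegral => //.
  - exact: (integrableD _ (RintegrableZl _ ibox) (RintegrableZl _ iJ)).
  - by move=> x _; exact: nw.
have Q_le : Q <= 4 * G ^+ 2 * L / c ^+ 2.
  have c2 : 0 < c ^+ 2 by exact: exprn_gt0.
  rewrite ler_pdivlMr//.
  have : 2 * h ^+ 2 * G ^+ 2 * L * (L * Q) <= c ^+ 2 / 2 * Q.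
    rewrite (_ : _ * _ = (8 * d ^+ 2 * L ^+ 4 * G ^+ 2) * Q); last by rewrite hE; ring.
    by rewrite ler_wpM2r//; lra.
  lra.
have AQ : A T <= L + Q.
  rewrite -(Iboxx T) /A /Q -RintegralD; [|by []|exact: iboxx|exact: iq].
  apply: le_Rintegral => //.
  - exact: iboxM.
  - exact: (integrableD _ (iboxx T) iq).
  - move=> t _; have := sqr_ge0 (normc (v t) - 1); have := box0 (T - t); have := box1 (T - t).
    have := normc_ge0 (v t); rewrite /q; rewrite /box; case: ifP => _; first by nra.
    by move=> _ _ _ _; rewrite mul0r add0r sqr_ge0.
have psT : normc (ps T) <= D.
  rewrite psE (_ : convolution gs ps T = convolution gs v T).
    apply: le_trans (le_normcD _ _) _.
    apply: le_trans (lerD (gs_bnd T) (convA T)) _.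
    rewrite /D -[X in X + _]mulr1 -mulrDr ler_wpM2l//.
    by rewrite -addrA lerD2l; apply: (le_trans AQ); rewrite lerD2l.
  congr cintegral; apply/funext => t.
  have [tT|tT] := leP t T; first by rewrite /v rT// mul1r.
  by rewrite gs_supp ?mul0r// negb_and -ltNge; apply/orP; left; lra.
have -> : normc (psi T) = normc (ps T) * expR (s * T).
  rewrite /ps normcM normcC ger0_norm ?expR_ge0// mulrAC -expRD.
  by rewrite (_ : _ + _ = 0) ?expR0 ?mul1r//; ring.
by rewrite ler_wpM2r// expR_ge0.
Qed.

Hypothesis psi_exp : exists A r, [/\ 0 <= A, 0 <= r & forall t, normc (psi t) <= A * expR (r * t)].

Lemma resolvent_bounded t : normc (psi t) <= D.
Proof.
have [A [r [A0 r0 Ar]]] := psi_exp.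
(* the admissible step does not depend on the rate, so finitely many suffice *)
pose E := 16 * L ^+ 4 * G ^+ 2 / c ^+ 2.
have c2 : 0 < c ^+ 2 by exact: exprn_gt0.
have E0 : 0 <= E by rewrite divr_ge0 ?(ltW c2)// mulr_ge0 ?sqr_ge0// mulr_ge0// exprn_ge0// ltW.
pose d := (1 + E)^-1.
have E1 : 0 < 1 + E by exact: ltr_pwDl.
have d0 : 0 < d by rewrite invr_gt0.
have dc : 16 * d ^+ 2 * L ^+ 4 * G ^+ 2 <= c ^+ 2.
  have : E * d ^+ 2 <= 1.
    have d1 : d * (1 + E) = 1 by rewrite mulVf// gt_eqF.
    have : d <= 1 by rewrite -d1 ler_peMr ?(ltW d0)// lerDl.
    nra.
  rewrite /E mulrAC ler_pdivrMr// mul1r; apply: le_trans.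
  by rewrite le_eqVlt; apply/orP; left; apply/eqP; ring.
pose m := Num.bound (r / d).
have rm : r <= d *+ m.
  by rewrite -mulr_natl -ler_pdivrMr//; apply/ltW/archi_boundP; rewrite divr_ge0// ltW.
have step k : (k <= m)%N -> exists D', forall t, normc (psi t) <= D' * expR ((d *+ (m - k)) * t).
  elim: k => [_|k ih km].
    exists A => u; rewrite subn0; have [u0|u0] := ltP u 0.
      by rewrite psi0// normc0 mulr_ge0// expR_ge0.
    by apply: (le_trans (Ar u)); rewrite ler_wpM2l// ler_expR ler_wpM2r.
  have [D' hD'] := ih (ltnW km); exists D; apply: (resolvent_step (d := d) (D' := D')) => //.
    by rewrite mulrn_wge0// ltW.
  by move=> u; rewrite -mulrSr -subSn// subSS.
have [|D' hD'] := step m; first exact: leqnn.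
have D'0 : 0 <= D'.
  by have := hD' 0; rewrite mulr0 expR0 mulr1; apply: le_trans; exact: normc_ge0.
have := @resolvent_step 0 d D' (lexx _) d0 dc _ t.
rewrite mul0r expR0 mulr1; apply => u; rewrite add0r.
have [u0|u0] := ltP u 0.
  by rewrite psi0// normc0 mulr_ge0// expR_ge0.
apply: (le_trans (hD' u)); rewrite subnn mulr0n mul0r ler_wpM2l// ler_expR.
by rewrite mulr_ge0// ltW.
Qed.

End bootstrap.

Section resolvent.
Context {R : realType}.

(** The Paley--Wiener theorem on resolvents of Volterra kernels.  Multiplication
    by [exp (b t)] moves the half-plane [Im z <= b] to [Im z <= 0], where the
    successive improvements of the rate end. *)
Lemma resolvent_kernel (g : R -> R[i]) (L G b c : R) : ccontinuous g ->
  (forall t, ~~ (0 <= t <= L) -> g t = 0) -> (forall t, normc (g t) <= G) ->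
  0 < L -> 0 < c ->
  (forall z : R[i], complex.Im z <= b -> c <= normc (1 - fourier g z)) ->
  exists psi D, [/\ ccontinuous psi, causal psi, 0 <= D,
    forall t, normc (psi t) <= D * expR (- b * t) &
    forall x, psi x = g x + convolution g psi x].
Proof.
move=> cg g_supp g_bnd L0 c0 gsym.
have G0 : 0 <= G by exact: le_trans (normc_ge0 _) (g_bnd 0).
pose gb t := (expR (b * t))%:C * g t.
have cgb : ccontinuous gb by apply: ccontinuousM_real => //; exact: continuous_expM.
have gb_supp t : ~~ (0 <= t <= L) -> gb t = 0 by move=> /g_supp gt; rewrite /gb gt mulr0.
have gb_bnd t : normc (gb t) <= expR (`|b| * L) * G.
  have [/andP[t0 tL]|tL] := boolP (0 <= t <= L); last first.
    by rewrite gb_supp// normc0 mulr_ge0// expR_ge0.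
  rewrite normcM normcC ger0_norm ?expR_ge0//; apply: ler_pM; rewrite ?expR_ge0 ?normc_ge0//.
  by rewrite ler_expR (le_trans (ler_norm _))// normrM ler_wpM2l// ger0_norm.
have gbsym (z : R[i]) : complex.Im z <= 0 -> c <= normc (1 - fourier gb z).
  case: z => x y y0; have {}y0 : y <= 0 := y0.
  have -> : fourier gb (x +i* y) = fourier g (x +i* (y + b)).
    rewrite !fourierE; congr cintegral; apply/funext => t.
    by rewrite (expi_cartesian x y) (expi_cartesian x (y + b)) mulrDl expRD rmorphM /gb /=; ring.
  by apply: gsym => /=; lra.
have [psi [cpsi psi0 psiexp psiE]] := volterra_resolvent cgb gb_supp gb_bnd.
have bnd := resolvent_bounded cgb gb_supp gb_bnd L0 c0 gbsym cpsi psi0 psiE psiexp.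
pose B := expR (`|b| * L) * G; pose D := B * (1 + L + 4 * B ^+ 2 * L / c ^+ 2).
have {}bnd t : normc (psi t) <= D by exact: bnd.
exists (fun t => (expR (- b * t))%:C * psi t), D; split.
- by apply: ccontinuousM_real => //; exact: continuous_expM.
- by move=> t t0; rewrite psi0// mulr0.
- exact: le_trans (normc_ge0 _) (bnd 0).
- by move=> t; rewrite normcM normcC ger0_norm ?expR_ge0// mulrC ler_wpM2r ?expR_ge0.
move=> x; rewrite psiE mulrDr; congr (_ + _).
  rewrite /gb mulrA -rmorphM -expRD (_ : _ + _ = 0) ?expR0 ?mul1r//; ring.
have lpsi : locally_bounded psi by move=> N; exists D.
rewrite /convolution -cintegralZ; last first.
  exact: (L1_window cgb gb_supp gb_bnd x (ccontinuous_cmeasurable cpsi) lpsi).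
congr cintegral; apply/funext => t; rewrite /gb.
rewrite (_ : - b * t = - b * x + b * (x - t)); last by ring.
by rewrite expRD rmorphM/=; ring.
Qed.

End resolvent.

(** * Convolution in the weighted spaces *)

Section young.
Context {R : realType}.
Local Notation mu := (@lebesgue_measure R).
Local Notation mR := (measurableTypeR R).
Variables (p : R) (p1 : 1 <= p).

Let p0 : 0 < p. Proof. exact: lt_le_trans p1. Qed.

(** Replaces convexity: integrating this pointwise inequality and choosing [s]
    proportional to the mean gives Jensen's inequality up to a constant. *)
Lemma le_split_powR (x s : R) : 0 <= x -> 0 < s -> x <= s + s `^ (1 - p) * x `^ p.
Proof.
move=> x0 s0; have [xs|sx] := leP x s.
  by rewrite (le_trans xs)// lerDl mulr_ge0 ?powR_ge0.
have x1 : 0 < x by exact: lt_trans sx.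
apply: (@le_trans _ _ (s `^ (1 - p) * x `^ p)); last by rewrite lerDr ltW.
rewrite -(mulr_powRB1 x0 p0) mulrCA ler_pMr// -(opprB p 1) powRN mulrC.
rewrite ler_pdivlMr ?powR_gt0// mul1r.
by apply: ge0_ler_powR; [rewrite subr_ge0|exact: ltW..].
Qed.

(** Jensen's inequality up to a constant, which suffices since only the
    boundedness of operators matters. *)
Lemma weighted_average_powR (K v : mR -> \bar R) (I : R) :
  measurable_fun setT K -> measurable_fun setT v -> (forall t, 0 <= K t)%E ->
  (forall t, 0 <= v t)%E -> 0 < I -> (\int[mu]_t K t <= I%:E)%E ->
  ((\int[mu]_t (K t * v t)) `^ p <=
    (2 * (2 * I) `^ (p - 1))%:E * \int[mu]_t (K t * v t `^ p))%E.
Proof.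
move=> mK mv K0 v0 I0 KI.
set y := (\int[mu]_t (K t * v t))%E; set h := (\int[mu]_t (K t * v t `^ p))%E.
have y0 : (0 <= y)%E by apply: integral_ge0 => t _; exact: mule_ge0.
have h0 : (0 <= h)%E by apply: integral_ge0 => t _; rewrite mule_ge0// poweR_ge0.
have mvp : measurable_fun setT (fun t => (v t `^ p)%E).
  exact: (measurableT_comp (@measurable_poweR R p) mv).
have key s : (0 < s)%R -> (y <= (s * I)%:E + (s `^ (1 - p))%:E * h)%E.
  move=> s0; apply: (@le_trans _ _ (\int[mu]_t (s%:E * K t + (s `^ (1 - p))%:E * (K t * v t `^ p)))%E).
    apply: ge0_le_integral => //.
    - by move=> t _; exact: mule_ge0.
    - exact: emeasurable_funM.
    - apply: emeasurable_funD; apply: emeasurable_funM => //; exact: emeasurable_funM.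
    move=> t _; rewrite (muleC s%:E) (muleCA _ (K t)) -ge0_muleDr; last 2 first.
    - by rewrite lee_fin ltW.
    - by rewrite mule_ge0 ?lee_fin ?powR_ge0// poweR_ge0.
    apply: lee_wpmul2l => //; have := v0 t; case: (v t) => [r r0|_|]//.
      by rewrite poweR_EFin -EFinM -EFinD lee_fin le_split_powR.
    by rewrite poweRyr ?gt_eqF// gt0_muley ?lte_fin ?powR_gt0// addey.
  rewrite ge0_integralD//=.
  - rewrite ge0_integralZl//; last by rewrite lee_fin ltW.
    rewrite ge0_integralZl ?lee_fin ?powR_ge0//.
    + by rewrite EFinM leeD2r// lee_pmul2l// ltry.
    + exact: emeasurable_funM.
    + by move=> t _; rewrite mule_ge0// poweR_ge0.
  - by move=> t _; rewrite mule_ge0// lee_fin ltW.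
  - exact: emeasurable_funM.
  - by move=> t _; rewrite !mule_ge0// ?lee_fin ?powR_ge0// poweR_ge0.
  - by apply: emeasurable_funM => //; exact: emeasurable_funM.
have [hy|] := ltP h +oo%E; last first.
  rewrite leye_eq => /eqP ->; rewrite gt0_muley ?leey// lte_fin mulr_gt0// powR_gt0// mulr_gt0//.
have hfin : h \is a fin_num by rewrite ge0_fin_numE.
have yfin : y \is a fin_num.
  rewrite ge0_fin_numE//; apply: le_lt_trans (key 1 ltr01) _.
  by rewrite -(fineK hfin) -EFinM -EFinD ltry.
move: key y0 h0; rewrite -(fineK hfin) -(fineK yfin); move: (fine h) (fine y) => H Y key Y0 H0.
rewrite !lee_fin in Y0 H0.
rewrite poweR_EFin -EFinM lee_fin.
move: Y0; rewrite le_eqVlt => /predU1P[<-|Y0].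
  by rewrite powR0 ?gt_eqF// mulr_ge0// mulr_ge0// powR_ge0.
have s0 : 0 < Y / (2 * I) by rewrite divr_gt0// mulr_gt0.
have := key _ s0; rewrite -EFinM -EFinD lee_fin.
have -> : Y / (2 * I) * I = Y / 2 by field; rewrite gt_eqF.
have YE : Y = Y / (2 * I) * (2 * I) by field; rewrite gt_eqF.
move: (Y / (2 * I)) s0 YE => s s0 YE.
move=> hh; have {}hh : Y <= 2 * (s `^ (1 - p) * H) by lra.
have sp : s `^ (1 - p) * Y `^ (p - 1) = (2 * I) `^ (p - 1).
  have I20 : 0 <= 2 * I by rewrite mulr_ge0// ltW.
  rewrite YE (powRM _ (ltW s0) I20) mulrA -powRD; last by rewrite (gt_eqF s0) implybT.
  by rewrite (_ : 1 - p + (p - 1) = 0) ?powRr0 ?mul1r//; ring.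
have -> : Y `^ p = Y * Y `^ (p - 1).
  by rewrite mulr_powRB1// ltW.
apply: le_trans (ler_wpM2r (powR_ge0 _ _) hh) _.
by rewrite -sp; rewrite le_eqVlt; apply/orP; left; apply/eqP; ring.
Qed.

Lemma measurable_convolution_ereal (W v : mR -> \bar R) : measurable_fun setT W ->
  measurable_fun setT v -> (forall t, 0 <= W t)%E -> (forall t, 0 <= v t)%E ->
  measurable_fun setT (fun x : R => \int[mu]_t (W (x - t)%R * v t))%E.
Proof.
move=> mW mv W0 v0.
apply: (@measurable_fun_fubini_tonelli_F _ _ _ _ _ mu (fun z : mR * mR => W (z.1 - z.2)%R * v z.2)%E).
  apply: emeasurable_funM; first exact: (measurableT_comp mW measurable_subz).
  exact: (measurableT_comp mv).
by move=> z; rewrite mule_ge0.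
Qed.

Lemma young_powR (W v : mR -> \bar R) (I : R) : measurable_fun setT W ->
  measurable_fun setT v -> (forall t, 0 <= W t)%E -> (forall t, 0 <= v t)%E -> 0 < I ->
  (\int[mu]_t W t <= I%:E)%E ->
  (\int[mu]_x (\int[mu]_t (W (x - t)%R * v t)) `^ p <=
    (2 * (2 * I) `^ (p - 1) * I)%:E * \int[mu]_t (v t `^ p))%E.
Proof.
move=> mW mv W0 v0 I0 WI.
have mvp : measurable_fun setT (fun t => (v t `^ p)%E).
  exact: (measurableT_comp (@measurable_poweR R p) mv).
have vp0 t : (0 <= v t `^ p)%E by exact: poweR_ge0.
have C0 : 0 <= 2 * (2 * I) `^ (p - 1) by rewrite mulr_ge0// powR_ge0.
apply: (@le_trans _ _ (\int[mu]_x ((2 * (2 * I) `^ (p - 1))%:E *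
    \int[mu]_t (W (x - t)%R * v t `^ p)))%E).
  apply: ge0_le_integral => //.
  - by move=> x _; exact: poweR_ge0.
  - apply: (measurableT_comp (@measurable_poweR R p)); exact: measurable_convolution_ereal.
  - by apply: emeasurable_funM => //; exact: measurable_convolution_ereal.
  move=> x _; apply: weighted_average_powR => //.
    by apply: (measurableT_comp mW); have [] := mpres_sub x.
  by rewrite (integral_mpres (mpres_sub x) mW).
rewrite ge0_integralZl//; last 2 first.
- exact: measurable_convolution_ereal.
- by move=> x _; apply: integral_ge0 => t _; rewrite mule_ge0.
rewrite (tonelli_mpres mW mvp measurable_subz W0 vp0 mpres_subr).
rewrite muleA [in leRHS]EFinM; apply: lee_wpmul2r; first exact: integral_ge0.
by apply: lee_wpmul2l => //; rewrite lee_fin.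
Qed.

End young.

Section dominated_kernels.
Context {R : realType}.
Local Notation mu := (@lebesgue_measure R).
Local Notation mR := (measurableTypeR R).
Variables (p : R) (w : R -> R) (p1 : 1 <= p) (ww : weight w).
Implicit Types (f g : R -> R[i]) (k l : R -> R[i]) (W : R -> R).

Let p0 : 0 < p. Proof. exact: lt_le_trans p1. Qed.

Let w0 x : 0 <= x -> 0 < w x. Proof. by have [_ h _] := ww; exact: h. Qed.

(** All that is asked of the weight: the convolution by [k], weighted on both
    sides, is dominated by the unweighted convolution by an integrable [W]. *)
Definition kernel_dom W k := [/\ cmeasurable k, measurable_fun setT W, forall t, 0 <= W t,
  mu.-integrable setT (fun t => (W t)%:E) &
  forall x t, 0 <= x -> 0 <= t -> normc (k (x - t)) * w x <= W (x - t) * w t].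

Lemma Lpw_funE f : f \in Lpw_fun p w <->
  [/\ forall x : R, x < 0 -> f x = 0, cmeasurable f & (eLpw_norm p w f < +oo)%E].
Proof. by rewrite inE. Qed.

Let v f (t : mR) : \bar R := (weighted_modulus w f t)%:E.

Let majorant W (u : mR -> \bar R) (x : mR) : \bar R := (\int[mu]_t ((W (x - t))%:E * u t))%E.

Let total W : R := \int[mu]_t W t + 1.

Let total_gt0 W : (forall t, 0 <= W t) -> 0 < total W.
Proof. by move=> W0; apply: ltr_wpDl => //; apply: Rintegral_ge0. Qed.

Let total_ge W : mu.-integrable setT (fun t => (W t)%:E) -> (\int[mu]_t (W t)%:E <= (total W)%:E)%E.
Proof.
move=> iW; rewrite EFinD /Rintegral fineK; last exact: integrable_fin_num.
by rewrite leeDl// lee_fin.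
Qed.

Definition kernel_bound W : R := (2 * (2 * total W) `^ (p - 1) * total W) `^ p^-1.

Section one_kernel.
Variables (W : R -> R) (k : R -> R[i]).
Hypothesis Wk : kernel_dom W k.

Let mk : cmeasurable k. Proof. by case: Wk. Qed.
Let mW : measurable_fun setT (fun t : mR => (W t)%:E).
Proof. by apply/measurable_EFinP; case: Wk. Qed.
Let W0 t : 0 <= W t. Proof. by case: Wk. Qed.
Let iW : mu.-integrable setT (fun t => (W t)%:E). Proof. by case: Wk. Qed.
Let dW x t : 0 <= x -> 0 <= t -> normc (k (x - t)) * w x <= W (x - t) * w t.
Proof. by case: Wk => _ _ _ _; apply. Qed.

Lemma measurable_majorant (u : mR -> \bar R) : measurable_fun setT u -> (forall t, 0 <= u t)%E ->
  measurable_fun setT (majorant W u).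
Proof.
by move=> mu' u0; apply: (measurable_convolution_ereal (W := fun t => (W t)%:E)).
Qed.

Lemma majorant_ge0 (u : mR -> \bar R) x : (forall t, 0 <= u t)%E -> (0 <= majorant W u x)%E.
Proof. by move=> u0; apply: integral_ge0 => t _; rewrite mule_ge0// lee_fin. Qed.

Lemma young_majorant (u : mR -> \bar R) : measurable_fun setT u -> (forall t, 0 <= u t)%E ->
  (\int[mu]_x (majorant W u x `^ p) <= (2 * (2 * total W) `^ (p - 1) * total W)%:E * \int[mu]_t (u t `^ p))%E.
Proof.
move=> mu' u0; apply: (young_powR p1 (W := fun t => (W t)%:E)) => //.
- exact: total_gt0.
- exact: total_ge.
Qed.

Lemma ae_majorant_lty (u : mR -> \bar R) : measurable_fun setT u -> (forall t, 0 <= u t)%E ->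
  (\int[mu]_t (u t `^ p) < +oo)%E -> {ae mu, forall x, (majorant W u x < +oo)%E}.
Proof.
move=> mu' u0 uy.
have iY : mu.-integrable setT (fun x => (majorant W u x `^ p)%E).
  apply/integrableP; split.
    by apply: (measurableT_comp (@measurable_poweR R p)); exact: measurable_majorant.
  under eq_integral do rewrite gee0_abs ?poweR_ge0//.
  apply: le_lt_trans (young_majorant mu' u0) _.
  apply: lte_mul_pinfty => //.
    by rewrite lee_fin !mulr_ge0 ?powR_ge0// ltW// total_gt0.
have := integrable_ae measurableT iY => h; apply: filterS h => x /(_ I).
rewrite ge0_fin_numE ?poweR_ge0// => /lty_poweRy; apply.
by rewrite gt_eqF.
Qed.

Lemma slice_le_majorant (u : mR -> \bar R) f x : cmeasurable f -> 0 <= x ->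
  (forall t, 0 <= u t)%E -> measurable_fun setT u ->
  (forall t, t < 0 -> f t = 0) -> (forall t, 0 <= t -> ((normc (f t) * w t)%:E <= u t)%E) ->
  ((\int[mu]_t (normc (k (x - t) * f t))%:E) * (w x)%:E <= majorant W u x)%E.
Proof.
move=> mf x0 u0 mu' f0 fu.
rewrite -ge0_integralZr//; last 3 first.
- by apply/measurable_EFinP; apply: measurable_normc; exact: cmeasurable_slice.
- by move=> t _; rewrite lee_fin normc_ge0.
- by rewrite lee_fin ltW// w0.
apply: ge0_le_integral => //.
- by move=> t _; rewrite -EFinM lee_fin mulr_ge0 ?normc_ge0// ltW// w0.
- apply: emeasurable_funM => //; apply/measurable_EFinP; apply: measurable_normc.
  exact: cmeasurable_slice.
- by apply: emeasurable_funM => //; apply: (measurableT_comp mW); have [] := mpres_sub x.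
move=> t _; have [t0|t0] := leP 0 t; last first.
  by rewrite f0// mulr0 normc0 mul0e mule_ge0// lee_fin.
apply: le_trans (lee_wpmul2l _ (fu t t0)); last by rewrite lee_fin.
rewrite -!EFinM lee_fin normcM mulrAC [leRHS]mulrCA [leRHS]mulrC -[leRHS]mulrA.
have := ler_wpM2r (normc_ge0 (f t)) (dW x0 t0); lra.
Qed.

Section one_function.
Variable f : R -> R[i].
Hypothesis fP : f \in Lpw_fun p w.

Let f0 x : x < 0 -> f x = 0. Proof. by move/Lpw_funE: fP => [h _ _]; exact: h. Qed.
Let mf : cmeasurable f. Proof. by case/Lpw_funE : fP. Qed.

Let v0 t : (0 <= v f t)%E.
Proof. by rewrite lee_fin; apply: weighted_modulus_ge0. Qed.

Let mv : measurable_fun setT (v f).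
Proof. by apply/measurable_EFinP; exact: measurable_weighted_modulus. Qed.

Let vp : ((\int[mu]_t (v f t `^ p)) `^ p^-1 = eLpw_norm p w f)%E.
Proof. by rewrite eLpw_normE. Qed.

Let vpy : (\int[mu]_t (v f t `^ p) < +oo)%E.
Proof.
have : (eLpw_norm p w f < +oo)%E by case/Lpw_funE : fP.
rewrite -vp => /lty_poweRy; apply.
by rewrite invr_eq0 gt_eqF.
Qed.

Lemma slice_le_majorant_modulus x : 0 <= x ->
  ((\int[mu]_t (normc (k (x - t) * f t))%:E) * (w x)%:E <= majorant W (v f) x)%E.
Proof. by move=> x0; apply: slice_le_majorant. Qed.

Lemma ae_L1_kernel_slice : {ae mu, forall x, 0 <= x -> L1 (fun t => k (x - t) * f t)}.
Proof.
have h := ae_majorant_lty mv v0 vpy; apply: filterS h => x Yx x0.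
split; first exact: cmeasurable_slice.
have := le_lt_trans (slice_le_majorant_modulus x0) Yx.
have : (0 <= \int[mu]_t (normc (k (x - t) * f t))%:E)%E.
  by apply: integral_ge0 => t _; rewrite lee_fin normc_ge0.
case: (\int[mu]_t _)%E => [r _ _|_|//]; first by rewrite ltry.
by rewrite gt0_mulye// lte_fin w0.
Qed.

Lemma Pplus_lt0 (F : R -> R[i]) x : x < 0 -> Pplus F x = 0.
Proof. by rewrite /Pplus leNgt => ->. Qed.

Lemma Pplus_ge0 (F : R -> R[i]) x : 0 <= x -> Pplus F x = F x.
Proof. by rewrite /Pplus => ->. Qed.

Lemma cmeasurable_Pplus (F : R -> R[i]) : cmeasurable F -> cmeasurable (Pplus F).
Proof.
move=> mF; apply: (@cmeas_if _ _ _ (fun x : mR => 0 <= x) F (fun=> 0)) => //.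
  by apply: measurable_fun_ler => //; exact: measurable_cst.
Qed.

Lemma eLpw_norm_convolution :
  (eLpw_norm p w (Pplus (convolution k f)) <= (kernel_bound W)%:E * eLpw_norm p w f)%E.
Proof.
have mF : cmeasurable (Pplus (convolution k f)).
  by apply: cmeasurable_Pplus; exact: measurable_convolution.
rewrite (eLpw_normE p ww); last by move=> x; exact: Pplus_lt0.
rewrite -vp /kernel_bound -poweR_EFin -poweRM; last 2 first.
- by rewrite lee_fin !mulr_ge0 ?powR_ge0// ltW// total_gt0.
- by apply: integral_ge0 => t _; exact: poweR_ge0.
apply: gt0_ler_poweR.
- by rewrite invr_ge0 ltW.
- by rewrite in_itv/= leey andbT; apply: integral_ge0 => t _; rewrite lee_fin powR_ge0.
- rewrite in_itv/= leey andbT mule_ge0//.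
    by rewrite lee_fin !mulr_ge0 ?powR_ge0// ltW// total_gt0.
  by apply: integral_ge0 => t _; rewrite lee_fin powR_ge0.
apply: le_trans (young_majorant mv v0).
apply: ge0_le_integral => //.
- by move=> x _; rewrite lee_fin powR_ge0.
- apply/measurable_EFinP; apply: (measurableT_comp (measurable_powR p)).
  by apply: measurable_weighted_modulus => // x; exact: Pplus_lt0.
- by apply: (measurableT_comp (@measurable_poweR R p)); exact: measurable_majorant.
move=> x _; rewrite -poweR_EFin; apply: gt0_ler_poweR.
- exact: ltW.
- rewrite in_itv/= leey andbT lee_fin; apply: weighted_modulus_ge0 => // y; exact: Pplus_lt0.
- by rewrite in_itv/= leey andbT majorant_ge0.
rewrite /weighted_modulus; have [x0|x0] := leP 0 x; last first.
  by rewrite Pplus_lt0// normc0 mul0r majorant_ge0.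
rewrite Pplus_ge0//; apply: le_trans (slice_le_majorant_modulus x0).
rewrite EFinM; apply: lee_wpmul2r; first by rewrite lee_fin ltW// w0.
by apply: normc_cintegral_ereal; exact: cmeasurable_slice.
Qed.

Lemma Lpw_fun_convolution : Pplus (convolution k f) \in Lpw_fun p w.
Proof.
apply/Lpw_funE; split.
- by move=> x; exact: Pplus_lt0.
- by apply: cmeasurable_Pplus; exact: measurable_convolution.
apply: le_lt_trans eLpw_norm_convolution _; apply: lte_mul_pinfty => //.
- by rewrite lee_fin powR_ge0.
- by case/Lpw_funE : fP.
Qed.

End one_function.
End one_kernel.

(** A common form of the two cases, both kernels causal or both anticausal, in
    which nothing is lost on the negative half line. *)
Definition half_line_compatible k l := forall x t s, 0 <= x -> t < 0 -> 0 <= s ->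
  k (x - t) = 0 \/ l (t - s) = 0.

(** Truncating the inner convolution to the half line is harmless when both
    kernels live on the same side. *)
Lemma convolutionA Wk Wl k l f : kernel_dom Wk k -> kernel_dom Wl l ->
  half_line_compatible k l -> f \in Lpw_fun p w ->
  {ae mu, forall x, 0 <= x ->
    convolution k (Pplus (convolution l f)) x = convolution (convolution k l) f x}.
Proof.
move=> Wkk Wll kl fP; have [f0 mf fy] := (Lpw_funE f).1 fP.
have [mk _ _ _ _] := Wkk; have [ml _ _ _ _] := Wll.
have v0 t : (0 <= v f t)%E by rewrite lee_fin; apply: weighted_modulus_ge0.
have mv : measurable_fun setT (v f).
  by apply/measurable_EFinP; exact: measurable_weighted_modulus.
have vpy : (\int[mu]_t (v f t `^ p) < +oo)%E.
  move: fy; rewrite (eLpw_normE p ww f0) => /lty_poweRy; apply.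
  by rewrite invr_eq0 gt_eqF.
pose yl := majorant Wl (v f).
have yl0 t : (0 <= yl t)%E by exact: majorant_ge0 Wll _ _ v0.
have myl : measurable_fun setT yl by exact: measurable_majorant Wll _ mv v0.
have ylp : (\int[mu]_t (yl t `^ p) < +oo)%E.
  apply: le_lt_trans (young_majorant Wll mv v0) _.
  apply: lte_mul_pinfty => //; rewrite lee_fin !mulr_ge0 ?powR_ge0// ltW// total_gt0//.
  by case: Wll.
have h1 := ae_majorant_lty Wkk myl yl0 ylp.
have h2 := ae_L1_kernel_slice Wll fP.
apply: filterS h1 => x Yx x0.
pose F (z : mR * mR) : R[i] := k (x - z.1) * (l (z.1 - z.2) * f z.2).
have mF : cmeas F.
  apply: cmeasM.
    have [mh _] := mpres_sub x.
    exact: (cmeas_comp (@measurable_fst _ _ mR mR) (cmeas_comp mh mk)).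
  exact: (conv_measurable measurable_subz ml mf).
have Flt0 t s : t < 0 -> F (t, s) = 0.
  move=> t0; rewrite /F/=; have [s0|s0] := leP 0 s; last by rewrite f0// !mulr0.
  by have [->|->] := kl x t s x0 t0 s0; rewrite ?mul0r ?mulr0.
have iF : (\int[mu]_t \int[mu]_s (normc (F (t, s)))%:E < +oo)%E.
  have le1 : ((\int[mu]_t \int[mu]_s (normc (F (t, s)))%:E) * (w x)%:E <= majorant Wk yl x)%E.
    rewrite -ge0_integralZr//; last 3 first.
    - apply: (@measurable_fun_fubini_tonelli_F _ _ _ _ _ mu (fun z => (normc (F z))%:E)) => //.
        by apply/measurable_EFinP; exact: measurable_normc.
      by move=> z; rewrite lee_fin normc_ge0.
    - by move=> t _; apply: integral_ge0 => s _; rewrite lee_fin normc_ge0.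
    - by rewrite lee_fin ltW// w0.
    apply: ge0_le_integral => //.
    - move=> t _; rewrite mule_ge0 ?lee_fin ?(ltW (w0 x0))//.
      by apply: integral_ge0 => s _; rewrite lee_fin normc_ge0.
    - apply: emeasurable_funM => //.
      apply: (@measurable_fun_fubini_tonelli_F _ _ _ _ _ mu (fun z => (normc (F z))%:E)) => //.
        by apply/measurable_EFinP; exact: measurable_normc.
      by move=> z; rewrite lee_fin normc_ge0.
    - apply: emeasurable_funM => //; apply/measurable_EFinP.
      by case: Wkk => _ mW _ _ _; apply: (measurableT_comp mW); have [] := mpres_sub x.
    move=> t _; have [t0|t0] := leP 0 t; last first.
      rewrite integral0_eq ?mul0e; last by move=> s _; rewrite Flt0// normc0.
      by rewrite mule_ge0// lee_fin; case: Wkk.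
    have Wk0 : 0 <= Wk (x - t) by case: Wkk.
    have := slice_le_majorant_modulus Wll fP t0; rewrite -/(yl t) => le2.
    apply: le_trans (lee_wpmul2l _ le2); last by rewrite lee_fin.
    have -> : (\int[mu]_s (normc (F (t, s)))%:E =
        (normc (k (x - t)))%:E * \int[mu]_s (normc (l (t - s) * f s))%:E)%E.
      rewrite -ge0_integralZl//.
      - by apply: eq_integral => s _; rewrite /F/= [LHS]/= normcM EFinM.
      - by apply/measurable_EFinP; apply: measurable_normc; exact: cmeasurable_slice.
      - by move=> s _; rewrite lee_fin normc_ge0.
      - by rewrite lee_fin normc_ge0.
    rewrite muleAC -EFinM [leRHS]muleA [leRHS]muleAC -[in leRHS]EFinM.
    apply: lee_wpmul2r; first by apply: integral_ge0 => s _; rewrite lee_fin normc_ge0.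
    by rewrite lee_fin; case: Wkk => _ _ _ _; apply.
  have := le_lt_trans le1 Yx.
  have : (0 <= \int[mu]_t \int[mu]_s (normc (F (t, s)))%:E)%E.
    by apply: integral_ge0 => t _; apply: integral_ge0 => s _; rewrite lee_fin normc_ge0.
  case: (\int[mu]_t _)%E => [r _ _|_|//]; first by rewrite ltry.
  by rewrite gt0_mulye// lte_fin w0.
transitivity (cintegral (fun t => cintegral (fun s => F (t, s)))).
  apply: ae_eq_cintegral.
  - apply: cmeasurable_slice => //; apply: cmeasurable_Pplus; exact: measurable_convolution.
  - exact: cmeasurable_cintegral.
  apply: filterS h2 => t ht; have [t0|t0] := ltP t 0.
    rewrite Pplus_lt0// mulr0; under eq_fun do rewrite Flt0//.
    by rewrite cintegral0.
  by rewrite Pplus_ge0// -cintegralZ//; exact: ht.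
rewrite (cFubini mF iF).
pose F' (z : mR * mR) := F (z.2, z.1).
have mF' : cmeas F' by apply: (cmeas_comp _ mF); exact: measurable_fun_pair.
have iF' : (\int[mu]_t \int[mu]_s (normc (F' (t, s)))%:E < +oo)%E.
  rewrite (fubini_tonelli (fun z => (normc (F' z))%:E))//.
    by apply/measurable_EFinP; exact: measurable_normc.
  by move=> z; rewrite lee_fin normc_ge0.
apply: ae_eq_cintegral.
- exact: (cmeasurable_cintegral mF').
- by apply: cmeasurable_slice => //; exact: measurable_convolution.
have h3 := ae_L1_slice mF' iF'; apply: filterS h3 => s js.
have [fs|fs] := eqVneq (f s) 0.
  rewrite fs mulr0 /F/=; under eq_fun do rewrite fs !mulr0.
  by rewrite cintegral0.
have jkl : L1 (fun t => k (x - t) * l (t - s)).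
  have := L1Z (f s)^-1 js; rewrite /F' /F/=; congr L1; apply/funext => t.
  by field.
have -> : cintegral (fun t => F (t, s)) = cintegral (fun t => k (x - t) * l (t - s)) * f s.
  by rewrite -cintegralZr//; congr cintegral; apply/funext => t; rewrite /F/= mulrA.
congr (_ * _); rewrite /convolution.
rewrite -(cintegral_mpres (f := fun u => k (x - s - u) * l u) (mpres_subr s)); last exact: cmeasurable_slice.
congr cintegral; apply/funext => t; congr (k _ * _); ring.
Qed.

Lemma convolutionC k l : cmeasurable k -> cmeasurable l ->
  convolution k l = convolution l k.
Proof.
move=> mk ml; apply/funext => x; rewrite /convolution.
rewrite -(cintegral_mpres (f := fun t => k (x - t) * l t) (mpres_sub x)); last exact: cmeasurable_slice.
by congr cintegral; apply/funext => t; rewrite mulrC subKr.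
Qed.

End dominated_kernels.

(** * Wiener--Hopf operators *)

Section Lpw_classes.
Context {R : realType}.
Local Notation mu := (@lebesgue_measure R).
Variables (p : R) (w : R -> R) (p1 : 1 <= p) (ww : weight w).
Local Notation Lpw := (Lpw p1 ww).
Implicit Types (u v : Lpw) (f : R -> R[i]).

Lemma aeI (P Q : R -> Prop) : {ae mu, forall x, P x} -> {ae mu, forall x, Q x} ->
  {ae mu, forall x, P x /\ Q x}.
Proof. by move=> hP hQ; apply: filterS2 hP hQ. Qed.

Lemma Lpw_mem u : (repr u : R -> R[i]) \in Lpw_fun p w.
Proof. exact: Lpw_valP. Qed.

Lemma Lpw_repr_lt0 u x : x < 0 -> repr u x = 0.
Proof. by have /Lpw_funE[h _ _] := Lpw_mem u; exact: h. Qed.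

Lemma Lpw_cmeasurable u : cmeasurable (repr u).
Proof. by have /Lpw_funE[] := Lpw_mem u. Qed.

Lemma Lpw_eqP u v : {ae mu, forall x, repr u x = repr v x} <-> u = v.
Proof.
split=> [uv|->]; last by apply: aeW.
by rewrite -[u]reprK -[v]reprK; apply/eqP/Lpw_pi_eqP.
Qed.

Lemma Lpw_repr_linear (a : R[i]) u v :
  {ae mu, forall x, repr (a *: u + v) x = a * repr u x + repr v x}.
Proof.
have E : a *: u + v = (\pi_(Lpw) (a *: repr u + repr v))%qT.
  by rewrite Lpw_piD -Lpw_scale_pi !reprK.
rewrite E; exact: Lpw_reprP.
Qed.

Lemma Lpw_norm_of f : f \in Lpw_fun p w -> Lpw_norm (Lpw_of p1 ww f) = fine (eLpw_norm p w f).
Proof. by move=> fP; rewrite /Lpw_of insubT Lpw_norm_pi. Qed.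

Lemma Lpw_norm_ge0 u : 0 <= Lpw_norm u.
Proof. by rewrite /Lpw_norm fine_ge0// Lnorm_ge0. Qed.

Lemma eLpw_norm_repr u : eLpw_norm p w (repr u) = (Lpw_norm u)%:E.
Proof. by rewrite /Lpw_norm fineK//; exact: eLpw_norm_fin. Qed.

Lemma Lpw_norm_le f (K : R) u : f \in Lpw_fun p w ->
  (eLpw_norm p w f <= K%:E * eLpw_norm p w (repr u))%E ->
  Lpw_norm (Lpw_of p1 ww f) <= K * Lpw_norm u.
Proof.
move=> fP; rewrite eLpw_norm_repr -EFinM Lpw_norm_of// -lee_fin => h.
rewrite fineK// ge0_fin_numE ?Lnorm_ge0//.
by apply: le_lt_trans h _; rewrite ltry.
Qed.

Lemma RLpw_normD u v : Lpw_norm (u + v) <= Lpw_norm u + Lpw_norm v.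
Proof. by have := Lpw_normD u v; rewrite -rmorphD lecR. Qed.

Lemma RLpw_normZ (a : R[i]) u : Lpw_norm (a *: u) = normc a * Lpw_norm u.
Proof. by have := Lpw_normZ a u; rewrite cnormE -rmorphM => /(congr1 (@complex.Re R)). Qed.

Section convolution_operators.
Variables (W : R -> R) (k : R -> R[i]).
Hypothesis Wk : kernel_dom w W k.

Let mk : cmeasurable k. Proof. by case: Wk. Qed.

Lemma wiener_hopf_repr u :
  {ae mu, forall x, repr (wiener_hopf p1 ww k u) x = Pplus (convolution k (repr u)) x}.
Proof. by apply: Lpw_ofP; apply: (Lpw_fun_convolution p1 ww Wk); exact: Lpw_mem. Qed.

Lemma wiener_hopf_norm u :
  Lpw_norm (wiener_hopf p1 ww k u) <= kernel_bound p W * Lpw_norm u.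
Proof.
apply: Lpw_norm_le; first by apply: (Lpw_fun_convolution p1 ww Wk); exact: Lpw_mem.
by apply: (eLpw_norm_convolution p1 ww Wk); exact: Lpw_mem.
Qed.

Lemma wiener_hopf_linear (a : R[i]) u v :
  wiener_hopf p1 ww k (a *: u + v) = a *: wiener_hopf p1 ww k u + wiener_hopf p1 ww k v.
Proof.
apply/Lpw_eqP.
have h1 := wiener_hopf_repr (a *: u + v).
have h2 := Lpw_repr_linear a (wiener_hopf p1 ww k u) (wiener_hopf p1 ww k v).
have h3 := aeI (wiener_hopf_repr u) (wiener_hopf_repr v).
have h5 := aeI (ae_L1_kernel_slice p1 ww Wk (Lpw_mem u)) (ae_L1_kernel_slice p1 ww Wk (Lpw_mem v)).
apply: filterS (aeI (aeI h1 h2) (aeI h3 h5)) => x [[-> ->] [[-> ->] [ju jv]]].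
have [x0|x0] := ltP x 0; first by rewrite !Pplus_lt0// mulr0 addr0.
rewrite !Pplus_ge0// /convolution -cintegralZ; last exact: ju.
rewrite -cintegralD; [|exact/L1Z/ju|exact: jv].
apply: ae_eq_cintegral.
- by apply: cmeasurable_slice => //; exact: Lpw_cmeasurable.
- apply: cmeasD; last by apply: cmeasurable_slice => //; exact: Lpw_cmeasurable.
  apply: cmeasM; first exact: cmeas_cst.
  by apply: cmeasurable_slice => //; exact: Lpw_cmeasurable.
by apply: filterS (Lpw_repr_linear a u v) => t ->; ring.
Qed.

Lemma wiener_hopf_congr u f : f \in Lpw_fun p w -> {ae mu, forall x, repr u x = f x} ->
  {ae mu, forall x, repr (wiener_hopf p1 ww k u) x = Pplus (convolution k f) x}.
Proof.
move=> fP uf; have [_ mf _] := (Lpw_funE p w f).1 fP.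
apply: filterS (wiener_hopf_repr u) => x ->; rewrite /Pplus; case: ifP => // x0.
apply: ae_eq_cintegral.
- by apply: cmeasurable_slice => //; exact: Lpw_cmeasurable.
- exact: cmeasurable_slice.
- by apply: filterS uf => t ->.
Qed.

End convolution_operators.

Lemma wiener_hopf_comp Wk Wl k l u : kernel_dom w Wk k -> kernel_dom w Wl l ->
  half_line_compatible k l ->
  {ae mu, forall x, repr (wiener_hopf p1 ww k (wiener_hopf p1 ww l u)) x =
    Pplus (convolution (convolution k l) (repr u)) x}.
Proof.
move=> hk hl kl.
have h1 := wiener_hopf_congr hk (Lpw_fun_convolution p1 ww hl (Lpw_mem u)) (wiener_hopf_repr hl u).
have h2 := convolutionA p1 ww hk hl kl (Lpw_mem u).
apply: filterS (aeI h1 h2) => x [-> h]; rewrite /Pplus; case: ifP => // x0.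
Qed.

Lemma wiener_hopf_compB Wk Wl Wm Wn k l m n u :
  kernel_dom w Wk k -> kernel_dom w Wl l -> kernel_dom w Wm m -> kernel_dom w Wn n ->
  half_line_compatible k l -> (forall x, convolution k l x = m x - n x) ->
  wiener_hopf p1 ww k (wiener_hopf p1 ww l u) = wiener_hopf p1 ww m u - wiener_hopf p1 ww n u.
Proof.
move=> hk hl hm hn kl klE; apply/Lpw_eqP.
have h0 := wiener_hopf_comp u hk hl kl.
have h1 := aeI (wiener_hopf_repr hm u) (wiener_hopf_repr hn u).
have h2 := Lpw_repr_linear (-1) (wiener_hopf p1 ww n u) (wiener_hopf p1 ww m u).
have h3 := aeI (ae_L1_kernel_slice p1 ww hm (Lpw_mem u)) (ae_L1_kernel_slice p1 ww hn (Lpw_mem u)).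
rewrite scaleN1r addrC in h2.
apply: filterS (aeI (aeI h0 h1) (aeI h2 h3)) => x [[-> [E1 E2]] [-> [jm jn]]].
rewrite {}E1 {}E2; have [x0|x0] := ltP x 0; first by rewrite !Pplus_lt0// mulr0 addr0.
rewrite !Pplus_ge0// mulN1r addrC /convolution -cintegralB; [|exact: jm|exact: jn].
by congr cintegral; apply/funext => t; rewrite -[cintegral _]/(convolution k l (x - t)) klE mulrBl.
Qed.

Lemma wiener_hopf_scale W k (a : R[i]) u : kernel_dom w W k ->
  wiener_hopf p1 ww (fun t => a * k t) u = a *: wiener_hopf p1 ww k u.
Proof.
move=> hk; have [mk mW W0 iW dW] := hk.
have hak : kernel_dom w (fun t => normc a * W t) (fun t => a * k t).
  split.
  - by apply: cmeasM => //; exact: cmeas_cst.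
  - exact: measurable_funM.
  - by move=> t; rewrite mulr_ge0// normc_ge0.
  - exact: RintegrableZl.
  - by move=> x t x0 t0; rewrite normcM -!mulrA ler_wpM2l ?normc_ge0// dW.
apply/Lpw_eqP; have h2 := Lpw_repr_linear a (wiener_hopf p1 ww k u) 0.
have h0 : {ae mu, forall x, repr (0 : Lpw) x = 0}.
  have h := Lpw_repr_linear (-1) (0 : Lpw) 0; rewrite scaler0 addr0 in h.
  by apply: filterS h => x; rewrite mulN1r addNr.
rewrite addr0 in h2.
apply: filterS (aeI (aeI (wiener_hopf_repr hak u) (wiener_hopf_repr hk u)) (aeI (aeI h2 h0) (ae_L1_kernel_slice p1 ww hk (Lpw_mem u)))).
move=> x [[-> E] [[-> ->] jk]]; rewrite {}E addr0.
have [x0|x0] := ltP x 0; first by rewrite !Pplus_lt0// mulr0.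
rewrite !Pplus_ge0// /convolution -cintegralZ; last exact: jk.
by congr cintegral; apply/funext => t; rewrite mulrA.
Qed.

Lemma bounded_linear_op (S : Lpw -> Lpw) (K : R) :
  (forall a u v, S (a *: u + v) = a *: S u + S v) ->
  (forall u, Lpw_norm (S u) <= K * Lpw_norm u) ->
  exists S' : {linear Lpw -> Lpw}, continuous S' /\ S' =1 S.
Proof.
move=> Slin SK.
pose L := GRing.isLinear.Build _ _ _ _ S Slin.
pose S' : {linear Lpw -> Lpw} := HB.pack S L.
exists S'; split => //.
apply: bounded_linear_continuous; apply/linear_boundedP.
exists K%:C; split; first by rewrite realE -[0]/(0%:C) !lecR; exact: le_total.
move=> r Kr u; rewrite !Lpw_normE.
apply: (@le_trans _ _ (K%:C * (Lpw_norm u)%:C)); first by rewrite -rmorphM lecR.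
by apply: ler_wpM2r; [rewrite -[0]/(0%:C) lecR Lpw_norm_ge0|exact: ltW].
Qed.

(** Composing operators of the same side convolves their kernels, so that
    [1 + T_r] inverts [1 - T_k] as soon as [delta + r] is the convolution inverse
    of [delta - k].  The scalar [a] rescales the spectral value 1. *)
Lemma wiener_hopf_regular Wk Wr k r (a : R[i]) : a != 0 ->
  kernel_dom w Wk k -> kernel_dom w Wr r ->
  half_line_compatible k r -> half_line_compatible r k ->
  (forall x, convolution k r x = r x - k x) ->
  ~ spectrum (wiener_hopf p1 ww (fun t => a * k t)) a.
Proof.
move=> a0 hk hr kr rk krE; rewrite /spectrum/= => ns; apply: ns.
have [mk _ _ _ _] := hk; have [mr _ _ _ _] := hr.
pose Tk := wiener_hopf p1 ww k; pose Tr := wiener_hopf p1 ww r.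
pose S u := - a^-1 *: (u + Tr u).
have Tlin := wiener_hopf_linear hk; have Rlin := wiener_hopf_linear hr.
have Slin b u v : S (b *: u + v) = b *: S u + S v.
  rewrite /S /Tr Rlin scalerA [b * _]mulrC -scalerA -scalerDr; congr (_ *: _).
  by rewrite scalerDr addrACA.
have SK u : Lpw_norm (S u) <= (normc a^-1 * (1 + kernel_bound p Wr)) * Lpw_norm u.
  rewrite /S RLpw_normZ normcN -mulrA ler_wpM2l ?normc_ge0//.
  apply: le_trans (RLpw_normD _ _) _; rewrite mulrDl mul1r lerD2l.
  exact: wiener_hopf_norm hr u.
have [S' [cS' S'E]] := bounded_linear_op Slin SK.
have [R' [_ R'E]] := bounded_linear_op Rlin (wiener_hopf_norm hr).
have [K' [_ K'E]] := bounded_linear_op Tlin (wiener_hopf_norm hk).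
have kr' x : convolution r k x = r x - k x by rewrite (convolutionC mr mk).
have KR u : K' (R' u) = R' u - K' u.
  by rewrite !K'E !R'E; exact: (wiener_hopf_compB u hk hr hr hk kr krE).
have RK u : R' (K' u) = R' u - K' u.
  by rewrite !K'E !R'E; exact: (wiener_hopf_compB u hr hk hr hk rk kr').
have TE u : wiener_hopf p1 ww (fun t => a * k t) u = a *: K' u.
  by rewrite (wiener_hopf_scale a _ hk) K'E.
have SE u : S' u = - a^-1 *: (u + R' u) by rewrite S'E /S /Tr R'E.
exists S'; split => // u.
- rewrite TE SE -scalerBr linearZ/= -scalerDr scalerA mulNr mulVf// scaleN1r linearB/= RK.
  rewrite (addrAC (R' u)) subrr sub0r (addrAC (K' u)) subrr sub0r.
  by rewrite opprK.
- rewrite TE SE linearZ/= linearD/= KR addrCA subrr addr0.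
  by rewrite !scaleNr !scalerN !scalerA mulfV// !scale1r opprK addrC addrK.
Qed.

End Lpw_classes.

(** * Windows, translations and growth exponents *)

Section windows.
Context {R : realType}.
Local Notation mu := (@lebesgue_measure R).
Local Notation mR := (measurableTypeR R).
Variables (p : R) (w : R -> R) (p1 : 1 <= p) (ww : weight w) (C : R).
Hypothesis wC : locally_doubling w C.
Local Notation Lpw := (Lpw p1 ww).
Implicit Types (u v : Lpw) (f : R -> R[i]).

Let p0 : 0 < p. Proof. exact: lt_le_trans p1. Qed.
Let C1 : 1 <= C. Proof. by case: wC. Qed.
Let C0 : 0 < C. Proof. exact: lt_le_trans C1. Qed.
Let w0 x : 0 <= x -> 0 < w x. Proof. by case: wC => _ + _; apply. Qed.

Definition window (y x : R) : bool := y <= x <= y + 1.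

Let wCl y x : 0 <= y -> window y x -> w x <= C * w y /\ w y <= C * w x.
Proof.
move=> y0 /andP[yx xy]; have [_ _ h] := wC.
have := h y (x - y) y0; rewrite (_ : y + (x - y) = x); last by ring.
apply.
by apply/andP; split; lra.
Qed.

Lemma Lpw_fun_window f (y M : R) : 0 <= y -> 0 <= M -> cmeasurable f ->
  (forall x, normc (f x) <= if window y x then M else 0) ->
  f \in Lpw_fun p w /\ (eLpw_norm p w f <= (M * (C * w y))%:E)%E.
Proof.
move=> y0 M0 mf fM.
have f0 x : x < 0 -> f x = 0.
  move=> x0; apply: eq0_normc; apply/eqP; rewrite eq_le normc_ge0 andbT.
  by have := fM x; rewrite /window ifF//; apply/negP => /andP[]; lra.
have wy := w0 y0.
have B0 : 0 <= M * (C * w y) by rewrite !mulr_ge0// ltW.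
have le : (eLpw_norm p w f <= (M * (C * w y))%:E)%E.
  rewrite eLpw_normE// -[leRHS]poweRe1 ?lee_fin// -(mulfV (p_neq0 p1)) poweRrM.
  apply: gt0_ler_poweR.
  - by rewrite invr_ge0 ltW.
  - rewrite in_itv/= leey andbT; apply: integral_ge0 => x _; by rewrite lee_fin powR_ge0.
  - by rewrite in_itv/= leey andbT ?poweR_EFin ?lee_fin ?powR_ge0 ?poweR_ge0.
  rewrite poweR_EFin.
  apply: (@le_trans _ _ (\int[mu]_x (if y <= x <= y + 1 then (M * (C * w y)) `^ p else 0)%:E)%E).
    apply: ge0_le_integral => //.
    - by move=> x _; rewrite lee_fin powR_ge0.
    - apply/measurable_EFinP; apply: (measurableT_comp (measurable_powR p)).
      exact: measurable_weighted_modulus.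
    - apply/measurable_EFinP; apply: measurable_fun_ifT => //; exact: measurable_in_itv.
    move=> x _; rewrite lee_fin /weighted_modulus; have := fM x; rewrite /window; case: ifP => [yx fx|_ fx].
      have x0 : 0 <= x by case/andP: yx => h _; exact: le_trans h.
      apply: ge0_ler_powR; rewrite ?nnegrE//; first exact: ltW.
        by rewrite mulr_ge0 ?normc_ge0// ltW// w0.
      apply: ler_pM; rewrite ?normc_ge0//; first exact/ltW/w0.
      exact: (wCl y0 yx).1.
    have -> : normc (f x) = 0 by apply/eqP; rewrite eq_le fx normc_ge0.
    by rewrite mul0r powR0// gt_eqF.
  have i1 := integrable_itv_cst ((M * (C * w y)) `^ p) y (y + 1).
  rewrite -[leLHS]fineK; last exact: (integrable_fin_num measurableT i1).
  rewrite -/(Rintegral _ _ _) Rintegral_itv_cst ?lerDl//.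
  by rewrite (_ : y + 1 - y = 1) ?mulr1//; ring.
split=> //; apply/Lpw_funE; split => //.
by apply: le_lt_trans le _; rewrite ltry.
Qed.

(** On a window the weight is comparable to its value at the left end, so that
    the norm of the space controls the unweighted [L^1] norm there. *)
Lemma window_integral_le_ereal f (y : R) : 0 <= y -> f \in Lpw_fun p w ->
  (\int[mu]_x (if window y x then normc (f x) else 0)%:E <=
    (2 * C / w y * fine (eLpw_norm p w f))%:E)%E.
Proof.
move=> y0 fP; have [f0 mf fy] := (Lpw_funE p w f).1 fP.
have wy := w0 y0.
pose v (x : mR) : \bar R := (weighted_modulus w f x)%:E.
pose K (x : mR) : \bar R := (if y <= x <= y + 1 then 1 else 0)%:E.
have mK : measurable_fun setT K.
  by apply/measurable_EFinP; apply: measurable_fun_ifT => //; exact: measurable_in_itv.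
have mv : measurable_fun setT v by apply/measurable_EFinP; exact: measurable_weighted_modulus.
have K0 t : (0 <= K t)%E by rewrite lee_fin; case: ifP.
have v0 t : (0 <= v t)%E by rewrite lee_fin; exact: weighted_modulus_ge0.
have iK := integrable_itv_cst 1 y (y + 1).
have IK : (\int[mu]_t K t <= 1%:E)%E.
  rewrite -[leLHS]fineK; last exact: (integrable_fin_num measurableT iK).
  rewrite -/(Rintegral _ _ _) Rintegral_itv_cst ?lerDl// lee_fin; lra.
have := weighted_average_powR p1 mK mv K0 v0 ltr01 IK.
have Kvp : (\int[mu]_t (K t * v t `^ p) <= \int[mu]_t (v t `^ p))%E.
  have mvp : measurable_fun setT (fun t => (v t `^ p)%E).
    exact: (measurableT_comp (@measurable_poweR R p) mv).
  apply: ge0_le_integral => //.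
  - by move=> t _; rewrite mule_ge0// poweR_ge0.
  - exact: emeasurable_funM.
  - move=> t _; rewrite /K; case: ifP => _; first by rewrite mul1e.
    by rewrite mul0e poweR_ge0.
set A := (\int[mu]_t (K t * v t))%E => h.
have A0 : (0 <= A)%E by apply: integral_ge0 => t _; exact: mule_ge0.
have {}h : (A <= 2%:E * eLpw_norm p w f)%E.
  rewrite eLpw_normE// -[leLHS]poweRe1// -{1}(mulfV (p_neq0 p1)) poweRrM.
  have -> : (2%:E : \bar R) = ((2 `^ p)%:E `^ p^-1)%E.
    by rewrite poweR_EFin -powRrM mulfV ?gt_eqF// powRr1.
  rewrite -poweRM ?lee_fin ?powR_ge0//; last by apply: integral_ge0 => t _; rewrite lee_fin powR_ge0.
  apply: gt0_ler_poweR.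
  - by rewrite invr_ge0 ltW.
  - by rewrite in_itv/= leey andbT poweR_ge0.
  - rewrite in_itv/= leey andbT mule_ge0 ?lee_fin ?powR_ge0//.
    by apply: integral_ge0 => t _; rewrite lee_fin powR_ge0.
  apply: le_trans h _; rewrite mulr1 mulr_powRB1//.
  by apply: lee_wpmul2l; rewrite ?lee_fin ?powR_ge0.
have mfw : measurable_fun setT (fun x => if window y x then normc (f x) else 0).
  apply: measurable_fun_ifT; [exact: measurable_in_itv|exact: measurable_normc|exact: measurable_cst].
have nfin : eLpw_norm p w f \is a fin_num by rewrite ge0_fin_numE// Lnorm_ge0.
have le1 : (\int[mu]_x (if window y x then normc (f x) else 0)%:E <= (C / w y)%:E * A)%E.
  rewrite /A -ge0_integralZl//; last 3 first.
  - exact: emeasurable_funM.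
  - by move=> t _; exact: mule_ge0.
  - by rewrite lee_fin divr_ge0// ltW.
  apply: ge0_le_integral => //.
  - by move=> t _; rewrite lee_fin; case: ifP => // _; exact: normc_ge0.
  - exact/measurable_EFinP.
  - by apply: emeasurable_funM => //; exact: emeasurable_funM.
  move=> t _; rewrite /K -/(window y t); case: ifP => [yt|_]; last by rewrite mul0e mule0.
  rewrite mul1e -EFinM lee_fin /weighted_modulus.
  have [_ h2] := wCl y0 yt.
  rewrite mulrCA ler_peMr ?normc_ge0//.
  by rewrite mulrAC ler_pdivlMr// mul1r.
apply: le_trans le1 _; rewrite [in leRHS]EFinM fineK//.
apply: (@le_trans _ _ ((C / w y)%:E * (2%:E * eLpw_norm p w f))%E).
  by apply: lee_wpmul2l => //; rewrite lee_fin divr_ge0// ltW.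
rewrite muleA -EFinM le_eqVlt; apply/orP; left; apply/eqP; congr (_%:E * _)%E; ring.
Qed.

Lemma integrable_window f (y : R) : 0 <= y -> f \in Lpw_fun p w ->
  mu.-integrable setT (fun x => (if window y x then normc (f x) else 0)%:E).
Proof.
move=> y0 fP; have [f0 mf _] := (Lpw_funE p w f).1 fP; apply/integrableP; split.
  apply/measurable_EFinP; apply: measurable_fun_ifT; [exact: measurable_in_itv|exact: measurable_normc|exact: measurable_cst].
apply: le_lt_trans (ltry _); apply: le_trans (window_integral_le_ereal y0 fP).
rewrite le_eqVlt; apply/orP; left; apply/eqP; apply: eq_integral => x _.
by rewrite gee0_abs// lee_fin; case: ifP => // _; exact: normc_ge0.
Qed.

Lemma window_integral_le f (y : R) : 0 <= y -> f \in Lpw_fun p w ->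
  \int[mu]_x (if window y x then normc (f x) else 0) <= 2 * C / w y * fine (eLpw_norm p w f).
Proof.
move=> y0 fP; rewrite -lee_fin /Rintegral fineK; last first.
  exact: (integrable_fin_num measurableT (integrable_window y0 fP)).
exact: window_integral_le_ereal.
Qed.

End windows.

Section shifts.
Context {R : realType}.
Local Notation mu := (@lebesgue_measure R).
Local Notation mR := (measurableTypeR R).
Variables (p : R) (w : R -> R) (p1 : 1 <= p) (ww : weight w).
Local Notation Lpw := (Lpw p1 ww).
Implicit Types (u v : Lpw) (f : R -> R[i]).

Let p0 : 0 < p. Proof. exact: lt_le_trans p1. Qed.
Let w0 x : 0 <= x -> 0 < w x. Proof. by have [_ h _] := ww; exact: h. Qed.

Definition shift_fun (t : R) f := Pplus (fun x => f (x - t)).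

(** [K] bounds the norm of the translation by [t], which may be negative. *)
Definition shift_bound (t K : R) := 0 <= K /\ forall x, 0 <= x -> 0 <= x - t -> w x <= K * w (x - t).

Lemma exists_shift_bound t : exists K, shift_bound t K.
Proof.
have [K K0 KP] := weight_ratio ww (normr_ge0 t).
exists K; split; first exact: ltW.
move=> x x0 xt; have [t0|t0] := leP 0 t.
  by have [h _] := KP (x - t) xt; rewrite ger0_norm// subrK in h.
by have [_ h] := KP x x0; rewrite ltr0_norm// in h.
Qed.

Lemma shift_fun_norm t K f : shift_bound t K -> f \in Lpw_fun p w ->
  shift_fun t f \in Lpw_fun p w /\ (eLpw_norm p w (shift_fun t f) <= K%:E * eLpw_norm p w f)%E.
Proof.
move=> [K0 tK] fP; have [f0 mf fy] := (Lpw_funE p w f).1 fP.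
have [mh _] := mpres_subr t.
have mF : cmeasurable (shift_fun t f).
  by apply: cmeasurable_Pplus; exact: (cmeas_comp mh mf).
have F0 x : x < 0 -> shift_fun t f x = 0 by exact: Pplus_lt0.
have le : (eLpw_norm p w (shift_fun t f) <= K%:E * eLpw_norm p w f)%E.
  rewrite !(eLpw_normE p ww)//.
  have -> : (K%:E = (K `^ p)%:E `^ p^-1)%E.
    by rewrite poweR_EFin -powRrM mulfV ?gt_eqF// powRr1.
  rewrite -poweRM ?lee_fin ?powR_ge0//; last by apply: integral_ge0 => x _; rewrite lee_fin powR_ge0.
  apply: gt0_ler_poweR.
  - by rewrite invr_ge0 ltW.
  - by rewrite in_itv/= leey andbT; apply: integral_ge0 => x _; rewrite lee_fin powR_ge0.
  - rewrite in_itv/= leey andbT mule_ge0 ?lee_fin ?powR_ge0//.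
    by apply: integral_ge0 => x _; rewrite lee_fin powR_ge0.
  have mwf : measurable_fun setT (fun x => (weighted_modulus w f x `^ p)%:E).
    apply/measurable_EFinP; apply: (measurableT_comp (measurable_powR p)).
    exact: measurable_weighted_modulus.
  rewrite -(integral_mpres (mpres_subr t) mwf) -ge0_integralZl//; last 3 first.
  - exact: (measurableT_comp (mwf : measurable_fun setT (_ : mR -> _)) mh).
  - by move=> x _; rewrite lee_fin powR_ge0.
  - by rewrite lee_fin powR_ge0.
  apply: ge0_le_integral => //.
  - by move=> x _; rewrite lee_fin powR_ge0.
  - apply/measurable_EFinP; apply: (measurableT_comp (measurable_powR p)).
    exact: measurable_weighted_modulus.
  - apply: emeasurable_funM => //.
    exact: (measurableT_comp (mwf : measurable_fun setT (_ : mR -> _)) mh).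
  move=> x _; rewrite -EFinM lee_fin -powRM//; last exact: weighted_modulus_ge0.
  apply: ge0_ler_powR; rewrite ?nnegrE.
  - exact: ltW.
  - exact: weighted_modulus_ge0.
  - by rewrite mulr_ge0//; exact: weighted_modulus_ge0.
  have wm0 y : 0 <= weighted_modulus w f y by exact: weighted_modulus_ge0.
  rewrite {1}/weighted_modulus; have [x0|x0] := leP 0 x; last first.
    by rewrite F0// normc0 mul0r mulr_ge0.
  rewrite /shift_fun Pplus_ge0//; have [xt|xt] := leP 0 (x - t); last first.
    by rewrite f0// normc0 mul0r mulr_ge0.
  by rewrite /weighted_modulus mulrCA ler_wpM2l ?normc_ge0// tK.
split => //; apply/Lpw_funE; split => //.
by apply: le_lt_trans le _; apply: lte_mul_pinfty => //; rewrite lee_fin.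
Qed.

Lemma shift_fun_in t f : f \in Lpw_fun p w -> shift_fun t f \in Lpw_fun p w.
Proof.
by move=> fP; have [K tK] := exists_shift_bound t; have [] := shift_fun_norm tK fP.
Qed.

Lemma shift_repr t u : {ae mu, forall x, repr (Lpw_shift p1 ww t u) x = shift_fun t (repr u) x}.
Proof. by apply: Lpw_ofP; apply: shift_fun_in; exact: Lpw_mem. Qed.

Lemma shift_norm t K u : shift_bound t K -> Lpw_norm (Lpw_shift p1 ww t u) <= K * Lpw_norm u.
Proof.
move=> tK; have [h1 h2] := shift_fun_norm tK (Lpw_mem u).
exact: Lpw_norm_le.
Qed.

Lemma shift_congr t u f : {ae mu, forall x, repr u x = f x} ->
  {ae mu, forall x, repr (Lpw_shift p1 ww t u) x = shift_fun t f x}.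
Proof.
move=> uf; apply: filterS (aeI (shift_repr t u) (ae_mpres (mpres_subr t) uf)) => x [-> E].
by rewrite /shift_fun /Pplus; case: ifP.
Qed.

Lemma shift_linear t (a : R[i]) u v :
  Lpw_shift p1 ww t (a *: u + v) = a *: Lpw_shift p1 ww t u + Lpw_shift p1 ww t v.
Proof.
apply/Lpw_eqP.
have h1 := shift_congr t (Lpw_repr_linear a u v).
have h2 := Lpw_repr_linear a (Lpw_shift p1 ww t u) (Lpw_shift p1 ww t v).
apply: filterS (aeI (aeI h1 h2) (aeI (shift_repr t u) (shift_repr t v))).
move=> x [[-> ->] [-> ->]]; rewrite /shift_fun /Pplus; case: ifP => // _.
by rewrite mulr0 addr0.
Qed.

Lemma shift0 t : Lpw_shift p1 ww t 0 = 0.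
Proof.
by have := shift_linear t (-1) 0 0; rewrite scaler0 addr0 scaleN1r addNr.
Qed.

Lemma shift_scale t (a : R[i]) u : Lpw_shift p1 ww t (a *: u) = a *: Lpw_shift p1 ww t u.
Proof. by have := shift_linear t a u 0; rewrite shift0 !addr0. Qed.

End shifts.

Section operator_norm.
Context {R : realType}.
Variables (p : R) (w : R -> R) (p1 : 1 <= p) (ww : weight w).
Local Notation Lpw := (Lpw p1 ww).

Lemma opnorm_set_sup (T : Lpw -> Lpw) K : 0 <= K ->
  (forall u, Lpw_norm (T u) <= K * Lpw_norm u) ->
  has_sup [set complex.Re `|T v| | v in [set v | `|v| <= 1]] /\ opnorm T <= K.
Proof.
move=> K0 TK.
have ub : ubound [set complex.Re `|T v| | v in [set v : Lpw | `|v| <= 1]] K.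
  move=> _ [v v1 <-]; rewrite -[complex.Re _]/(Lpw_norm (T v)) (le_trans (TK v))// ler_piMr//.
  by move: v1; rewrite /= Lpw_normE -[1]/(1%:C) lecR.
have ne : [set complex.Re `|T v| | v in [set v : Lpw | `|v| <= 1]] !=set0.
  by exists (complex.Re `|T 0|); exists 0 => //=; rewrite normr0 ler01.
by split; [split => //; exists K|exact: ge_sup].
Qed.

Lemma opnorm_ge (T : Lpw -> Lpw) K : 0 <= K ->
  (forall u, Lpw_norm (T u) <= K * Lpw_norm u) -> (forall a u, T (a *: u) = a *: T u) ->
  forall u, Lpw_norm (T u) <= opnorm T * Lpw_norm u.
Proof.
move=> K0 TK TZ u; have [hs _] := opnorm_set_sup K0 TK.
have [u0|u0] := eqVneq (Lpw_norm u) 0.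
  by rewrite u0 mulr0; have := TK u; rewrite u0 mulr0.
have up : 0 < Lpw_norm u by rewrite lt_neqAle eq_sym u0 Lpw_norm_ge0.
rewrite -ler_pdivrMr// mulrC.
have : [set complex.Re `|T v| | v in [set v : Lpw | `|v| <= 1]] (complex.Re `|T ((Lpw_norm u)^-1%:C *: u)|).
  exists ((Lpw_norm u)^-1%:C *: u) => //=.
  by rewrite Lpw_normE RLpw_normZ normcC ger0_norm ?invr_ge0 ?Lpw_norm_ge0// mulVf// -[1]/(1%:C) lecR.
move=> /(sup_upper_bound hs); apply: le_trans.
rewrite -[complex.Re _]/(Lpw_norm (T _)) TZ RLpw_normZ normcC.
by rewrite ger0_norm ?invr_ge0 ?Lpw_norm_ge0.
Qed.

End operator_norm.

Section growth.
Context {R : realType}.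
Local Notation mu := (@lebesgue_measure R).
Local Notation mR := (measurableTypeR R).
Variables (p : R) (w : R -> R) (p1 : 1 <= p) (ww : weight w) (C : R).
Hypothesis wC : locally_doubling w C.
Local Notation Lpw := (Lpw p1 ww).
Local Notation shift := (Lpw_shift p1 ww).

Let C0 : 0 < C. Proof. by case: wC => /(lt_le_trans ltr01). Qed.
Let w0 x : 0 <= x -> 0 < w x. Proof. by case: wC => _ + _; apply. Qed.

Let bump (y x : R) : R[i] := if window y x then 1 else 0.

Let mbump y : cmeasurable (bump y).
Proof. by apply: cmeas_if; [exact: measurable_in_itv|exact: cmeas_cst|exact: cmeas_cst]. Qed.

Let bumpP y : 0 <= y -> bump y \in Lpw_fun p w /\ (eLpw_norm p w (bump y) <= (C * w y)%:E)%E.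
Proof.
move=> y0; have := Lpw_fun_window p1 ww wC y0 ler01 (mbump y).
rewrite mul1r; apply => x; rewrite /bump; case: ifP => _; by rewrite ?normc1 ?normc0.
Qed.

(** The indicator of a window is translated to the indicator of a window, and
    the norms of both are comparable to values of the weight. *)
Lemma opnorm_shift_lower (t y : R) : 0 <= y -> 0 <= y + t ->
  w (y + t) <= 2 * C ^+ 2 * opnorm (shift t) * w y.
Proof.
move=> y0 yt0.
have [b1 b2] := bumpP y0; have [b3 _] := bumpP yt0.
pose B := Lpw_of p1 ww (bump y).
have [K tK] := exists_shift_bound ww t.
have := opnorm_ge (proj1 tK) (fun u => shift_norm u tK) (@shift_scale R p w p1 ww t) B.
have hB : {ae mu, forall x, repr B x = bump y x} by exact: Lpw_ofP.
have hS := shift_congr t hB.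
have E : shift t B = Lpw_of p1 ww (bump (y + t)).
  apply/Lpw_eqP; apply: filterS (aeI hS (Lpw_ofP p1 ww b3)) => x [-> ->].
  rewrite /shift_fun /Pplus /bump /window; case: ifP => [x0|/negbT].
    by congr (if _ then _ else _); congr (_ && _); apply/idP/idP => ?; lra.
  by rewrite -ltNge => x0; rewrite ifF//; apply/negP => /andP[]; lra.
rewrite E Lpw_norm_of// => le1.
have le2 : Lpw_norm B <= C * w y.
  rewrite Lpw_norm_of// -lee_fin fineK//.
  by rewrite ge0_fin_numE ?Lnorm_ge0// (le_lt_trans b2)// ltry.
have op0 : 0 <= opnorm (shift t).
  have [hs _] := @opnorm_set_sup R p w p1 ww (shift t) K (proj1 tK) (fun u => shift_norm u tK).
  apply: (@le_trans _ _ (complex.Re `|shift t (0 : Lpw)|)); first exact: Lpw_norm_ge0.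
  have /= := sup_upper_bound hs; apply; exists 0 => //=; by rewrite normr0 ler01.
have := window_integral_le p1 ww wC yt0 b3.
rewrite (_ : \int[mu]_x _ = 1); last first.
  transitivity (\int[mu]_x (if y + t <= x <= y + t + 1 then 1 else 0)).
    apply: eq_Rintegral => x _; rewrite /bump /window; case: ifP => h; rewrite ?h; [exact: normc1|by rewrite ?normc0].
  by rewrite Rintegral_itv_cst ?lerDl// mul1r; ring.
have wyt := w0 yt0.
move=> le3.
have {}le3 : w (y + t) <= 2 * C * fine (eLpw_norm p w (bump (y + t))).
  by move: le3; rewrite mulrAC ler_pdivlMr// mul1r.
apply: (le_trans le3); rewrite expr2.
have := le_trans le1 (ler_wpM2l op0 le2) => le4.
have C20 : 0 <= 2 * C by rewrite mulr_ge0// ltW.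
have := ler_wpM2l C20 le4; lra.
Qed.

Lemma growth_right_eq (a : R) : exp_growth w a -> growth_right p1 ww = a.
Proof.
move=> [ga gb]; have C2 : 0 < 4 * C ^+ 2 by rewrite mulr_gt0// exprn_gt0.
rewrite /growth_right; apply: (exp_rate_lim (f := fun t => opnorm (shift t))).
  exists (4 * C ^+ 2)^-1; first by rewrite invr_gt0.
  move=> t t1; have t0 : 0 <= t by exact: le_trans t1.
  have [x x0 hx] := ga t t1; have wx := w0 x0.
  have xt0 : 0 <= x + t by rewrite addr_ge0.
  have h := opnorm_shift_lower x0 xt0.
  rewrite mulrC ler_pdivrMr// -(ler_pM2r wx).
  by apply: (le_trans hx); move: h; lra.
move=> b ab; have [D D0 hD] := gb b ab; exists D => // t t1.
have t0 : 0 <= t by exact: le_trans t1.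
have DE0 : 0 <= D * expR (b * t) by rewrite mulr_ge0 ?expR_ge0// ltW.
have tK : shift_bound w t (D * expR (b * t)).
  by split => // x x0 xt; have := hD (x - t) t xt t0; rewrite subrK.
by have [] := @opnorm_set_sup R p w p1 ww _ _ DE0 (fun u => shift_norm u tK).
Qed.

(** A left translation by [t] multiplies the weight by ratios [w x / w (x + t)],
    which are the right ratios of the inverse weight. *)
Lemma growth_left_eq (a : R) : exp_growth (fun x => (w x)^-1) a -> growth_left p1 ww = a.
Proof.
move=> [ga gb]; have C2 : 0 < 4 * C ^+ 2 by rewrite mulr_gt0// exprn_gt0.
rewrite /growth_left; apply: (exp_rate_lim (f := fun t => opnorm (shift (- t)))).
  exists (4 * C ^+ 2)^-1; first by rewrite invr_gt0.
  move=> t t1; have t0 : 0 <= t by exact: le_trans t1.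
  have [x x0 hx] := ga t t1; have wx := w0 x0.
  have xt0 : 0 <= x + t by rewrite addr_ge0.
  have wxt := w0 xt0.
  have x0' : 0 <= x + t + - t by rewrite addrK.
  have h := opnorm_shift_lower xt0 x0'; rewrite addrK in h.
  have {}hx : expR (a * t) * w (x + t) <= 2 * w x.
    by move: hx; rewrite ler_pdivrMr// mulrAC ler_pdivlMr.
  rewrite mulrC ler_pdivrMr// -(ler_pM2r wxt).
  by apply: (le_trans hx); move: h; lra.
move=> b ab; have [D D0 hD] := gb b ab; exists D => // t t1.
have t0 : 0 <= t by exact: le_trans t1.
have DE0 : 0 <= D * expR (b * t) by rewrite mulr_ge0 ?expR_ge0// ltW.
have tK : shift_bound w (- t) (D * expR (b * t)).
  split => // x x0; rewrite opprK => xt.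
  have := hD x t x0 t0; have wx := w0 x0; have wxt := w0 xt.
  by rewrite ler_pdivlMr// mulrC ler_pdivrMr.
by have [] := @opnorm_set_sup R p w p1 ww _ _ DE0 (fun u => shift_norm u tK).
Qed.

End growth.

Section commutation.
Context {R : realType}.
Local Notation mu := (@lebesgue_measure R).
Variables (p : R) (w : R -> R) (p1 : 1 <= p) (ww : weight w).
Variables (W : R -> R) (k : R -> R[i]).
Hypothesis Wk : kernel_dom w W k.
Local Notation Lpw := (Lpw p1 ww).
Local Notation shift := (Lpw_shift p1 ww).

Let mk : cmeasurable k. Proof. by case: Wk. Qed.

(** The two conditions say that nothing is lost in the truncations to the half
    line before and after the translation.  They hold for causal kernels and
    right translations, and for anticausal kernels and left translations. *)
Lemma wiener_hopf_shift (t : R) (u : Lpw) :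
  (forall x s, 0 <= x -> s < 0 -> 0 <= s - t -> k (x - s) = 0) ->
  (forall x s, 0 <= x -> x - t < 0 -> 0 <= s - t -> k (x - s) = 0) ->
  wiener_hopf p1 ww k (shift t u) = shift t (wiener_hopf p1 ww k u).
Proof.
move=> k1 k2; apply/Lpw_eqP.
have h1 := wiener_hopf_congr Wk (shift_fun_in p1 ww t (Lpw_mem u)) (shift_repr t u).
have h2 := shift_congr t (wiener_hopf_repr Wk u).
have mu' := Lpw_cmeasurable u.
apply: filterS (aeI h1 h2) => x [-> ->].
rewrite /shift_fun /Pplus; case: ifP => // x0.
transitivity (cintegral (fun s => k (x - s) * repr u (s - t))).
  congr cintegral; apply/funext => s; case: ifP => // /negbT; rewrite -ltNge => s0.
  rewrite mulr0; have [st|st] := leP 0 (s - t); first by rewrite (k1 x s x0 s0 st) mul0r.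
  by rewrite Lpw_repr_lt0// mulr0.
case: ifP => [xt|/negbT].
  rewrite /convolution -(cintegral_mpres (f := fun s => k (x - t - s) * repr u s) (mpres_subr t)).
    by congr cintegral; apply/funext => s; congr (k _ * _); ring.
  exact: cmeasurable_slice.
rewrite -ltNge => xt; rewrite -[RHS]cintegral0; congr cintegral; apply/funext => s.
have [st|st] := leP 0 (s - t); first by rewrite (k2 x s x0 xt st) mul0r.
by rewrite Lpw_repr_lt0// mulr0.
Qed.

End commutation.

(** * Approximate eigenvectors of the transposed operator *)

Lemma expR_decay_lt (R : realType) (C d : R) : 0 <= C -> 0 < d ->
  exists N : nat, C * expR (- d * N%:R) < 2^-1.
Proof.
move=> C0 d0; pose N := Num.bound (2 * C / d); exists N.
have hN : 2 * C / d < N%:R by apply: archi_boundP; rewrite divr_ge0 ?mulr_ge0// ltW.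
rewrite mulNr expRN -ltr_pdivlMr ?invr_gt0 ?expR_gt0// invrK mulrC.
have := expR_ge1Dx (d * N%:R); rewrite ltr_pdivrMr// in hN => h.
by rewrite ltr_pdivlMr//; nra.
Qed.

Section exponential_test_functions.
Context {R : realType}.
Local Notation mu := (@lebesgue_measure R).
Local Notation mR := (measurableTypeR R).

Variables (kap : R -> R[i]) (L G : R) (zeta lam : R[i]) (a A D : R).
Hypotheses (mkap : cmeasurable kap) (kap_supp : forall t, ~~ (- L <= t <= 0) -> kap t = 0)
  (kap_bnd : forall t, normc (kap t) <= G) (L0 : 0 < L) (A0 : 0 <= A) (D0 : 0 <= D).
(** [ell k] is the pairing with the [k]-th iterate of a would-be inverse of
    [T - lam], so that [ell_step] expresses one application of this inverse; the
    decay rate [a] comes from the weight, the factor [A] from its norm. *)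
Variable ell : nat -> (R -> R[i]) -> R[i].

(** Bounded functions with bounded support on the half line; they serve both as
    elements of the space and of its dual. *)
Definition test_function (h : R -> R[i]) := cmeasurable h /\
  exists (N : nat) (M : R), forall x, normc (h x) <= if 0 <= x < N%:R then M else 0.

Hypothesis ell_linear : forall k (c : R[i]) h1 h2, test_function h1 -> test_function h2 ->
  ell k (fun x => c * h1 x + h2 x) = c * ell k h1 + ell k h2.
Hypothesis ell_decay : forall k (n : nat) M h, 0 <= M -> cmeasurable h ->
  (forall x, normc (h x) <= if window n%:R x then M else 0) ->
  normc (ell k h) <= A ^+ k * D * expR (- a * n%:R) * M.
Hypothesis ell_step : forall k h, test_function h ->
  ell k h = ell k.+1 (fun x => Pplus (convolution kap h) x - lam * h x).
Hypothesis zeta_a : complex.Im zeta < a.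

Let G0 : 0 <= G. Proof. exact: le_trans (normc_ge0 _) (kap_bnd 0). Qed.

(** An intermediate rate: exponentials of rate [b] dominate the truncated
    [expi zeta] and are still summable against the decay of the functionals. *)
Let b := (complex.Im zeta + a) / 2.
Let q := expR (- (a - b)).

Let ba : b < a. Proof. by move: zeta_a; rewrite /b; lra. Qed.
Let zb : complex.Im zeta < b. Proof. by move: zeta_a; rewrite /b; lra. Qed.
Let q1 : q < 1. Proof. by move: ba; rewrite /q -expR0 ltr_expR; lra. Qed.
Let q0 : 0 < q. Proof. exact: expR_gt0. Qed.

Let D' := D * expR `|b| / (1 - q).

Lemma measurable_in_itvco (u v : R) : measurable_fun setT (fun x : mR => u <= x < v).
Proof.
apply: measurable_and; first by apply: measurable_fun_ler => //; exact: measurable_cst.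
by apply: measurable_fun_ltr => //; exact: measurable_cst.
Qed.

Let ell_sum k (N : nat) M h : 0 <= M -> cmeasurable h ->
  (forall x, normc (h x) <= if 0 <= x < N%:R then M * expR (b * x) else 0) ->
  normc (ell k h) <= A ^+ k * M * (D * expR `|b| * ((1 - q ^+ N) / (1 - q))).
Proof.
move=> M0 mh; elim: N h mh => [|N ih] h mh hM.
  have -> : A ^+ k * M * (D * expR `|b| * ((1 - q ^+ 0) / (1 - q))) = A ^+ k * D * expR (- a * 0%:R) * 0.
    by rewrite expr0 subrr mul0r !mulr0.
  apply: ell_decay => // x; rewrite if_same; have := hM x; rewrite ifF//.
  by apply/negP => /andP[x0]; rewrite ltNge x0.
pose h1 x := if 0 <= x < N%:R then h x else 0.
pose h2 x := if 0 <= x < N%:R then 0 else h x.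
have mh1 : cmeasurable h1 by apply: cmeas_if; [exact: measurable_in_itvco|exact: mh|exact: cmeas_cst].
have mh2 : cmeasurable h2 by apply: cmeas_if; [exact: measurable_in_itvco|exact: cmeas_cst|exact: mh].
have NS : N.+1%:R = N%:R + 1 :> R by rewrite -natr1.
have ebN (n : nat) x : 0 <= x < n%:R -> expR (b * x) <= expR (`|b| * n%:R).
  move=> /andP[x0 xn]; rewrite ler_expR (le_trans (ler_norm _))// normrM ler_wpM2l// ger0_norm//; exact: ltW.
have t1 : test_function h1.
  split => //; exists N, (M * expR (`|b| * N%:R)) => x; rewrite /h1; case: ifP => [xN|_]; last by rewrite normc0.
  apply: (@le_trans _ _ (M * expR (b * x))); last by rewrite ler_wpM2l// ebN.
  by have := hM x; rewrite ifT//; move: xN => /andP[-> /=]; rewrite NS; lra.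
have t2 : test_function h2.
  split => //; exists N.+1, (M * expR (`|b| * N.+1%:R)) => x.
  rewrite /h2; case: ifP => _.
    by rewrite normc0; case: ifP => // _; rewrite mulr_ge0// expR_ge0.
  apply: (le_trans (hM x)); case: ifP => // xN; by rewrite ler_wpM2l// ebN.
have E : h = fun x => 1 * h1 x + h2 x.
  by apply/funext => x; rewrite /h1 /h2 mul1r; case: ifP; rewrite ?addr0 ?add0r.
rewrite E ell_linear// mul1r; apply: (le_trans (le_normcD _ _)).
have le1 : normc (ell k h1) <= A ^+ k * M * (D * expR `|b| * ((1 - q ^+ N) / (1 - q))).
  apply: ih => // x; rewrite /h1; case: ifP => [xN|_]; last by rewrite normc0.
  by have := hM x; rewrite ifT//; move: xN => /andP[-> /=]; rewrite NS; lra.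
have le2 : normc (ell k h2) <= A ^+ k * D * expR (- a * N%:R) * (M * (expR `|b| * expR (b * N%:R))).
  apply: ell_decay => //; first by rewrite mulr_ge0// mulr_ge0// expR_ge0.
  move=> x; rewrite /h2; case: ifP => [_|/negbT xN].
    by rewrite normc0; case: ifP => // _; rewrite mulr_ge0// mulr_ge0// expR_ge0.
  apply: (le_trans (hM x)); case: ifP => [/andP[x0 xN1]|_].
    rewrite x0/= -leNgt in xN; rewrite ifT; last by rewrite /window xN -NS ltW.
    rewrite ler_wpM2l// -expRD ler_expR.
    rewrite (_ : b * x = b * (x - N%:R) + b * N%:R); last by ring.
    rewrite lerD2r (le_trans (ler_norm _))// normrM ler_piMr// ger0_norm; lra.
  by case: ifP => // _; rewrite mulr_ge0// mulr_ge0// expR_ge0.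
apply: (le_trans (lerD le1 le2)).
have -> : A ^+ k * D * expR (- a * N%:R) * (M * (expR `|b| * expR (b * N%:R))) =
    A ^+ k * M * (D * expR `|b| * q ^+ N).
  rewrite /q -expRM_natl (_ : N%:R * - (a - b) = - a * N%:R + b * N%:R) ?expRD; ring.
rewrite -mulrDr -mulrDr exprS le_eqVlt; apply/orP; left; apply/eqP; congr (_ * (_ * _)).
by field; rewrite subr_eq0 gt_eqF.
Qed.

(** Cutting [h] into unit windows gives a geometric series of ratio [q]. *)
Lemma ell_exponential_bound k (N : nat) M h : 0 <= M -> cmeasurable h ->
  (forall x, normc (h x) <= if 0 <= x < N%:R then M * expR (b * x) else 0) ->
  normc (ell k h) <= A ^+ k * M * D'.
Proof.
move=> M0 mh hM; apply: (le_trans (ell_sum k M0 mh hM)).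
rewrite ler_wpM2l//; first by rewrite mulr_ge0// exprn_ge0.
rewrite /D'  ler_wpM2l//; first by rewrite mulr_ge0// expR_ge0.
rewrite -[leRHS]mul1r ler_wpM2r// ?invr_ge0 ?subr_ge0 ?(ltW q1)//.
by rewrite lerBlDr lerDl exprn_ge0// ltW.
Qed.

Let e (N : nat) (x : R) : R[i] := if 0 <= x < N%:R then expi zeta x else 0.
Let m := fourier (fun t => kap (- t)) zeta.
(** The defect of the truncated exponential as an eigenvector. *)
Let r N x := Pplus (convolution kap (e N)) x - m * e N x.

Let me N : cmeasurable (e N).
Proof. by apply: cmeas_if; [exact: measurable_in_itvco|exact: cmeas_expi|exact: cmeas_cst]. Qed.

Let mr N : cmeasurable (r N).
Proof.
apply: cmeasB; last by apply: cmeasM; [exact: cmeas_cst|exact: me].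
by apply: cmeasurable_Pplus; apply: measurable_convolution.
Qed.

Let B := (G * L * expR (`|complex.Im zeta| * L) + normc m) * expR ((b - complex.Im zeta) * L).

Let B0 : 0 <= B.
Proof.
apply: mulr_ge0; last exact: expR_ge0.
apply: addr_ge0; last exact: normc_ge0.
apply: mulr_ge0; last exact: expR_ge0.
by apply: mulr_ge0 => //; exact: ltW.
Qed.

Let kap_e_bound N x : 0 <= x ->
  normc (convolution kap (e N) x) <= G * L * expR (`|complex.Im zeta| * L) * expR (complex.Im zeta * x).
Proof.
move=> x0; rewrite [leRHS](_ : _ = G * expR (`|complex.Im zeta| * L) * expR (complex.Im zeta * x) * (x + L - x)); last by ring.
rewrite -Rintegral_itv_cst; last by rewrite lerDl ltW.
apply: normc_cintegral_le; first exact: cmeasurable_slice.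
  exact: integrable_itv_cst.
move=> t; case: ifP => [/andP[xt tL]|/negbT xt]; last first.
  rewrite kap_supp ?mul0r ?normc0//; apply: contra xt => /andP[h1 h2]; apply/andP; split; lra.
rewrite normcM -mulrA; apply: ler_pM; rewrite ?normc_ge0//.
rewrite /e; case: ifP => _; last by rewrite normc0 mulr_ge0// expR_ge0.
rewrite normc_expi -expRD ler_expR (_ : complex.Im zeta * t = complex.Im zeta * (t - x) + complex.Im zeta * x); last by ring.
rewrite lerD2r (le_trans (ler_norm _))// normrM ler_wpM2l// ger0_norm; lra.
Qed.

Let kap_e_inner N x : 0 <= x -> x + L < N%:R -> convolution kap (e N) x = m * expi zeta x.
Proof.
move=> x0 xN; rewrite /m fourierE -cintegralZr; last first.
  apply: (@L1_bounded_support _ _ (G * expR (`|complex.Im zeta| * L)) 0 L).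
    apply: cmeasM; last exact: cmeas_expi.
    by have [mh _] := @mpresN R; exact: (cmeas_comp mh mkap).
  move=> t; case: ifP => [/andP[t0 tL]|/negbT tL]; last first.
    rewrite kap_supp ?mul0r ?normc0//; apply: contra tL => /andP[h1 h2]; apply/andP; split; lra.
  rewrite normcM; apply: ler_pM; rewrite ?normc_ge0// normc_expi ler_expR.
  rewrite (le_trans (ler_norm _))// normrM ler_wpM2l// ger0_norm; lra.
rewrite /convolution -(cintegral_mpres (mpresD x)); last exact: cmeasurable_slice.
congr cintegral; apply/funext => t.
have [tL|tL] := boolP (0 <= t <= L); last first.
  have k0 s : s = - t -> kap s = 0.
    by move=> ->; apply: kap_supp; apply: contra tL => /andP[h1 h2]; apply/andP; split; lra.
  by rewrite !k0 ?mul0r//; ring.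
rewrite /e ifT; last by move: tL => /andP[h1 h2]; apply/andP; split; lra.
by rewrite expiD -mulrA; congr (kap _ * _); ring.
Qed.

Let r_bound N x : normc (r N x) <=
  if 0 <= x < N%:R then B * expR (- (b - complex.Im zeta) * N%:R) * expR (b * x) else 0.
Proof.
rewrite /r; have [x0|x0] := ltP x 0.
  have xf : (0 <= x < N%:R) = false by rewrite leNgt x0.
  by rewrite Pplus_lt0// /e xf mulr0 subrr normc0.
rewrite Pplus_ge0//; have [xN|xN] := ltP x N%:R; last first.
  rewrite (_ : e N x = 0) ?mulr0 ?subr0; last by rewrite /e ltNge xN andbF.
  rewrite (_ : convolution _ _ _ = 0) ?normc0//.
  rewrite /convolution -[RHS]cintegral0; congr cintegral; apply/funext => t.
  rewrite /e; case: ifP => [/andP[t0 tN]|]; last by rewrite mulr0.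
  by rewrite kap_supp ?mul0r//; apply/negP => /andP[]; lra.
rewrite (_ : e N x = expi zeta x); last by rewrite /e x0 xN.
have [xL|xL] := ltP (x + L) N%:R.
  by rewrite kap_e_inner// subrr normc0 mulr_ge0 ?expR_ge0// mulr_ge0 ?expR_ge0.
apply: (le_trans (normcB _ _)); rewrite normcM normc_expi.
apply: (le_trans (lerD (kap_e_bound N x0) (lexx _))); rewrite -mulrDl /B.
rewrite -!mulrA; apply: ler_wpM2l.
  apply: addr_ge0; last exact: normc_ge0.
  apply: mulr_ge0 => //; apply: mulr_ge0; [exact: ltW|exact: expR_ge0].
rewrite -!expRD ler_expR.
have zb' : 0 <= b - complex.Im zeta by rewrite subr_ge0 ltW.
have : 0 <= x + L - N%:R by lra.
rewrite (_ : (complex.Im zeta + a) * (2^-1 * x) = b * x); last by rewrite /b mulrA.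
by move=> /(mulr_ge0 zb'); lra.
Qed.

(** The eigenvector relation gives [ell k (e N)] as [m - lam] times
    [ell k.+1 (e N)] up to the value at [r N].  The growth of [ell k] with [k]
    is beaten by the factor [m - lam], and the defect, supported near [N], is
    exponentially small for the functionals.  The cut at [N.+2] leaves a
    function supported in [[0, 1]] untouched. *)
Lemma exponential_test_small : normc (m - lam) * A <= 2^-1 ->
  exists N : nat, normc (ell 0 (e N.+2)) < 1.
Proof.
move=> cA; have [c cE] : exists c, c = normc (m - lam) by eexists.
have c0 : 0 <= c by rewrite cE normc_ge0.
have D'0 : 0 <= D'.
  by rewrite /D' divr_ge0 ?subr_ge0 ?(ltW q1)// mulr_ge0// expR_ge0.
have te N : test_function (e N).
  split => //; exists N, (expR (`|complex.Im zeta| * N%:R)) => x; rewrite /e; case: ifP => [|_]; last by rewrite normc0.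
  move=> /andP[x0 xN]; rewrite normc_expi ler_expR (le_trans (ler_norm _))// normrM ler_wpM2l// ger0_norm//; exact: ltW.
have tr N : test_function (r N).
  split => //; exists N, (B * expR (- (b - complex.Im zeta) * N%:R) * expR (`|b| * N%:R)) => x.
  apply: (le_trans (r_bound N x)); case: ifP => // /andP[x0 xN].
  apply: ler_wpM2l; first by rewrite mulr_ge0// expR_ge0.
  by rewrite ler_expR (le_trans (ler_norm _))// normrM ler_wpM2l// ger0_norm//; exact: ltW.
pose rho N := B * expR (- (b - complex.Im zeta) * N%:R) * D'.
have rho0 N : 0 <= rho N by rewrite mulr_ge0// mulr_ge0// expR_ge0.
have step k N : normc (ell k (e N)) <= c * normc (ell k.+1 (e N)) + A ^+ k.+1 * rho N.
  rewrite ell_step//.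
  rewrite (_ : (fun x => _) = fun x => (m - lam) * e N x + r N x); last by apply/funext => x; rewrite /r; ring.
  rewrite ell_linear//; apply: (le_trans (le_normcD _ _)); rewrite normcM -cE lerD2l.
  rewrite /rho mulrA; apply: (@ell_exponential_bound _ N) => //; by rewrite mulr_ge0// expR_ge0.
have iter N K : normc (ell 0 (e N)) <= c ^+ K * normc (ell K (e N)) + 2 * A * rho N * (1 - 2^-1 ^+ K).
  elim: K => [|K ih]; first by rewrite !expr0 subrr mulr0 addr0 mul1r.
  apply: (le_trans ih).
  have h1 := ler_wpM2l (exprn_ge0 K c0) (step K N).
  have h2 : c ^+ K * (A ^+ K.+1 * rho N) <= 2^-1 ^+ K * (A * rho N).
    rewrite [leLHS](_ : _ = (c * A) ^+ K * (A * rho N)); last by rewrite exprMn exprSr; ring.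
    apply: ler_wpM2r; first exact: mulr_ge0.
    by apply: lerXn2r; rewrite ?nnegrE ?mulr_ge0// cE.
  move: h1 h2; rewrite mulrDr mulrA -exprSr (exprSr 2^-1).
  move: (c ^+ K * normc (ell K (e N))) (c ^+ K.+1 * normc (ell K.+1 (e N))) (c ^+ K * (A ^+ K.+1 * rho N)) (2^-1 ^+ K) (rho N) => ? ? ? ? ?.
  lra.
have [N hN] : exists N, 2 * A * rho N.+2 < 2^-1.
  have C0 : 0 <= 2 * A * B * D' by do 3!apply: mulr_ge0 => //.
  have d0 : 0 < b - complex.Im zeta by rewrite subr_gt0.
  have [N hN] := expR_decay_lt C0 d0.
  exists N; apply: le_lt_trans hN.
  rewrite [leLHS](_ : _ = 2 * A * B * D' * expR (- (b - complex.Im zeta) * N.+2%:R)); last by rewrite /rho; ring.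
  apply: ler_wpM2l => //.
  rewrite ler_expR mulNr mulNr lerN2; apply: ler_wpM2l; first exact: ltW.
  by rewrite ler_nat !leqW.
have [K hK] : exists K : nat, D' * 2^-1 ^+ K < 2^-1.
  have ln2 : 0 < ln (2 : R) by rewrite ln_gt0// ltr1n.
  have [K hK] := expR_decay_lt D'0 ln2; exists K; move: hK.
  by rewrite mulNr expRN (mulrC (ln 2)) expRM_natl lnK ?posrE// -exprVn.
exists N; apply: (le_lt_trans (iter N.+2 K)).
have eK : normc (ell K (e N.+2)) <= A ^+ K * 1 * D'.
  apply: (@ell_exponential_bound _ N.+2) => // x; rewrite /e; case: ifP => [/andP[x0 _]|_]; last by rewrite normc0.
  by rewrite normc_expi mul1r ler_expR ler_wpM2r// ltW.
have le1 : c ^+ K * normc (ell K (e N.+2)) <= 2^-1 ^+ K * D'.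
  apply: (le_trans (ler_wpM2l (exprn_ge0 K c0) eK)); rewrite mulr1 mulrA -exprMn.
  by apply: ler_wpM2r => //; apply: lerXn2r; rewrite ?nnegrE ?mulr_ge0// cE.
have le2 : 2 * A * rho N.+2 * (1 - 2^-1 ^+ K) <= 2 * A * rho N.+2.
  rewrite ler_piMr//; by do 2!apply: mulr_ge0 => //.
rewrite (mulrC D') in hK; move: hK hN le1 le2; set u1 := c ^+ K * _; set u2 := 2^-1 ^+ K * D'.
set u3 := 2 * A * _ * _; set u4 := 2 * A * _; lra.
Qed.

End exponential_test_functions.

(** * Values of the symbol are spectral *)

Section test_functions.
Context {R : realType}.
Local Notation mu := (@lebesgue_measure R).
Local Notation mR := (measurableTypeR R).
Variables (p : R) (w : R -> R) (p1 : 1 <= p) (ww : weight w) (C : R).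
Hypothesis wC : locally_doubling w C.
Local Notation Lpw := (Lpw p1 ww).

(** Test functions are sums of functions supported in unit windows. *)
Lemma test_function_ind (P : (R -> R[i]) -> Prop) :
  (forall (n : nat) M h, 0 <= M -> cmeasurable h ->
     (forall x, normc (h x) <= if window n%:R x then M else 0) -> P h) ->
  (forall h1 h2, P h1 -> P h2 -> P (fun x => h1 x + h2 x)) ->
  forall h, test_function h -> P h.
Proof.
move=> Pw PD h [mh [N [M]]]; elim: N h mh => [|N ih] h mh hM.
  apply: (Pw 0 0) => // x; rewrite if_same; have := hM x; rewrite ifF//.
  by apply/negP => /andP[x0]; rewrite ltNge x0.
have M0 : 0 <= M.
  by have := hM 0; rewrite ifT; [apply: le_trans; exact: normc_ge0|rewrite lexx ltr0n].
rewrite (_ : h = fun x => (if 0 <= x < N%:R then h x else 0) + (if 0 <= x < N%:R then 0 else h x)); last first.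
  by apply/funext => x; case: ifP; rewrite ?addr0 ?add0r.
have NS : N.+1%:R = N%:R + 1 :> R by rewrite -natr1.
apply: PD.
  apply: ih; first by apply: cmeas_if; [exact: measurable_in_itvco|exact: mh|exact: cmeas_cst].
  move=> x; case: ifP => [/andP[x0 xN]|_]; last by rewrite normc0.
  by have := hM x; rewrite ifT// x0 NS; lra.
apply: (Pw N M) => //; first by apply: cmeas_if; [exact: measurable_in_itvco|exact: cmeas_cst|exact: mh].
move=> x; case: ifP => [_|/negbT xN]; first by rewrite normc0; case: ifP.
apply: (le_trans (hM x)); case: ifP => [/andP[x0 xN1]|_]; last by case: ifP.
by rewrite x0/= -leNgt in xN; rewrite ifT// /window xN -NS ltW.
Qed.

Lemma L1_Lpw_test f h : f \in Lpw_fun p w -> test_function h -> L1 (fun x => f x * h x).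
Proof.
move=> fP; have [f0 mf _] := (Lpw_funE p w f).1 fP.
apply: (@test_function_ind (fun h => L1 (fun x => f x * h x))) => [n M {}h M0 mh hM|h1 h2 j1 j2]; last first.
  by under eq_fun do rewrite mulrDr; exact: L1D.
apply: (L1_dominated (g := fun x => M * (if window n%:R x then normc (f x) else 0))).
- exact: cmeasM.
- exact: (RintegrableZl M (integrable_window p1 ww wC (ler0n _ n) fP)).
- move=> x; rewrite normcM mulrC; have := hM x; case: ifP => _ hx.
    by rewrite ler_wpM2r// normc_ge0.
  by rewrite mulr0 (_ : normc (h x) = 0) ?mul0r//; apply/eqP; rewrite eq_le hx normc_ge0.
Qed.

Lemma Lpw_funD f g : f \in Lpw_fun p w -> g \in Lpw_fun p w ->
  (fun x => f x + g x) \in Lpw_fun p w.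
Proof.
move=> fP gP; have [_ h] := Lpw_fun_submod_closed p1 ww.
by have := h 1 f g fP gP; rewrite scale1r.
Qed.

Lemma Lpw_fun_test h : test_function h -> h \in Lpw_fun p w.
Proof.
apply: (@test_function_ind (fun h => h \in Lpw_fun p w)) => [n M {}h M0 mh hM|h1 h2]; last exact: Lpw_funD.
by have [] := Lpw_fun_window p1 ww wC (ler0n _ n) M0 mh hM.
Qed.

Lemma Lpw_ofD (c : R[i]) f g : f \in Lpw_fun p w -> g \in Lpw_fun p w ->
  Lpw_of p1 ww (fun x => c * f x + g x) = c *: Lpw_of p1 ww f + Lpw_of p1 ww g.
Proof.
move=> fP gP; apply/Lpw_eqP.
have fgP : (fun x => c * f x + g x) \in Lpw_fun p w.
  by have [_ h] := Lpw_fun_submod_closed p1 ww; exact: (h c f g fP gP).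
have h1 := aeI (Lpw_ofP p1 ww fgP) (Lpw_repr_linear c (Lpw_of p1 ww f) (Lpw_of p1 ww g)).
have h2 := aeI (Lpw_ofP p1 ww fP) (Lpw_ofP p1 ww gP).
by apply: filterS (aeI h1 h2) => x [[-> ->] [-> ->]].
Qed.

Lemma cFubini_bounded (F H : mR * mR -> R[i]) M : cmeas F -> cmeas H ->
  (forall z, normc (H z) <= M) ->
  (\int[mu]_x \int[mu]_y (normc (F (x, y)))%:E < +oo)%E ->
  cintegral (fun x => cintegral (fun y => F (x, y) * H (x, y))) =
  cintegral (fun y => cintegral (fun x => F (x, y) * H (x, y))).
Proof.
move=> mF mH HM iF; apply: (@cFubini R (fun z => F z * H z)); first exact: cmeasM.
have M0 : 0 <= M by apply: le_trans (normc_ge0 _) (HM (0, 0)).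
have mn : measurable_fun setT (fun z => (normc (F z))%:E) by apply/measurable_EFinP; exact: measurable_normc.
have mI : measurable_fun setT (fun x : mR => (\int[mu]_y (normc (F (x, y)))%:E)%E).
  apply: (@measurable_fun_fubini_tonelli_F _ _ _ _ _ mu (fun z => (normc (F z))%:E)) => // z.
  by rewrite lee_fin normc_ge0.
apply: (@le_lt_trans _ _ (M%:E * \int[mu]_x \int[mu]_y (normc (F (x, y)))%:E)%E); last first.
  by apply: lte_mul_pinfty => //; rewrite ?lee_fin.
rewrite -ge0_integralZl//; last by move=> x _; apply: integral_ge0 => y _; rewrite lee_fin normc_ge0.
apply: ge0_le_integral => //.
- by move=> x _; apply: integral_ge0 => y _; rewrite lee_fin normc_ge0.
- apply: (@measurable_fun_fubini_tonelli_F _ _ _ _ _ mu (fun z => (normc (F z * H z))%:E)) => //.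
    by apply/measurable_EFinP; apply: measurable_normc; exact: cmeasM.
  by move=> z; rewrite lee_fin normc_ge0.
- exact: measurable_funeM.
move=> x _; have mFx := cmeas_pair1 mF x; have mHx := cmeas_pair1 mH x.
rewrite -ge0_integralZl//; last 2 first.
- by apply/measurable_EFinP; exact: measurable_normc.
- by move=> y _; rewrite lee_fin normc_ge0.
apply: ge0_le_integral => //.
- by move=> y _; rewrite lee_fin normc_ge0.
- by apply/measurable_EFinP; apply: measurable_normc; exact: cmeasM.
- by apply: measurable_funeM; apply/measurable_EFinP; exact: measurable_normc.
by move=> y _; rewrite -EFinM lee_fin normcM mulrC ler_wpM2r// normc_ge0.
Qed.

(** Fubini's theorem; it applies because only the restriction of [v] to a bounded
    interval meets the support of [h]. *)
Lemma convolution_transpose phi L G v h : cmeasurable phi ->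
  (forall t, ~~ (0 <= t <= L) -> phi t = 0) -> (forall t, normc (phi t) <= G) ->
  v \in Lpw_fun p w -> test_function h ->
  cintegral (fun x => Pplus (convolution phi v) x * h x) =
  cintegral (fun t => v t * Pplus (convolution (fun s => phi (- s)) h) t).
Proof.
move=> mphi phi0 phiG vP th; have [v0 mv _] := (Lpw_funE p w v).1 vP.
have [mh [N [M hM]]] := th.
have h0 x : ~~ (0 <= x < N%:R) -> h x = 0.
  move=> /negbTE xN; have := hM x; rewrite xN => hx.
  by apply: eq0_normc; apply/eqP; rewrite eq_le hx normc_ge0.
pose v1 t := v t * (if 0 <= t < N%:R then 1 else 0).
have tone : test_function (fun t : R => if 0 <= t < N%:R then 1 else 0).
  split; first by apply: cmeas_if; [exact: measurable_in_itvco|exact: cmeas_cst|exact: cmeas_cst].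
  by exists N, 1 => x; case: ifP => _; rewrite ?normc1 ?normc0.
have jv1 : L1 v1 by exact: L1_Lpw_test.
have jphi : L1 phi.
  by apply: (@L1_bounded_support _ _ G 0 L) => // t; case: ifP => // /negbT /phi0 ->; rewrite normc0.
have hM0 x : normc (h x) <= `|M|.
  by apply: (le_trans (hM x)); case: ifP => _; rewrite ?normr_ge0// ler_norm.
have v1E x t : 0 <= x < N%:R -> phi (x - t) * v1 t = phi (x - t) * v t.
  move=> /andP[x0 xN]; rewrite /v1; have [tN|tN] := boolP (0 <= t < N%:R); first by rewrite mulr1.
  have [t0|t0] := ltP t 0; first by rewrite (v0 _ t0) mul0r.
  rewrite (phi0 (x - t)); first by rewrite !mul0r.
  by apply: contra tN => /andP[h1 h2]; apply/andP; split; lra.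
transitivity (cintegral (fun x => cintegral (fun y => phi (x - y) * v1 y * h x))).
  congr cintegral; apply/funext => x; have [xN|xN] := boolP (0 <= x < N%:R); last first.
    by rewrite h0// mulr0; under eq_fun do rewrite mulr0; rewrite cintegral0.
  have /andP[x0 _] := xN.
  have E' : (fun t => phi (x - t) * v t) = fun t => phi (x - t) * v1 t.
    by apply/funext => t; rewrite v1E.
  rewrite Pplus_ge0// /convolution E' cintegralZr//.
  apply: (@L1_Mbounded _ _ _ G); [|by move=> t; exact: phiG|exact: jv1].
  by have [mm _] := mpres_sub x; exact: (cmeas_comp mm mphi).
transitivity (cintegral (fun t => cintegral (fun x => phi (x - t) * v1 t * h x))).
  have mF := conv_measurable measurable_subz mphi (L1_cmeasurable jv1).
  have iF := conv_integrable measurable_subz mpres_subr jphi jv1.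
  have mH : cmeas (fun z : mR * mR => h z.1) by exact: (cmeas_comp measurable_fst mh).
  exact: (cFubini_bounded mF mH (fun z : mR * mR => hM0 z.1) iF).
congr cintegral; apply/funext => t.
have [t0|t0] := ltP t 0.
  rewrite (v0 _ t0) mul0r -[RHS]cintegral0; congr cintegral; apply/funext => x.
  by rewrite /v1 (v0 _ t0) mul0r mulr0 mul0r.
rewrite Pplus_ge0//.
have jh : L1 (fun x => phi (- (t - x)) * h x).
  apply: (@L1_Mbounded _ _ _ G); [|by move=> x; exact: phiG|].
    by have [mm _] := mpres_sub t; have [mn _] := @mpresN R; exact: (cmeas_comp mm (cmeas_comp mn mphi)).
  have := @L1_bounded_support _ h `|M| 0 N%:R mh; apply => x.
  have := hM x; case: ifP => [/andP[x0 xN]|_] hx.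
    rewrite ifT; first exact: le_trans hx (ler_norm _).
    by apply/andP; split => //; exact: ltW.
  by apply: (le_trans hx); case: ifP.
rewrite /convolution -cintegralZ//.
congr cintegral; apply/funext => x.
have [hx|hx] := boolP (0 <= x < N%:R); last by rewrite (h0 _ hx) !mulr0.
by rewrite (v1E _ _ hx) opprB; ring.
Qed.

End test_functions.

Section reflected_convolution.
Context {R : realType}.
Local Notation mu := (@lebesgue_measure R).

Lemma test_function_reflected_convolution (phi h : R -> R[i]) (L G : R) : cmeasurable phi ->
  (forall t, ~~ (0 <= t <= L) -> phi t = 0) -> (forall t, normc (phi t) <= G) ->
  test_function h -> test_function (Pplus (convolution (fun t => phi (- t)) h)).
Proof.
move=> mphi phi0 phiG [mh [N [M hM]]].
have mk : cmeasurable (fun t => phi (- t)).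
  by have [mn _] := @mpresN R; exact: (cmeas_comp mn mphi).
split; first by apply: cmeasurable_Pplus; exact: measurable_convolution.
have G0 : 0 <= G by exact: le_trans (normc_ge0 _) (phiG 0).
exists N, (G * `|M| * (N%:R - 0)) => x.
have B0 : 0 <= G * `|M| * (N%:R - 0) by rewrite subr0; apply: mulr_ge0 => //; exact: mulr_ge0.
have [x0|x0] := ltP x 0; first by rewrite Pplus_lt0// normc0.
rewrite Pplus_ge0//; have [xN|xN] := ltP x N%:R.
  suff : normc (convolution (fun s => phi (- s)) h x) <= G * `|M| * (N%:R - 0) by [].
  rewrite -Rintegral_itv_cst//.
  apply: normc_cintegral_le; first exact: (cmeasurable_slice x mk mh).
    exact: integrable_itv_cst.
  move=> t; rewrite normcM; have := hM t; case: ifP => [/andP[t0 tN]|_] ht.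
    rewrite t0 (ltW tN)/=; apply: ler_pM; rewrite ?normc_ge0//.
    exact: le_trans ht (ler_norm _).
  rewrite (_ : normc (h t) = 0); last by apply/eqP; rewrite eq_le ht normc_ge0.
  by rewrite mulr0; case: ifP => // _; exact: mulr_ge0.
rewrite (_ : convolution _ _ _ = 0) ?normc0//.
rewrite /convolution -[RHS]cintegral0; congr cintegral; apply/funext => t.
have := hM t; case: ifP => [/andP[t0 tN] _|_ ht].
  by rewrite phi0 ?mul0r//; apply/negP => /andP[]; lra.
rewrite (_ : h t = 0) ?mulr0//.
by apply: eq0_normc; apply/eqP; rewrite eq_le ht normc_ge0.
Qed.

End reflected_convolution.

Section resolvent.
Context {R : realType}.
Local Notation mu := (@lebesgue_measure R).
Local Notation mR := (measurableTypeR R).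
Variables (p : R) (w : R -> R) (p1 : 1 <= p) (ww : weight w) (C : R).
Hypothesis wC : locally_doubling w C.
Local Notation Lpw := (Lpw p1 ww).
Local Notation shift := (Lpw_shift p1 ww).

Let C0 : 0 < C. Proof. by case: wC => /(lt_le_trans ltr01). Qed.
Let w0 x : 0 <= x -> 0 < w x. Proof. by case: wC => _ + _; apply. Qed.

Lemma exp_growth_nat (f : R -> R) a (n : nat) : 0 <= f 0 -> exp_growth f a ->
  exists2 x, 0 <= x & expR (a * n%:R) * f x <= 2 * f (x + n%:R).
Proof.
case: n => [|n] f0 [ga _]; last by apply: ga; rewrite ler1n.
by exists 0 => //; rewrite mulr0 expR0 addr0 mul1r ler_peMl// ler1n.
Qed.

Lemma pairing_bound (u : Lpw) h M y : 0 <= y -> cmeasurable h ->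
  (forall x, normc (h x) <= if window y x then M else 0) ->
  normc (cintegral (fun x => repr u x * h x)) <= M * (2 * C / w y) * Lpw_norm u.
Proof.
move=> y0 mh hM.
have M0 : 0 <= M.
  by have := hM y; rewrite ifT; [apply: le_trans; exact: normc_ge0|rewrite /window lexx lerDl ler01].
have iw := integrable_window p1 ww wC y0 (Lpw_mem u).
apply: (@le_trans _ _ (\int[mu]_x (M * (if window y x then normc (repr u x) else 0)))).
  apply: normc_cintegral_le; first by apply: cmeasM => //; exact: Lpw_cmeasurable.
    exact: RintegrableZl.
  move=> x; rewrite normcM mulrC; have := hM x; case: ifP => _ hx.
    by rewrite ler_wpM2r// normc_ge0.
  by rewrite mulr0 (_ : normc (h x) = 0) ?mul0r//; apply/eqP; rewrite eq_le hx normc_ge0.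
rewrite RintegralZl// -mulrA ler_wpM2l//.
exact: (window_integral_le p1 ww wC y0 (Lpw_mem u)).
Qed.

Lemma Lpw_norm_window (u : Lpw) f M y : 0 <= y -> 0 <= M -> cmeasurable f ->
  (forall x, normc (f x) <= if window y x then M else 0) ->
  {ae mu, forall x, repr u x = f x} -> Lpw_norm u <= M * (C * w y).
Proof.
move=> y0 M0 mf fM uf; have [fP h] := Lpw_fun_window p1 ww wC y0 M0 mf fM.
have -> : u = Lpw_of p1 ww f.
  by apply/Lpw_eqP; apply: filterS (aeI uf (Lpw_ofP p1 ww fP)) => x [-> ->].
rewrite Lpw_norm_of// -lee_fin fineK// ge0_fin_numE ?Lnorm_ge0//.
by apply: le_lt_trans h _; rewrite ltry.
Qed.

Variables (phi : R -> R[i]) (W : R -> R) (S : Lpw -> Lpw) (K : R) (lam : R[i]).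
Hypotheses (Wphi : kernel_dom w W phi) (K0 : 0 <= K).
Local Notation T := (wiener_hopf p1 ww phi).
Hypotheses (Slin : forall a u v, S (a *: u + v) = a *: S u + S v)
  (SK : forall u, Lpw_norm (S u) <= K * Lpw_norm u)
  (ST : forall u, S (T u - lam *: u) = u) (TS : forall u, T (S u) - lam *: S u = u).

Let mphi : cmeasurable phi. Proof. by case: Wphi. Qed.

(** Commuting with [T] passes to the inverse of [T - lam]. *)
Lemma inverse_shift t : (forall u, T (shift t u) = shift t (T u)) ->
  forall k u, iter k S (shift t u) = shift t (iter k S u).
Proof.
move=> Tt k u; elim: k => //= k ->; set v := iter k S u.
rewrite -[in LHS](TS v) -scaleNr addrC shift_linear -Tt scaleNr addrC.
exact: ST.
Qed.

Lemma inverse_iter_norm k u : Lpw_norm (iter k S u) <= K ^+ k * Lpw_norm u.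
Proof.
elim: k => [|k ih]; first by rewrite expr0 mul1r.
by rewrite /= exprS -mulrA (le_trans (SK _))// ler_wpM2l.
Qed.

Lemma inverse_iter_linear k c u v : iter k S (c *: u + v) = c *: iter k S u + iter k S v.
Proof. by elim: k => //= k ->. Qed.

(** Paired with the truncated exponential [expi (- z)], it gives exactly 1. *)
Let wave (z : R[i]) (x : R) : R[i] := if window 0 x then expi z x else 0.

Let mwave z : cmeasurable (wave z).
Proof. by apply: cmeas_if; [exact: measurable_in_itv|exact: cmeas_expi|exact: cmeas_cst]. Qed.

Let wave_bound z t x : normc (wave z (x - t)) <= if window t x then expR `|complex.Im z| else 0.
Proof.
have -> : window t x = window 0 (x - t) by apply/idP/idP => /andP[h1 h2]; apply/andP; split; lra.
rewrite /wave; case: ifP => [/andP[x0]|_]; last by rewrite normc0.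
rewrite add0r => x1; rewrite normc_expi ler_expR (le_trans (ler_norm _))// normrM ler_piMr//.
by rewrite ger0_norm.
Qed.

Let mshift (t : R) f : cmeasurable f -> cmeasurable (fun x => f (x - t)).
Proof. by move=> mf; have [mh _] := mpres_subr t; exact: (cmeas_comp mh mf). Qed.

Let test_wave z : test_function (wave z).
Proof.
split => //; exists 2, (expR `|complex.Im z|) => x; have := wave_bound z 0 x.
rewrite subr0 => h; apply: (le_trans h); case: ifP => [/andP[h1 h2]|_].
  by rewrite ifT// h1/=; lra.
by case: ifP => // _; exact: expR_ge0.
Qed.

Let wave_pairing z (N : nat) :
  cintegral (fun x => wave (- z) x * (if 0 <= x < N.+2%:R then expi z x else 0)) = 1.
Proof.
transitivity (cintegral (fun x : R => (if 0 <= x <= 0 + 1 then 1 else 0 : R)%:C)).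
  congr cintegral; apply/funext => x; rewrite /wave /window; case: ifP => [/andP[x0 x1]|_]; last by rewrite mul0r.
  rewrite ifT; last by rewrite x0/= (le_lt_trans x1)// add0r ltr1n.
  rewrite /expi -cexpD (_ : _ + _ = 0) ?cexp0//; ring.
by rewrite cintegral_realC Rintegral_itv_cst ?add0r// subr0 mulr1.
Qed.

(** The functionals are the pairings with the iterates [iter k S F].  Their decay
    on the window [[n, n + 1]] is seen after a right translation by a point [x0]
    at which the ratio [w (x0 + n) / w x0] is nearly maximal: translating costs
    [w x0] in the norm of [F] and gains [w (x0 + n)] in the pairing. *)
Lemma causal_spectral_inclusion L G a z : 0 < L ->
  (forall t, ~~ (0 <= t <= L) -> phi t = 0) -> (forall t, normc (phi t) <= G) ->
  exp_growth w a -> complex.Im z < a -> normc (fourier phi z - lam) * K <= 2^-1 -> False.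
Proof.
move=> L0 phi0 phiG wa za zK.
have Tshift t : 0 <= t -> forall u, T (shift t u) = shift t (T u).
  move=> t0 u; apply: (wiener_hopf_shift Wphi) => x s x0; first by move=> s0 st; exfalso; lra.
  by move=> xt st; apply: phi0; apply/negP => /andP[]; lra.
pose F := Lpw_of p1 ww (wave (- z)).
have hF : {ae mu, forall x, repr F x = wave (- z) x}.
  exact: Lpw_ofP (Lpw_fun_test p1 ww wC (test_wave _)).
pose ell k h := cintegral (fun x => repr (iter k S F) x * h x).
pose Mz := expR `|complex.Im (- z)|.
have Mz0 : 0 <= Mz by exact: expR_ge0.
(* a factor [C] from the norm of a wave, [2 * C] from the pairing, 2 from [exp_growth] *)
pose D := 4 * C ^+ 2 * Mz.
have D0 : 0 <= D by rewrite /D; apply: mulr_ge0 => //; apply: mulr_ge0 => //; exact: sqr_ge0.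
have mkap : cmeasurable (fun t => phi (- t)).
  by have [mh _] := @mpresN R; exact: (cmeas_comp mh mphi).
have [||||||N] := @exponential_test_small R (fun t => phi (- t)) L G z lam a K D mkap _ _ L0 K0 D0 ell _ _ _ za.
- by move=> t tL; apply: phi0; apply: contra tL => /andP[h1 h2]; apply/andP; split; lra.
- by move=> t; exact: phiG.
- move=> k c h1 h2 t1 t2; rewrite /ell.
  have j1 := L1_Lpw_test p1 ww wC (Lpw_mem (iter k S F)) t1.
  have j2 := L1_Lpw_test p1 ww wC (Lpw_mem (iter k S F)) t2.
  rewrite -cintegralZ// -cintegralD//; last exact: L1Z.
  by congr cintegral; apply/funext => x; ring.
- move=> k n M h M0 mh hM.
  have [x0 x00 wx0] := exp_growth_nat n (ltW (w0 (lexx 0))) wa.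
  have xn0 : 0 <= x0 + n%:R by rewrite addr_ge0.
  have E : ell k h = cintegral (fun x => repr (iter k S (shift x0 F)) x * h (x - x0)).
    rewrite (inverse_shift (Tshift _ x00)) /ell.
    have mu' := Lpw_cmeasurable (iter k S F).
    rewrite -(cintegral_mpres (f := fun x => repr (iter k S F) x * h x) (mpres_subr x0)); last exact: cmeasM.
    apply: ae_eq_cintegral.
    + by apply: cmeasM; apply: mshift.
    + by apply: cmeasM; [exact: Lpw_cmeasurable|exact: mshift].
    apply: filterS (shift_repr x0 (iter k S F)) => x ->; rewrite /shift_fun.
    have [x0'|x0'] := leP 0 x; first by rewrite Pplus_ge0.
    by rewrite Pplus_lt0// Lpw_repr_lt0//; lra.
  have hM' x : normc (h (x - x0)) <= if window (x0 + n%:R) x then M else 0.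
    have -> : window (x0 + n%:R) x = window n%:R (x - x0).
      by apply/idP/idP => /andP[h1 h2]; apply/andP; split; lra.
    exact: hM.
  have b1 := pairing_bound (iter k S (shift x0 F)) xn0 (mshift x0 mh) hM'.
  rewrite -E in b1; apply: (le_trans b1).
  have b2 : Lpw_norm (shift x0 F) <= Mz * (C * w x0).
    apply: (@Lpw_norm_window _ (shift_fun x0 (wave (- z)))) => //.
    + by apply: cmeasurable_Pplus; exact: mshift.
    + move=> x; rewrite /shift_fun; have [x0'|x0'] := leP 0 x; first by rewrite Pplus_ge0//; exact: wave_bound.
      by rewrite Pplus_lt0// normc0; case: ifP.
    + exact: shift_congr.
  have b3 := le_trans (inverse_iter_norm k _) (ler_wpM2l (exprn_ge0 k K0) b2).
  have wxn := w0 xn0; have wx := w0 x00.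
  have C2w : 0 <= M * (2 * C / w (x0 + n%:R)).
    by apply: mulr_ge0 => //; apply: divr_ge0; [apply: mulr_ge0 => //|]; exact: ltW.
  apply: (le_trans (ler_wpM2l C2w b3)).
  have key : w x0 / w (x0 + n%:R) <= 2 * expR (- a * n%:R).
    by rewrite ler_pdivrMr// mulNr expRN -mulrA (mulrC _^-1) mulrA ler_pdivlMr ?expR_gt0// mulrC.
  have P0 : 0 <= 2 * C ^+ 2 * Mz * K ^+ k * M.
    apply: mulr_ge0 => //; apply: mulr_ge0; last exact: exprn_ge0.
    by apply: mulr_ge0 => //; apply: mulr_ge0 => //; exact: sqr_ge0.
  have := ler_wpM2l P0 key; congr (_ <= _); rewrite /D; ring.
- move=> k h th; rewrite /ell.
  set u := iter k S F; pose v := iter k.+1 S F.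
  have uE : u = T v + (- lam) *: v by rewrite scaleNr /v iterS TS.
  have mh := proj1 th.
  have jT := L1_Lpw_test p1 ww wC (Lpw_fun_convolution p1 ww Wphi (Lpw_mem v)) th.
  have jv := L1_Lpw_test p1 ww wC (Lpw_mem v) th.
  transitivity (cintegral (fun x => Pplus (convolution phi (repr v)) x * h x - lam * (repr v x * h x))).
    apply: ae_eq_cintegral.
    + by apply: cmeasM => //; exact: Lpw_cmeasurable.
    + exact: L1_cmeasurable (L1B jT (L1Z lam jv)).
    have h1 := Lpw_repr_linear (- lam) v (T v).
    rewrite addrC -uE in h1.
    by apply: filterS (aeI h1 (wiener_hopf_repr Wphi v)) => x [-> ->]; ring.
  have tr := convolution_transpose p1 ww wC mphi phi0 phiG (Lpw_mem v) th.
  have jP := L1_Lpw_test p1 ww wC (Lpw_mem v) (test_function_reflected_convolution mphi phi0 phiG th).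
  have E1 := cintegralB jT (L1Z lam jv); rewrite /= tr (cintegralZ lam jv) in E1.
  rewrite E1 -(cintegralZ lam jv) -cintegralB//; last exact: L1Z.
  by congr cintegral; apply/funext => x; ring.
- by under [X in fourier X]eq_fun do rewrite opprK.
rewrite (_ : ell 0 _ = 1) ?normc1 ?ltxx//.
rewrite -(wave_pairing z N) /ell /=; apply: ae_eq_cintegral.
- apply: cmeasM; first exact: Lpw_cmeasurable.
  by apply: cmeas_if; [exact: measurable_in_itvco|exact: cmeas_expi|exact: cmeas_cst].
- apply: cmeasM; first exact: mwave.
  by apply: cmeas_if; [exact: measurable_in_itvco|exact: cmeas_expi|exact: cmeas_cst].
by apply: filterS hF => x ->.
Qed.

(** The roles are exchanged: the test function is now moved by the iterates of
    [S] and paired with a fixed wave, so that no transposition is needed.  A test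
    function on [[n, n + 1]] is the left translate by [x0] of one on
    [[x0 + n, x0 + n + 1]]. *)
Lemma anticausal_spectral_inclusion L G a z : 0 < L ->
  (forall t, ~~ (- L <= t <= 0) -> phi t = 0) -> (forall t, normc (phi t) <= G) ->
  exp_growth (fun x => (w x)^-1) a -> - a < complex.Im z ->
  normc (fourier phi z - lam) * K <= 2^-1 -> False.
Proof.
move=> L0 phi0 phiG wa za zK.
have Tshift t : t <= 0 -> forall u, T (shift t u) = shift t (T u).
  move=> t0 u; apply: (wiener_hopf_shift Wphi) => x s x0; last by move=> xt; exfalso; lra.
  by move=> s0 st; apply: phi0; apply/negP => /andP[]; lra.
pose F h := Lpw_of p1 ww h.
have FP h : test_function h -> {ae mu, forall x, repr (F h) x = h x}.
  by move=> th; exact: Lpw_ofP (Lpw_fun_test p1 ww wC th).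
pose ell k h := cintegral (fun x => repr (iter k S (F h)) x * wave z x).
pose Mz := expR `|complex.Im z|.
have Mz0 : 0 <= Mz by exact: expR_ge0.
pose D := 4 * C ^+ 2 * Mz.
have D0 : 0 <= D by rewrite /D; apply: mulr_ge0 => //; apply: mulr_ge0 => //; exact: sqr_ge0.
have za' : complex.Im (- z) < a by rewrite (_ : complex.Im (- z) = - complex.Im z); [move: za; lra|case: (z)].
have jw (u : Lpw) : L1 (fun x => repr u x * wave z x) by exact: (L1_Lpw_test p1 ww wC (Lpw_mem u) (test_wave z)).
have [||||N] := @exponential_test_small R phi L G (- z) lam a K D mphi phi0 phiG L0 K0 D0 ell _ _ _ za'.
- move=> k c h1 h2 t1 t2; rewrite /ell /F.
  rewrite (Lpw_ofD p1 ww c (Lpw_fun_test p1 ww wC t1) (Lpw_fun_test p1 ww wC t2)).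
  rewrite inverse_iter_linear -(cintegralZ c (jw _)) -cintegralD; [|exact/L1Z/jw|exact: jw].
  apply: ae_eq_cintegral; [exact: L1_cmeasurable (jw _)|exact: L1_cmeasurable (L1D (L1Z c (jw _)) (jw _))|].
  by apply: filterS (Lpw_repr_linear c (iter k S (Lpw_of p1 ww h1)) (iter k S (Lpw_of p1 ww h2))) => x ->; ring.
- move=> k n M h M0 mh hM.
  have wn0 x : 0 <= x -> 0 < (w x)^-1 by move=> x0; rewrite invr_gt0 w0.
  have [x0 x00 wx0] := exp_growth_nat n (ltW (wn0 0 (lexx 0))) wa.
  have xn0 : 0 <= x0 + n%:R by rewrite addr_ge0.
  have wxn := w0 xn0; have wx := w0 x00.
  have C2w : 0 <= Mz * (2 * C / w x0).
    by apply: mulr_ge0 => //; apply: divr_ge0; [apply: mulr_ge0 => //|]; exact: ltW.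
  have key : w (x0 + n%:R) / w x0 <= 2 * expR (- a * n%:R).
    rewrite mulNr expRN ler_pdivlMr ?expR_gt0// mulrC mulrCA mulrC -ler_pdivlMr//.
  have P0 : 0 <= 2 * C ^+ 2 * Mz * K ^+ k * M.
    apply: mulr_ge0 => //; apply: mulr_ge0; last exact: exprn_ge0.
    by apply: mulr_ge0 => //; apply: mulr_ge0 => //; exact: sqr_ge0.
  have th : test_function h.
    split => //; exists n.+2, M => x; apply: (le_trans (hM x)); case: ifP => [/andP[h1 h2]|_].
      by rewrite ifT// (le_trans (ler0n _ n) h1)/= (le_lt_trans h2)// -addn1 natrD ltrD2r ltr_nat.
    by case: ifP.
  have hM' x : normc (h (x - x0)) <= if window (x0 + n%:R) x then M else 0.
    have -> : window (x0 + n%:R) x = window n%:R (x - x0).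
      by apply/idP/idP => /andP[h1 h2]; apply/andP; split; lra.
    exact: hM.
  have [hP _] := Lpw_fun_window p1 ww wC xn0 M0 (mshift x0 mh) hM'.
  pose v := Lpw_of p1 ww (fun x => h (x - x0)).
  have hv : {ae mu, forall x, repr v x = h (x - x0)} by exact: Lpw_ofP.
  have Fv : F h = shift (- x0) v.
    apply/Lpw_eqP; apply: filterS (aeI (FP h th) (shift_congr (- x0) hv)) => x [-> ->].
    rewrite /shift_fun; have [x1|x1] := leP 0 x; first by rewrite Pplus_ge0// opprK addrK.
    rewrite Pplus_lt0//; apply: eq0_normc; apply/eqP; rewrite eq_le normc_ge0 andbT.
    have := hM x; rewrite ifF//; apply/negP => /andP[h1 _].
    by have := le_trans (ler0n R n) h1; lra.
  have E : ell k h = cintegral (fun x => repr (iter k S v) x * wave z (x - x0)).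
    rewrite /ell Fv inverse_shift; last by apply: Tshift; rewrite oppr_le0.
    rewrite -(cintegral_mpres (f := fun x => repr (iter k S v) x * wave z (x - x0)) (mpresD x0)); last first.
      by apply: cmeasM; [exact: Lpw_cmeasurable|apply: mshift; exact: mwave].
    apply: ae_eq_cintegral.
    + by apply: cmeasM; [exact: Lpw_cmeasurable|exact: mwave].
    + apply: cmeasM; last by under eq_fun do rewrite addrK; exact: mwave.
      by have [mm _] := mpresD x0; exact: (cmeas_comp mm (Lpw_cmeasurable _)).
    apply: filterS (shift_repr (- x0) (iter k S v)) => x ->; rewrite /shift_fun addrK.
    have [x1|x1] := leP 0 x; first by rewrite Pplus_ge0// opprK.
    rewrite /wave (_ : window 0 x = false) ?mulr0//.
    by apply/negP => /andP[]; lra.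
  have b1 := pairing_bound (iter k S v) x00 (mshift x0 (mwave z)) (wave_bound z x0).
  rewrite E; apply: (le_trans b1).
  have b2 : Lpw_norm v <= M * (C * w (x0 + n%:R)).
    exact: (Lpw_norm_window xn0 M0 (mshift x0 mh) hM' hv).
  have b3 := le_trans (inverse_iter_norm k _) (ler_wpM2l (exprn_ge0 k K0) b2).
  apply: (le_trans (ler_wpM2l C2w b3)).
  have := ler_wpM2l P0 key; congr (_ <= _); rewrite /D; ring.
- move=> k h th; rewrite /ell iterSr; suff -> : S (F (fun x => Pplus (convolution phi h) x - lam * h x)) = F h by [].
  have hP := Lpw_fun_test p1 ww wC th.
  rewrite (_ : (fun x => _) = fun x => - lam * h x + Pplus (convolution phi h) x); last first.
    by apply/funext => y; rewrite mulNr addrC.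
  rewrite /F (Lpw_ofD p1 ww _ hP (Lpw_fun_convolution p1 ww Wphi hP)).
  rewrite (_ : Lpw_of p1 ww (Pplus _) = T (Lpw_of p1 ww h)); first by rewrite scaleNr addrC ST.
  apply/Lpw_eqP; apply: filterS (aeI (Lpw_ofP p1 ww (Lpw_fun_convolution p1 ww Wphi hP)) (wiener_hopf_congr Wphi hP (Lpw_ofP p1 ww hP))).
  by move=> y [-> ->].
- rewrite (_ : fourier _ (- z) = fourier phi z)//.
  rewrite !fourierE -(cintegral_mpres (f := fun t => phi t * expi z t) (@mpresN R)); last first.
    by apply: cmeasM => //; exact: cmeas_expi.
  congr cintegral; apply/funext => t; congr (_ * cexp _); rewrite rmorphN/=; ring.
rewrite (_ : ell 0 _ = 1) ?normc1 ?ltxx//.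
rewrite -(wave_pairing (- z) N) opprK /ell /=; apply: ae_eq_cintegral.
- apply: cmeasM; first exact: Lpw_cmeasurable; exact: mwave.
- apply: cmeasM; first exact: mwave.
  by apply: cmeas_if; [exact: measurable_in_itvco|exact: cmeas_expi|exact: cmeas_cst].
have te : test_function (fun x : R => if 0 <= x < N.+2%:R then expi (- z) x else 0).
  split; first by apply: cmeas_if; [exact: measurable_in_itvco|exact: cmeas_expi|exact: cmeas_cst].
  exists N.+2, (expR (`|complex.Im (- z)| * N.+2%:R)) => x; case: ifP => [/andP[x0 xN]|_]; last by rewrite normc0.
  by rewrite normc_expi ler_expR (le_trans (ler_norm _))// normrM ler_wpM2l// ger0_norm//; exact: ltW.
by apply: filterS (FP _ te) => x ->; rewrite mulrC.
Qed.

End resolvent.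

(** * Values away from the symbol are regular *)

Section kernels.
Context {R : realType}.
Local Notation mu := (@lebesgue_measure R).
Local Notation mR := (measurableTypeR R).

Lemma integrable_reflect (V : R -> R) : measurable_fun setT V ->
  mu.-integrable setT (fun t => (V t)%:E) -> mu.-integrable setT (fun t => (V (- t))%:E).
Proof.
move=> mV /integrableP[_ iV]; have [mn _] := @mpresN R; apply/integrableP; split.
  by apply/measurable_EFinP; exact: (measurableT_comp (mV : measurable_fun setT (_ : mR -> _)) mn).
rewrite (@integral_mpres R _ (fun t => `|(V t)%:E|%E) (@mpresN R))//.
by apply: measurableT_comp => //; exact/measurable_EFinP.
Qed.

(** The rate [c], strictly between [a] and [b], leaves a factor that is integrable. *)
Lemma kernel_dom_causal (w : R -> R) (a b D : R) (k : R -> R[i]) :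
  (forall x, 0 <= x -> 0 < w x) -> exp_growth w a -> a < b -> 0 <= D -> cmeasurable k -> causal k ->
  (forall t, 0 <= t -> normc (k t) <= D * expR (- b * t)) ->
  exists W, kernel_dom w W k.
Proof.
move=> w0 [_ wa] ab D0 mk k0 kD.
pose c := (a + b) / 2; have [ac cb] : a < c /\ c < b by rewrite /c; split; lra.
have [B B0 wB] := wa c ac.
have bc0 : 0 < b - c by rewrite subr_gt0.
exists (fun t => D * B * (if 0 <= t then expR (- (b - c) * t) else 0)); split => //.
- apply: measurable_funM => //; apply: measurable_fun_ifT; [|exact: measurable_expM|exact: measurable_cst].
  by apply: measurable_fun_ler => //; exact: measurable_cst.
- move=> t; apply: mulr_ge0; first by apply: mulr_ge0 => //; exact: ltW.
  by case: ifP => // _; exact: expR_ge0.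
- exact: RintegrableZl (integrable_exp_decay bc0).
move=> x t x0 t0; have wt := w0 t t0; have wx := w0 x x0.
case: ifP => [xt|/negbT]; last first.
  by rewrite -ltNge => xt; rewrite k0// normc0 mul0r mulr0 mul0r.
have := wB t (x - t) t0 xt; rewrite (_ : t + (x - t) = x); last by ring.
move=> h; have h' := ler_pM (normc_ge0 _) (ltW wx) (kD _ xt) h.
apply: (le_trans h'); rewrite (_ : - (b - c) * (x - t) = - b * (x - t) + c * (x - t)); last by ring.
rewrite expRD le_eqVlt; apply/orP; left; apply/eqP; ring.
Qed.

Lemma kernel_dom_anticausal (w : R -> R) (a b D : R) (k : R -> R[i]) :
  (forall x, 0 <= x -> 0 < w x) -> exp_growth (fun x => (w x)^-1) a -> a < b -> 0 <= D ->
  cmeasurable k -> causal k ->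
  (forall t, 0 <= t -> normc (k t) <= D * expR (- b * t)) ->
  exists W, kernel_dom w W (fun t => k (- t)).
Proof.
move=> w0 [_ wa] ab D0 mk k0 kD.
pose c := (a + b) / 2; have [ac cb] : a < c /\ c < b by rewrite /c; split; lra.
have [B B0 wB] := wa c ac.
have bc0 : 0 < b - c by rewrite subr_gt0.
pose V (t : R) := D * B * (if 0 <= t then expR (- (b - c) * t) else 0).
have mV : measurable_fun setT V.
  apply: measurable_funM => //; apply: measurable_fun_ifT; [|exact: measurable_expM|exact: measurable_cst].
  by apply: measurable_fun_ler => //; exact: measurable_cst.
have [mn _] := @mpresN R.
exists (fun t => V (- t)); split => //.
- exact: (cmeas_comp mn mk).
- exact: (measurableT_comp (mV : measurable_fun setT (_ : mR -> _)) mn).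
- move=> t; apply: mulr_ge0; first by apply: mulr_ge0 => //; exact: ltW.
  by case: ifP => // _; exact: expR_ge0.
- exact: integrable_reflect mV (RintegrableZl _ (integrable_exp_decay bc0)).
move=> x t x0 t0; have wt := w0 t t0; have wx := w0 x x0.
rewrite opprB /V; case: ifP => [xt|/negbT]; last first.
  by rewrite -ltNge => xt; rewrite k0// normc0 mul0r mulr0 mul0r.
have := wB x (t - x) x0 xt; rewrite (_ : x + (t - x) = t); last by ring.
move=> h.
have {}h : w x <= B * expR (c * (t - x)) * w t.
  by move: h; rewrite ler_pdivlMr// mulrC ler_pdivrMr.
have h' := ler_pM (normc_ge0 _) (ltW wx) (kD _ xt) h.
apply: (le_trans h'); rewrite (_ : - (b - c) * (t - x) = - b * (t - x) + c * (t - x)); last by ring.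
rewrite expRD le_eqVlt; apply/orP; left; apply/eqP; ring.
Qed.

End kernels.

Section symbol.
Context {R : realType}.
Local Notation mu := (@lebesgue_measure R).
Local Notation mR := (measurableTypeR R).
Variables (g : R -> R[i]) (L G : R).
Hypotheses (cg : ccontinuous g) (g_supp : forall t, ~~ (0 <= t <= L) -> g t = 0)
  (g_bnd : forall t, normc (g t) <= G) (L0 : 0 < L).

Let mg : cmeasurable g. Proof. exact: ccontinuous_cmeasurable. Qed.
Let G0 : 0 <= G. Proof. exact: le_trans (normc_ge0 _) (g_bnd 0). Qed.

Let expi_window (z : R[i]) t : 0 <= t <= L -> normc (expi z t) <= expR (`|complex.Im z| * L).
Proof.
move=> /andP[t0 tL]; rewrite normc_expi ler_expR (le_trans (ler_norm _))// normrM ler_wpM2l//.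
by rewrite ger0_norm.
Qed.

Lemma L1_symbol z : L1 (fun t => g t * expi z t).
Proof.
apply: (@L1_bounded_support _ _ (G * expR (`|complex.Im z| * L)) 0 L).
  by apply: cmeasM => //; exact: cmeas_expi.
move=> t; case: ifP => [tL|/negbT tL]; last by rewrite g_supp// mul0r normc0.
by rewrite normcM; apply: ler_pM; rewrite ?normc_ge0//; exact: expi_window.
Qed.

(** The symbol tends to 0 along the negative imaginary axis, so that 0 is always
    adherent to its values. *)
Lemma fourier_decay (s : R) : 0 < s -> normc (fourier g (0 +i* (- s))) <= G / s.
Proof.
move=> s0; rewrite fourierE.
pose f (t : mR) := if 0 <= t <= L then expR (s * t) else 0.
have mf : measurable_fun setT f.
  by apply: measurable_fun_ifT; [exact: measurable_in_itv|exact: measurable_expM|exact: measurable_cst].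
have fi := integrable_expM_window s 0 L.
have ifr : mu.-integrable setT (fun t => (f (L - t))%:E).
  have /integrableP[_ iV] := fi; have [mn _] := mpres_sub L; apply/integrableP; split.
    by apply/measurable_EFinP; exact: (measurableT_comp (mf : measurable_fun setT (_ : mR -> _)) mn).
  rewrite (@integral_mpres R _ (fun t => `|(f t)%:E|%E) (mpres_sub L))//.
  by apply: measurableT_comp => //; exact/measurable_EFinP.
apply: (@le_trans _ _ (\int[mu]_t (G * expR (- s * L) * f (L - t)))).
  apply: normc_cintegral_le.
  - exact: L1_cmeasurable (L1_symbol _).
  - exact: RintegrableZl.
  move=> t; rewrite normcM normc_expi /= /f; have [tL|tL] := boolP (0 <= t <= L); last first.
    rewrite g_supp// normc0 mul0r; apply: mulr_ge0; first by rewrite mulr_ge0// expR_ge0.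
    by case: ifP => // _; exact: expR_ge0.
  rewrite ifT; last by move: tL => /andP[h1 h2]; apply/andP; split; lra.
  rewrite -mulrA -expRD (_ : - s * L + s * (L - t) = - s * t); last by ring.
  by rewrite ler_wpM2r// expR_ge0.
rewrite RintegralZl// (Rintegral_mpres (mpres_sub L) mf) Rintegral_expM_window ?(ltW L0)//.
rewrite -mulrA ler_wpM2l// mulrA -[leRHS]mul1r ler_wpM2r ?invr_ge0 ?(ltW s0)//.
rewrite mulrBr mulNr -expRD addNr expR0 mulr1 lerBlDr lerDl; exact: expR_ge0.
Qed.

Lemma fourier_shift_imaginary (z : R[i]) (e : R) : 0 <= e ->
  normc (fourier g z - fourier g (z - (0 +i* e))) <= G * expR (`|complex.Im z| * L) * (e * L) * L.
Proof.
move=> e0; rewrite !fourierE -cintegralB; [|exact: L1_symbol|exact: L1_symbol].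
have jB := L1B (L1_symbol z) (L1_symbol (z - (0 +i* e))).
rewrite -[X in _ * X](subr0 L) -Rintegral_itv_cst ?(ltW L0)//.
apply: normc_cintegral_le; [exact: L1_cmeasurable jB|exact: integrable_itv_cst|].
move=> t; case: ifP => [tL|/negbT tL]; last by rewrite g_supp// !mul0r subrr normc0.
have -> : expi (z - (0 +i* e)) t = expi z t * (expR (- (e * t)))%:C.
  rewrite /expi (_ : - _ = - ('i * z * t%:C) + (- (e * t))%:C); last first.
    by case: (z) => ? ?; apply/eqP; rewrite eq_complex/=; apply/andP; split; apply/eqP; ring.
  rewrite cexpD; congr (_ * _); rewrite /cexp/= cos0 sin0.
  by apply/eqP; rewrite eq_complex/=; apply/andP; split; apply/eqP; ring.
rewrite (_ : g t * _ - _ = g t * (expi z t * (1 - expR (- (e * t)))%:C)); last by rewrite rmorphB/=; ring.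
move: (tL) => /andP[t0 tL'].
rewrite (normcM (g t)) (normcM (expi z t)) normcC -mulrA; apply: ler_pM; [exact: normc_ge0|by apply: mulr_ge0; [exact: normc_ge0|exact: normr_ge0]|exact: g_bnd|].
apply: ler_pM; [exact: normc_ge0|exact: normr_ge0|exact: expi_window|].
have et : e * t <= e * L by rewrite ler_wpM2l.
have et0 : 0 <= e * t by rewrite mulr_ge0.
rewrite ger0_norm; last by rewrite subr_ge0 -expR0 ler_expR oppr_le0.
have := expR_ge1Dx (- (e * t)); lra.
Qed.

(** The symbol of a kernel of bounded support is uniformly continuous on
    horizontal strips, so that the lower bound persists slightly beyond the
    half-plane, and [lam] is nonzero because the symbol tends to 0 downwards.
    The resolvent of [g / lam] then decays strictly faster than the weight may
    grow. *)
Lemma resolvent_beyond (a d : R) (lam : R[i]) : 0 < d ->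
  (forall z, complex.Im z < a -> d <= normc (lam - fourier g z)) ->
  lam != 0 /\ exists b psi D, [/\ a < b, ccontinuous psi, causal psi, 0 <= D &
    (forall t, normc (psi t) <= D * expR (- b * t)) /\
    forall x, convolution (fun t => lam^-1 * g t) psi x = psi x - lam^-1 * g x].
Proof.
move=> d0 gd.
have lam0 : lam != 0.
  apply/eqP => lam0; pose s := Num.max 1 (Num.max (1 - a) (2 * G / d)).
  have s1 : 1 <= s by rewrite /s !le_max lexx.
  have sa : 1 - a <= s by rewrite /s !le_max lexx !orbT.
  have sG : 2 * G / d <= s by rewrite /s !le_max lexx !orbT.
  have s0 : 0 < s by exact: lt_le_trans s1.
  have := gd (0 +i* (- s)); rewrite lam0 sub0r normcN => /(_ _)/le_trans-/(_ _ _ (fourier_decay s0)) /=.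
  have h : - s < a by lra.
  move=> /(_ h); rewrite ler_pdivlMr//; move: sG; rewrite ler_pdivrMr//; nra.
split => //.
have nl : 0 < normc lam by rewrite normc_gt0.
pose Q := G * expR ((`|a| + 1) * L) * L * L.
have Q0 : 0 <= Q by rewrite /Q; do 2!(apply: mulr_ge0; last exact: ltW); rewrite mulr_ge0// expR_ge0.
pose e := Num.min 1 (d / (4 * (Q + 1))).
have Q4 : 0 < 4 * (Q + 1) by lra.
have e0 : 0 < e by rewrite /e lt_min ltr01 divr_gt0.
have e1 : e <= 1 by rewrite /e ge_min lexx.
have eQ : 2 * e * Q <= d / 2.
  have : e <= d / (4 * (Q + 1)) by rewrite /e ge_min lexx orbT.
  by rewrite ler_pdivlMr//; nra.
have gd2 z : complex.Im z <= a + e -> d / 2 <= normc (lam - fourier g z).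
  move=> za; have [za'|za'] := ltP (complex.Im z) a; first by apply: le_trans (gd z za'); lra.
  (* a point at distance [2 * e] at which the bound is known *)
  pose z' := z - (0 +i* (2 * e)).
  have Iz' : complex.Im z' = complex.Im z - 2 * e by rewrite /z'; case: (z).
  have h1 : d <= normc (lam - fourier g z') by apply: gd; rewrite Iz'; lra.
  have e20 : 0 <= 2 * e by lra.
  have h2 := fourier_shift_imaginary z e20.
  have h3 : G * expR (`|complex.Im z| * L) * (2 * e * L) * L <= 2 * e * Q.
    rewrite [leLHS](_ : _ = 2 * e * (G * expR (`|complex.Im z| * L) * L * L)); last by ring.
    apply: ler_wpM2l => //; rewrite /Q; do 2!(apply: ler_wpM2r; first exact: ltW).
    apply: ler_wpM2l => //; rewrite ler_expR ler_wpM2r ?(ltW L0)// ler_norml.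
    have := ler_norm a; have := ler_norm (- a); rewrite normrN => n1 n2.
    by apply/andP; split; lra.
  have h4 : normc (lam - fourier g z') <= normc (lam - fourier g z) + normc (fourier g z - fourier g z').
    by apply: le_trans (le_normcD _ _); rewrite le_eqVlt; apply/orP; left; apply/eqP; congr normc; ring.
  by move: h2 h4; rewrite -/z'; lra.
pose gl t := lam^-1 * g t.
have cgl : ccontinuous gl.
  have [cr ci] := cg; split => x.
    rewrite (_ : (fun _ => _) = fun t => complex.Re lam^-1 * complex.Re (g t) - complex.Im lam^-1 * complex.Im (g t)).
      by apply: cvgB; apply: cvgM; [exact: cvg_cst|exact: cr|exact: cvg_cst|exact: ci].
    by apply/funext => t; rewrite /gl; case: (lam^-1) (g t) => ? ? [].
  rewrite (_ : (fun _ => _) = fun t => complex.Re lam^-1 * complex.Im (g t) + complex.Im lam^-1 * complex.Re (g t)).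
    by apply: cvgD; apply: cvgM; [exact: cvg_cst|exact: ci|exact: cvg_cst|exact: cr].
  by apply/funext => t; rewrite /gl; case: (lam^-1) (g t) => ? ? [].
have c0 : 0 < d / 2 / normc lam by rewrite !divr_gt0.
have gl_supp t : ~~ (0 <= t <= L) -> gl t = 0 by move=> tL; rewrite /gl g_supp// mulr0.
have gl_bnd t : normc (gl t) <= normc lam^-1 * G by rewrite /gl normcM ler_wpM2l// normc_ge0.
have glow (z : R[i]) : complex.Im z <= a + e -> d / 2 / normc lam <= normc (1 - fourier gl z).
  move=> za; rewrite ler_pdivrMr// -normcM (_ : _ * lam = lam - fourier g z); first exact: gd2.
  have -> : fourier gl z = lam^-1 * fourier g z.
    rewrite !fourierE -(cintegralZ _ (L1_symbol z)); congr cintegral.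
    by apply/funext => t; rewrite /gl mulrA.
  by field.
have [psi [D [cp psi0 D0 psiD psiE]]] := resolvent_kernel cgl gl_supp gl_bnd L0 c0 glow.
exists (a + e), psi, D; split => //; first by rewrite ltrDl.
by split=> // x; rewrite [in RHS]psiE addrAC subrr add0r.
Qed.

End symbol.

Section regularity.
Context {R : realType}.
Local Notation mu := (@lebesgue_measure R).
Variables (p : R) (w : R -> R) (p1 : 1 <= p) (ww : weight w).
Variables (phi : R -> R[i]) (L G a d : R) (lam : R[i]).
Hypotheses (cphi : ccontinuous phi) (phi_bnd : forall t, normc (phi t) <= G) (L0 : 0 < L) (d0 : 0 < d).

Let w0 x : 0 <= x -> 0 < w x. Proof. by have [_ h _] := ww; exact: h. Qed.

Lemma exp_decay_support (f : R -> R[i]) (B b : R) : (forall t, ~~ (0 <= t <= L) -> f t = 0) ->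
  (forall t, normc (f t) <= B) -> exists2 D, 0 <= D & forall t, 0 <= t -> normc (f t) <= D * expR (- b * t).
Proof.
move=> f0 fB; have B0 : 0 <= B by exact: le_trans (normc_ge0 _) (fB 0).
exists (B * expR (`|b| * L)); first by rewrite mulr_ge0// expR_ge0.
move=> t t0; have [tL|tL] := leP t L; last first.
  by rewrite f0 ?normc0 ?mulr_ge0 ?expR_ge0// t0/= -ltNge.
rewrite -mulrA -expRD (le_trans (fB t))// ler_peMr// -expR0 ler_expR.
have := ler_norm b; have nb := normr_ge0 b; nra.
Qed.

Lemma causal_regular : (forall t, ~~ (0 <= t <= L) -> phi t = 0) -> exp_growth w a ->
  (forall z, complex.Im z < a -> d <= normc (lam - fourier phi z)) ->
  ~ spectrum (wiener_hopf p1 ww phi) lam.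
Proof.
move=> phi0 wa pd.
have [lam0 [b [psi [D [ab cp psi0 D0 [psiD psiE]]]]]] := resolvent_beyond cphi phi0 phi_bnd L0 d0 pd.
pose g t := lam^-1 * phi t.
have mg : cmeasurable g by apply: cmeasM; [exact: cmeas_cst|exact: ccontinuous_cmeasurable].
have g0 t : ~~ (0 <= t <= L) -> g t = 0 by move=> tL; rewrite /g phi0// mulr0.
have gB t : normc (g t) <= normc lam^-1 * G by rewrite /g normcM ler_wpM2l// normc_ge0.
have gc : causal g by move=> t t0; apply: g0; rewrite leNgt t0.
have [D' D'0 gD] := exp_decay_support b g0 gB.
have [Wg hg] := kernel_dom_causal w0 wa ab D'0 mg gc gD.
have [Wp hp] := kernel_dom_causal w0 wa ab D0 (ccontinuous_cmeasurable cp) psi0 (fun t _ => psiD t).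
rewrite (_ : phi = fun t => lam * g t); last by apply/funext => t; rewrite /g mulVKf.
apply: (wiener_hopf_regular lam0 hg hp _ _ psiE) => x t s x0 t0 s0; right.
  by apply: psi0; lra.
by apply: gc; lra.
Qed.

Lemma anticausal_regular : (forall t, ~~ (- L <= t <= 0) -> phi t = 0) ->
  exp_growth (fun x => (w x)^-1) a ->
  (forall z, - a < complex.Im z -> d <= normc (lam - fourier phi z)) ->
  ~ spectrum (wiener_hopf p1 ww phi) lam.
Proof.
move=> phi0 wa pd.
pose phir t := phi (- t).
have cphir : ccontinuous phir.
  have [cr ci] := cphi; split=> x.
    by apply: (@continuous_comp _ _ _ -%R (fun t => complex.Re (phi t))); [exact: opp_continuous|exact: cr].
  by apply: (@continuous_comp _ _ _ -%R (fun t => complex.Im (phi t))); [exact: opp_continuous|exact: ci].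
have phir0 t : ~~ (0 <= t <= L) -> phir t = 0.
  by move=> tL; apply: phi0; apply: contra tL => /andP[h1 h2]; apply/andP; split; lra.
have mphi := ccontinuous_cmeasurable cphi.
have pd' z : complex.Im z < a -> d <= normc (lam - fourier phir z).
  move=> za; rewrite (_ : fourier phir z = fourier phi (- z)).
    by apply: pd; rewrite (_ : complex.Im (- z) = - complex.Im z) ?ltrN2//; case: (z).
  rewrite !fourierE -(cintegral_mpres (f := fun t => phi t * expi (- z) t) (@mpresN R)); last first.
    by apply: cmeasM => //; exact: cmeas_expi.
  congr cintegral; apply/funext => t; congr (_ * cexp _); rewrite rmorphN/=; ring.
have [lam0 [b [psi [D [ab cp psi0 D0 [psiD psiE]]]]]] :=
  resolvent_beyond cphir phir0 (fun t => phi_bnd (- t)) L0 d0 pd'.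
pose g t := lam^-1 * phir t.
have mg : cmeasurable g by apply: cmeasM; [exact: cmeas_cst|exact: ccontinuous_cmeasurable].
have g0 t : ~~ (0 <= t <= L) -> g t = 0 by move=> tL; rewrite /g phir0// mulr0.
have gB t : normc (g t) <= normc lam^-1 * G by rewrite /g normcM ler_wpM2l// ?normc_ge0//; exact: phi_bnd.
have gc : causal g by move=> t t0; apply: g0; rewrite leNgt t0.
have [D' D'0 gD] := exp_decay_support b g0 gB.
have [Wg hg] := kernel_dom_anticausal w0 wa ab D'0 mg gc gD.
have [Wp hp] := kernel_dom_anticausal w0 wa ab D0 (ccontinuous_cmeasurable cp) psi0 (fun t _ => psiD t).
rewrite (_ : phi = fun t => lam * g (- t)); last by apply/funext => t; rewrite /g /phir opprK mulVKf.
have E x : convolution (fun t => g (- t)) (fun t => psi (- t)) x = psi (- x) - g (- x).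
  rewrite -psiE /convolution -(cintegral_mpres (f := fun t => g (- x - t) * psi t) (@mpresN R)); last first.
    exact: (cmeasurable_slice _ mg (ccontinuous_cmeasurable cp)).
  by congr cintegral; apply/funext => t; congr (g _ * _); ring.
apply: (wiener_hopf_regular lam0 hg hp _ _ E) => x t s x0 t0 s0; left.
  by apply: gc; lra.
by apply: psi0; lra.
Qed.

End regularity.

(** * The spectrum *)

Section plane_topology.
Context {R : realType}.

Lemma closure_normcP (A : set R[i]) (l : R[i]) :
  closure A l <-> forall e : R, 0 < e -> exists2 z, A z & normc (z - l) < e.
Proof.
split=> [cl e e0|h B /nbhs_ballP[[er ei] /= e0 eB]].
  have e0' : 0 < e%:C by rewrite -[0]/(0%:C) ltcR.
  have [z [Az]] := cl _ (nbhsx_ballx l _ e0').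
  rewrite -ball_normE/= cnormE ltcR normc_subC => lz.
  by exists z.
have [ei0 er0] : ei = 0 /\ 0 < er by move: e0; rewrite ltcE/= => /andP[/eqP-> ->].
have [z Az zl] := h er er0; exists z; split => //; apply: eB.
by rewrite -ball_normE/= cnormE normc_subC ei0 ltcR.
Qed.

Lemma continuous_ccontinuous (f : R -> R[i]) : continuous f -> ccontinuous f.
Proof.
have ReB (z u : R[i]) : complex.Re (z - u) = complex.Re z - complex.Re u by case: z u => ? ? [].
have ImB (z u : R[i]) : complex.Im (z - u) = complex.Im z - complex.Im u by case: z u => ? ? [].
move=> cf; split=> x; apply/cvgrPdist_lt => e e0.
  have e0' : 0 < e%:C by rewrite -[0]/(0%:C) ltcR.
  move/cvgrPdist_lt : (cf x) => /(_ _ e0'); apply: filterS => t.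
  by rewrite cnormE ltcR; apply: le_lt_trans; rewrite -ReB normc_ge_normRe.
have e0' : 0 < e%:C by rewrite -[0]/(0%:C) ltcR.
move/cvgrPdist_lt : (cf x) => /(_ _ e0'); apply: filterS => t.
by rewrite cnormE ltcR; apply: le_lt_trans; rewrite -ImB normc_ge_normIm.
Qed.

Lemma continuous_bounded_on (f : R -> R) (K : set R) : continuous f -> compact K ->
  exists B, forall t, K t -> `|f t| <= B.
Proof.
move=> cf cK.
have /compact_bounded[M [_ hM]] := continuous_compact (continuous_subspaceT cf) cK.
exists (M + 1) => t Kt; apply: (hM (M + 1)); first by rewrite ltrDl.
by exists t.
Qed.

Lemma compact_support_window (f : R -> R[i]) : ccontinuous f -> compact (supp f) ->
  exists L G, [/\ 0 < L, forall t, L < `|t| -> f t = 0 & forall t, normc (f t) <= G].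
Proof.
move=> [cr ci] cK.
have out t : ~ supp f t -> f t = 0.
  by move=> nt; apply/eqP; apply/negPn/negP => ft; apply: nt; exact: subset_closure.
have [M [_ hM]] := compact_bounded cK.
have [A hA] := continuous_bounded_on cr cK; have [B hB] := continuous_bounded_on ci cK.
exists (Num.max 1 (M + 1)), (`|A| + `|B|); split.
- by rewrite lt_max ltr01.
- move=> t; rewrite gt_max => /andP[_ tM]; apply: out => st.
  have h : `|t| <= M + 1 by apply: (hM (M + 1)) => //; rewrite ltrDl.
  by rewrite leNgt tM in h.
move=> t; have [st|/out ->] := pselect (supp f t); last by rewrite normc0 addr_ge0.
apply: (le_trans (normc_le_normReIm _)); apply: lerD.
  by apply: le_trans (hA t st) (ler_norm _).
by apply: le_trans (hB t st) (ler_norm _).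
Qed.

End plane_topology.

Section linear_bound.
Context {R : realType}.
Variables (p : R) (w : R -> R) (p1 : 1 <= p) (ww : weight w).
Local Notation Lpw := (Lpw p1 ww).

Lemma continuous_linear_Lpw_bound (S : {linear Lpw -> Lpw}) : continuous S ->
  exists2 K, 0 < K & forall u, Lpw_norm (S u) <= K * Lpw_norm u.
Proof.
move=> cS; have /linear_boundedP[[kr ki] [kreal hk]] := (proj2 (linear_bounded_continuous S)) cS.
exists (`|kr| + 1); first by have := normr_ge0 kr; lra.
move=> u; have := hk (`|kr| + 1)%:C.
have ki0 : ki = 0 by have := RIm_real kreal => /= -[].
rewrite ki0 ltcR => /(_ _ u); rewrite !Lpw_normE -rmorphM lecR; apply.
by have := ler_norm kr; lra.
Qed.

End linear_bound.

Section closed_range.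
Context {R : realType}.

Lemma not_closure_separated (A : set R[i]) (f : R[i] -> R[i]) (l : R[i]) :
  ~ closure (f @` A) l -> exists2 d, 0 < d & forall z, A z -> d <= normc (l - f z).
Proof.
move=> ncl; apply: contrapT => nd; apply/ncl/closure_normcP => e e0.
apply: contrapT => nz; apply: nd; exists e => // z Az.
rewrite leNgt; apply/negP => lz; apply: nz; exists (f z); first by exists z.
by rewrite normc_subC.
Qed.

Variables (p : R) (w : R -> R) (p1 : 1 <= p) (ww : weight w).

(** A value of the closure is within [1 / (2 K)] of a value of the symbol, where
    [K] bounds the supposed inverse. *)
Lemma closure_sub_spectrum (A : set R[i]) (f : R[i] -> R[i]) (T : Lpw p1 ww -> Lpw p1 ww) :
  (forall lam (S : Lpw p1 ww -> Lpw p1 ww) K z, A z -> 0 <= K ->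
     (forall a u v, S (a *: u + v) = a *: S u + S v) ->
     (forall u, Lpw_norm (S u) <= K * Lpw_norm u) ->
     (forall u, S (T u - lam *: u) = u) -> (forall u, T (S u) - lam *: S u = u) ->
     normc (f z - lam) * K <= 2^-1 -> False) ->
  closure (f @` A) `<=` spectrum T.
Proof.
move=> H lam /closure_normcP cl [S [cS ST TS]].
have [K K0 SK] := continuous_linear_Lpw_bound cS.
have e0 : 0 < (2 * K)^-1 by rewrite invr_gt0 mulr_gt0.
have [_ [z Az <-] zl] := cl _ e0.
apply: (H lam S K z Az (ltW K0) (linearP S) SK ST TS).
have := ler_wpM2r (ltW K0) (ltW zl).
by rewrite invfM -mulrA mulVf ?gt_eqF// mulr1.
Qed.

End closed_range.

Theorem theorem5 (R : realType) (p : R) (p1 : 1 <= p)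
  (w : R -> R) (ww : weight w)
  (phi : R -> R[i]) (phi_cont : continuous phi) (phi_supp : compact (supp phi)) :
  (supp phi `<=` [set x : R | 0 <= x] ->
     closure (fourier phi @` [set z : R[i] | complex.Im z < growth_right p1 ww])
     = spectrum (wiener_hopf p1 ww phi)) /\
  (supp phi `<=` [set x : R | x <= 0] ->
     closure (fourier phi @` [set z : R[i] | - growth_left p1 ww < complex.Im z])
     = spectrum (wiener_hopf p1 ww phi)).
Proof.
have cphi := continuous_ccontinuous phi_cont.
have mphi := ccontinuous_cmeasurable cphi.
have [L [G [L0 phiL phiG]]] := compact_support_window cphi phi_supp.
have [C C1 wCl] := weight_local ww.
have [_ w0 _] := ww.
have wC : locally_doubling w C by split.
have out t : ~ supp phi t -> phi t = 0.
  by move=> nt; apply/eqP; apply/negPn/negP => ft; apply: nt; exact: subset_closure.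
split=> sphi.
- have [a wa] := exists_exp_growth wC.
  rewrite (growth_right_eq p1 ww wC wa).
  have phi0 t : ~~ (0 <= t <= L) -> phi t = 0.
    rewrite negb_and -!ltNge => /orP[t0|tL]; last by apply: phiL; exact: lt_le_trans tL (ler_norm _).
    by apply: out => /sphi/=; rewrite leNgt t0.
  rewrite eqEsubset; split.
    apply: closure_sub_spectrum => lam S K z /= za K0 Slin SK ST TS zK.
    have a1 : a < a + 1 by rewrite ltrDl.
    have [D D0 phiD] := exp_decay_support (a + 1) phi0 phiG.
    have phic : causal phi by move=> t t0; apply: phi0; rewrite leNgt t0.
    have [W hW] := kernel_dom_causal w0 wa a1 D0 mphi phic phiD.
    exact: (causal_spectral_inclusion wC hW K0 SK ST TS L0 phi0 phiG wa za zK).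
  move=> lam sl; apply: contrapT => /not_closure_separated[d d0 pd].
  exact: (causal_regular cphi phiG L0 d0 phi0 wa pd sl).
have [a wa] := exists_exp_growth (locally_doublingV wC).
rewrite (growth_left_eq p1 ww wC wa).
have phi0 t : ~~ (- L <= t <= 0) -> phi t = 0.
  rewrite negb_and -!ltNge => /orP[tL|t0].
    by apply: phiL; rewrite -normrN; apply: lt_le_trans (ler_norm _); rewrite ltrNr.
  by apply: out => /sphi/=; rewrite leNgt t0.
rewrite eqEsubset; split.
  apply: closure_sub_spectrum => lam S K z /= za K0 Slin SK ST TS zK.
  pose phir t := phi (- t).
  have phir0 t : ~~ (0 <= t <= L) -> phir t = 0.
    by move=> tL; apply: phi0; apply: contra tL => /andP[h1 h2]; apply/andP; split; lra.
  have a1 : a < a + 1 by rewrite ltrDl.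
  have [D D0 phiD] := exp_decay_support (a + 1) phir0 (fun t => phiG (- t)).
  have phic : causal phir by move=> t t0; apply: phir0; rewrite leNgt t0.
  have mphir : cmeasurable phir by have [mn _] := @mpresN R; exact: (cmeas_comp mn mphi).
  have [W hW] := kernel_dom_anticausal w0 wa a1 D0 mphir phic phiD.
  rewrite (_ : (fun t => phir (- t)) = phi) in hW; last by apply/funext => t; rewrite /phir opprK.
  exact: (anticausal_spectral_inclusion wC hW K0 Slin SK ST TS L0 phi0 phiG wa za zK).
move=> lam sl; apply: contrapT => /not_closure_separated[d d0 pd].
exact: (anticausal_regular cphi phiG L0 d0 phi0 wa pd sl).
Qed.
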